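(* Let $2\le m\le n+1$ be integers, $1\le q\le\infty$ and $\beta\in\mathbb R$. Suppose that there is a constant $C$ such that for every $\varepsilon>0$ and $C_H>0$ there exist a constant $C_\varepsilon$ (which may depend on $C_H$) and parameters $0<\delta_{\deg}\ll\delta\ll\varepsilon$ for which $$\|\mathcal Ef\|_{L^{q}(B^{n+1}(0,R),\,H\,dx)}\le C_\varepsilon\,E^C R^\varepsilon R^{\beta}\|f\|_2$$ holds for every $R\ge1$, every $E\ge R^\delta$, every transverse complete intersection $Z=Z(P_1,\dots,P_{n+1-m})\subset\mathbb R^{n+1}$ with $\deg P_i\le R^{\delta_{\deg}}$ for all $i$, every $f\in L^2(\mathbb R^n)$ with $\operatorname{supp}f\subset B^n(0,1)$ that is concentrated in wave packets from $\mathbb T_Z(E)$, and every weight function $H:\mathbb R^{n+1}\to[0,1]$ which is $n$-dimensional up to scale $\sqrt R$ with constant $C_H$. Then $$\beta\ \ge\ \max_{2\le k\le m}\ \left[\frac{n+k}{2}\left(\frac1q-\frac12\right)+\frac{k}{2(k+1)}\right].$$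
   Context: $B^d(x,r)$ is the ball in $\mathbb R^d$ with centre $x$ and radius $r$; $B_R=B^{n+1}(0,R)$, $2B_R=B^{n+1}(0,2R)$; $N_\rho(A)$ is the $\rho$-neighbourhood of a set $A$. $a\ll b$ means that $a$ is sufficiently small depending on $b$ and the dimensions (in particular $a<b$). $E$ denotes a positive number; $\mathcal E$ is the Fourier extension operator of the truncated paraboloid: for $x=(x',x_{n+1})\in\mathbb R^n\times\mathbb R$, $$\mathcal Ef(x)=\int_{B^n(0,1)}e^{i(x'\cdot\xi+x_{n+1}|\xi|^2)}f(\xi)\,d\xi .$$ A (measurable) weight $H:\mathbb R^{n+1}\to[0,1]$ is $\alpha$-dimensional up to scale $S$ with constant $C_H$ if $\int_{B^{n+1}(x,r)}H\le C_Hr^\alpha$ for all $x\in\mathbb R^{n+1}$, $1\le r\le S$. Also $\|F\|_{L^q(B,\,H\,dx)}$ is the $L^q$ norm on $B$ with respect to the measure $H\,dx$. $\mathrm{RapDec}(R)$ denotes any quantity bounded by $C_NR^{-N}$ for every (arbitrarily large) $N$, where the constants $C_N$ are independent of $R,E,Z,f,H$; the assumed estimate is understood to hold for any choice of such a sequence $(C_N)$, with constants allowed to depend on it. Wave packet decomposition at scale $R$ with parameter $\delta$. Cover $B^n(0,1)$ by finitely overlapping balls $\theta$ of radius $R^{-1/2}$ with centres $\omega_\theta\in B^n(0,1)$, and cover $\mathbb R^n$ by finitely overlapping balls of radius $\sim R^{(1+\delta)/2}$ with centres $\nu\in R^{(1+\delta)/2}\mathbb Z^n$; $\mathbb T$ is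 the set of pairs $(\theta,\nu)$. Take smooth partitions of unity $\{\psi_\theta\}$ on $B^n(0,1)$ and $\{\eta_\nu\}$ on $\mathbb R^n$ subordinate to these covers (with the natural derivative bounds, and $\psi_\theta$ supported in a slightly smaller concentric ball), and smooth $\tilde\psi_\theta$ supported in $\theta$ and equal to $1$ on a $cR^{-1/2}$-neighbourhood of $\operatorname{supp}\psi_\theta$. With $\mathcal Fg(y)=\int e^{iy\cdot\xi}g(\xi)\,d\xi$, set $f_{\theta,\nu}=\tilde\psi_\theta\,\mathcal F^{-1}\big(\eta_\nu\,\mathcal F(\psi_\theta f)\big)$. Then $f=\sum_{(\theta,\nu)\in\mathbb T}f_{\theta,\nu}+\mathrm{RapDec}(R)\|f\|_{L^2}$, $f_{\theta,\nu}$ is supported in $\theta$, and $\mathcal F f_{\theta,\nu}$ is essentially supported in a ball of radius $R^{1/2+\delta}$ around $\nu$. On $B_R$, $\mathcal Ef_{\theta,\nu}$ is essentially supported in $$T_{\theta,\nu}=\{(x',x_{n+1})\in B_R:\ |x'+2x_{n+1}\omega_\theta-\nu|\le R^{1/2+\delta}\},$$ a tube with direction $G(\theta)=\frac{(-2\omega_\theta,1)}{|(-2\omega_\theta,1)|}$. $Z(P_1,\dots,P_{n+1-m})$ is the common zero set in $\mathbb R^{n+1}$ of the real polynomials $P_1,\dots,P_{n+1-m}$; it is a transverse complete intersection if $\nabla P_1(x)\wedge\cdots\wedge\nabla P_{n+1-m}(x)\ne0$ at every point $x$ of it. (If $m=n+1$ there are no polynomials and $Z=\mathbb R^{n+1}$.)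 The tube $T_{\theta,\nu}$ is $ER^{-1/2}$-tangent to $Z$ if $T_{\theta,\nu}\subset N_{ER^{1/2}}(Z)\cap B_R$ and $\mathrm{Angle}(G(\theta),T_zZ)\le ER^{-1/2}$ for every non-singular point $z\in N_{2ER^{1/2}}(T_{\theta,\nu})\cap2B_R\cap Z$, where $T_zZ$ is the tangent space of $Z$ at $z$. Set $\mathbb T_Z(E)=\{(\theta,\nu)\in\mathbb T: T_{\theta,\nu}\text{ is }ER^{-1/2}\text{-tangent to }Z\}$. The function $f$ is concentrated in wave packets from $\mathbb T_Z(E)$ if $\sum_{(\theta,\nu)\notin\mathbb T_Z(E)}\|f_{\theta,\nu}\|_{L^2}\le\mathrm{RapDec}(R)\|f\|_{L^2}$. *)

(* Defs.v *)
(* Points of R^n are row vectors 'rV[R]_n; balls are closed, neighbourhoods of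
   sets are open. *)
From HB Require Import structures.
From mathcomp Require Import all_boot all_order all_algebra.
From mathcomp Require Import all_classical all_reals all_analysis.
From mathcomp Require Import measurable_realfun complex.
From mathcomp Require mpoly.
Set Implicit Arguments.
Unset Strict Implicit.
Unset Printing Implicit Defensive.
Import Order.TTheory GRing.Theory Num.Def Num.Theory.
Import numFieldNormedType.Exports.
Local Open Scope classical_set_scope.
Local Open Scope ring_scope.

(* Product sigma-algebra on row vectors, hence the Borel sets of R^n. *)
Section rV_measurable.
Context {d} {T : sigmaRingType d} (n : nat).

Let coord : 'I_n -> 'rV[T]_n -> T := fun i v => v ord0 i.

Let rV_set0 : g_sigma_preimage coord set0.
Proof. exact: sigma_algebra0. Qed.

Let rV_setC A : g_sigma_preimage coord A -> g_sigma_preimage coord (~` A).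
Proof. exact: sigma_algebraC. Qed.

Let rV_bigcup (F : _^nat) : (forall i, g_sigma_preimage coord (F i)) ->
  g_sigma_preimage coord (\bigcup_i (F i)).
Proof. exact: sigma_algebra_bigcup. Qed.

HB.instance Definition _ := @isMeasurable.Build (measure_tuple_display d)
  'rV[T]_n (g_sigma_preimage coord) rV_set0 rV_setC rV_bigcup.

End rV_measurable.

Lemma measurable_coord {d} {T : sigmaRingType d} n (i : 'I_n) :
  measurable_fun [set: 'rV[T]_n] (fun v => v ord0 i).
Proof.
move=> _ Y mY; rewrite setTI; apply: sub_sigma_algebra => /=.
rewrite -bigcup_seq/=; exists i => /=; first by rewrite mem_index_enum.
by exists Y => //; rewrite setTI.
Qed.

Lemma measurable_rV {d1 d2} {T1 : measurableType d1} {T2 : measurableType d2} n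
    (f : T1 -> 'rV[T2]_n) :
  (forall i, measurable_fun [set: T1] (fun x => f x ord0 i)) ->
  measurable_fun [set: T1] f.
Proof.
move=> mf; suff : g_sigma_preimage (fun (i : 'I_n) x => f x ord0 i) `<=` measurable.
  rewrite (g_sigma_preimage_comp (fun i (v : 'rV[T2]_n) => v ord0 i) f).
  by move=> prefS _ A mA; apply: prefS; exists A.
apply: smallest_sub; first exact: sigma_algebra_measurable.
case: n => [|n] in f mf *; first by rewrite big_ord0.
rewrite -bigcup_mkord_ord; apply: bigcup_sub => i Ii.
by move=> A [B mB <-]; exact: mf.
Qed.

Definition rV_cons (R : realType) n (p : measurableTypeR R * 'rV[R]_n) :
  'rV[R]_n.+1 := row_mx (const_mx (p.1 : R) : 'rV[R]_1) p.2.

Lemma measurable_rV_cons (R : realType) n : measurable_fun setT (@rV_cons R n).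
Proof.
apply: measurable_rV => i; rewrite /rV_cons.
case: (split_ordP (i : 'I_(1 + n))) => j ->.
  rewrite (_ : (fun _ => _) = fst); first exact: measurable_fst.
  by apply/funext => x; apply: etrans (row_mxEl _ _ _ _) _; rewrite mxE.
rewrite (_ : (fun _ => _) = (fun v : 'rV[R]_n => v ord0 j) \o snd).
  by apply: measurableT_comp => //; exact: measurable_coord.
by apply/funext => x; exact: row_mxEr.
Qed.

Section leb_step.
Variables (R : realType) (n : nat).
Variable m : {sigma_finite_measure set 'rV[R]_n -> \bar R}.
Local Open Scope ereal_scope.

Definition leb_step : set 'rV[R]_n.+1 -> \bar R :=
  pushforward (@lebesgue_measure R \x m) (@rV_cons R n).

Let leb_step0 : leb_step set0 = 0.
Proof. by rewrite /leb_step /pushforward preimage_set0 measure0. Qed.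

Let leb_step_ge0 A : 0 <= leb_step A.
Proof. by rewrite /leb_step /pushforward; exact: measure_ge0. Qed.

Let leb_step_sigma_additive : semi_sigma_additive leb_step.
Proof.
pose mf := @measurable_rV_cons R n.
move=> F mF tF mUF; rewrite /leb_step /pushforward preimage_bigcup.
apply: measure_semi_sigma_additive.
- by move=> k; rewrite -[X in measurable X]setTI; exact: mf.
- apply/trivIsetP => /= i j _ _ ij; rewrite -preimage_setI.
  by move/trivIsetP : tF => /(_ _ _ _ _ ij) ->//; rewrite preimage_set0.
- by rewrite -preimage_bigcup -[X in measurable X]setTI; exact: mf.
Qed.

HB.instance Definition _ := isMeasure.Build _ _ _ leb_step
  leb_step0 leb_step_ge0 leb_step_sigma_additive.

Let leb_step_sigma_finite : sigma_finite setT leb_step.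
Proof.
have /sigma_finiteP[F [TF ndF Foo]] := sigma_finiteT (@lebesgue_measure R).
have /sigma_finiteP[G [TG ndG Goo]] := sigma_finiteT m.
pose g (v : 'rV[R]_n.+1) : measurableTypeR R * 'rV[R]_n :=
  (v ord0 ord0, \row_i v ord0 (lift ord0 i)).
have gK : cancel (@rV_cons R n) g.
  case=> a v; rewrite /g /rV_cons; congr pair => /=.
    have e : (ord0 : 'I_n.+1) = lshift n (ord0 : 'I_1) by exact/val_inj.
    by rewrite [X in fun_of_matrix _ _ X]e; apply: etrans (row_mxEl _ _ _ _) _; rewrite mxE.
  apply/rowP => i; rewrite mxE.
  have e : lift ord0 i = rshift 1 i by exact/val_inj.
  by rewrite [X in fun_of_matrix _ _ X]e; exact: row_mxEr.
have mg : measurable_fun setT g.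
  apply/measurable_fun_pair; first exact: measurable_coord.
  apply: measurable_rV => i; under eq_fun do rewrite mxE.
  exact: measurable_coord.
exists (fun k => g @^-1` (F k `*` G k)).
  rewrite -preimage_bigcup (_ : \bigcup_k _ = setT) ?preimage_setT//.
  rewrite -setXTT [in RHS]TF [in RHS]TG predeqE => -[x y]; split.
    by move=> [k _ []/= ? ?]; split; exists k.
  move=> [/= [k _ Fkx] [l _ Gly]]; exists (maxn k l) => //; split.
  - by move: x Fkx; exact/subsetPset/ndF/leq_maxl.
  - by move: y Gly; exact/subsetPset/ndG/leq_maxr.
move=> k; have [mFk Fkoo] := Foo k; have [mGk Gkoo] := Goo k; split.
  by rewrite -[X in measurable X]setTI; apply: mg => //; exact: measurableX.
rewrite /leb_step /pushforward -comp_preimage.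
rewrite (_ : g \o _ = id); last exact/funext.
by rewrite preimage_id product_measure1E// lte_mul_pinfty// ge0_fin_numE.
Qed.

HB.instance Definition _ := Measure_isSigmaFinite.Build _ _ _ leb_step
  leb_step_sigma_finite.

End leb_step.

(* Lebesgue measure on R^n, as an iterated product. *)
Fixpoint leb (R : realType) n : {sigma_finite_measure set 'rV[R]_n -> \bar R} :=
  match n with
  | 0 => \d_(0 : 'rV[R]_0)
  | n'.+1 => leb_step (leb R n')
  end.

Record weight (R : realType) d := Weight {
  weight_fun :> 'rV[R]_d -> R;
  measurable_weight : measurable_fun setT weight_fun;
  weight_ge0 : forall x, 0 <= weight_fun x;
  weight_le1 : forall x, weight_fun x <= 1 }.

(* The measure H dx. *)
Section weighted_measure.
Variables (R : realType) (d : nat) (H : weight R d).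
Local Open Scope ereal_scope.

Definition wleb (A : set 'rV[R]_d) : \bar R := \int[leb R d]_(x in A) (H x)%:E.

Let wleb0 : wleb set0 = 0.
Proof. by rewrite /wleb integral_set0. Qed.

Let wleb_ge0 A : 0 <= wleb A.
Proof. by apply: integral_ge0 => x _; rewrite lee_fin weight_ge0. Qed.

Let wleb_sigma_additive : semi_sigma_additive wleb.
Proof.
move=> F mF tF mUF; rewrite /wleb ge0_integral_bigcup//.
- apply: is_cvg_ereal_nneg_natsum_cond => k _ _.
  by apply: integral_ge0 => x _; rewrite lee_fin weight_ge0.
- apply: (@measurable_funS _ _ _ _ setT) => //.
  by apply/measurable_EFinP; exact: measurable_weight.
- by move=> x _; rewrite lee_fin weight_ge0.
Qed.

HB.instance Definition _ := isMeasure.Build _ _ _ wleb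
  wleb0 wleb_ge0 wleb_sigma_additive.

End weighted_measure.

(* The library norm on 'rV[R]_d is the sup norm, hence enorm and eball below. *)
Section euclidean.
Variables (R : realType) (d : nat).
Implicit Types (u v x : 'rV[R]_d) (A V : set 'rV[R]_d) (r : R).

Definition dot u v : R := \sum_i u ord0 i * v ord0 i.

Definition enorm v : R := Num.sqrt (dot v v).

Definition eball x r : set 'rV[R]_d := [set y | enorm (y - x) <= r].

Definition enbhd r A : set 'rV[R]_d :=
  [set x | exists2 a, A a & enorm (x - a) < r].

(* The angle between a vector and a linear subspace: the least angle between
   it and a nonzero vector of the subspace. *)
Definition angle v V : R :=
  inf [set acos (dot v w / (enorm v * enorm w)) | w in [set w | V w /\ w != 0]].

Definition pderiv (s : seq 'I_d) (g : 'rV[R]_d -> R) : 'rV[R]_d -> R :=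
  foldr (fun i (h : 'rV[R]_d -> R) x => 'D_(delta_mx ord0 i) h x) g s.

Definition smooth (g : 'rV[R]_d -> R) : Prop :=
  forall s x, differentiable (pderiv s g) x.

(* The derivative bounds natural for a function living at length scale r. *)
Definition deriv_bounds (A : nat -> R) r (g : 'rV[R]_d -> R) : Prop :=
  forall s x, `|pderiv s g x| <= A (size s) * r ^- size s.

Definition supp (g : 'rV[R]_d -> R) : set 'rV[R]_d :=
  closure [set x | g x != 0].

(* Every point lies in at most K members of the family. *)
Definition overlap_le (I : eqType) (K : nat) (B : I -> set 'rV[R]_d) : Prop :=
  forall x (s : seq I), uniq s -> (forall i, i \in s -> B i x) -> (size s <= K)%N.

End euclidean.

Arguments angle {R d}.

Section fourier.
Variables (R : realType) (d : nat).
Implicit Types (g : 'rV[R]_d -> R[i]) (D : set 'rV[R]_d) (xi y : 'rV[R]_d).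

Definition cmeasurable g : Prop :=
  measurable_fun setT (fun x => complex.Re (g x)) /\
  measurable_fun setT (fun x => complex.Im (g x)).

Definition cintegral D g : R[i] :=
  (Rintegral (leb R d) D (fun x => complex.Re (g x)) +i*
   Rintegral (leb R d) D (fun x => complex.Im (g x)))%C.

Definition cis (t : R) : R[i] := (cos t +i* sin t)%C.

Definition fourier g y : R[i] := cintegral setT (fun xi => cis (dot y xi) * g xi).

Definition ifourier g xi : R[i] :=
  ((2 * pi) ^- d)%:C%C * cintegral setT (fun y => cis (- dot y xi) * g y).

Definition cabs (z : R[i]) : R := ComplexField.Normc.normc z.

Definition L2norm g : \bar R := Lnorm (leb R d) 2%:E (fun x => (cabs (g x))%:E).

End fourier.

(* hpart x and tpart x are x' and x_{n+1} for x = (x', x_{n+1}). *)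
Definition hpart (R : realType) n (x : 'rV[R]_(n + 1)) : 'rV[R]_n := lsubmx x.
Definition tpart (R : realType) n (x : 'rV[R]_(n + 1)) : R :=
  rsubmx x ord0 ord0.

Definition extension (R : realType) n (f : 'rV[R]_n -> R[i])
    (x : 'rV[R]_(n + 1)) : R[i] :=
  cintegral (eball 0 1)
    (fun xi => cis (dot (hpart x) xi + tpart x * enorm xi ^+ 2) * f xi).

(* The norm of F in L^q(B, H dx), as the norm on R^d of F extended by 0. *)
Definition wnorm (R : realType) d (H : weight R d) (q : \bar R)
    (B : set 'rV[R]_d) (F : 'rV[R]_d -> R[i]) : \bar R :=
  Lnorm (wleb H) q ((fun x => (cabs (F x))%:E) \_ B).

Definition dimensional (R : realType) d (H : weight R d) (alpha S CH : R) : Prop :=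
  forall x r, 1 <= r -> r <= S ->
    (\int[leb R d]_(y in eball x r) (H y)%:E <= (CH * r `^ alpha)%:E)%E.

(* Data of a wave packet decomposition: the caps theta, indexed by the finite
   type cap, with their centres; the radii of the balls covering R^n, indexed by
   k in Z^n (with centres nu k, below); and the cutoff functions. *)
Record wave_packets (R : realType) n := WavePackets {
  cap : finType;
  omega : cap -> 'rV[R]_n;
  radius : 'rV[int]_n -> R;
  psi : cap -> 'rV[R]_n -> R;
  psit : cap -> 'rV[R]_n -> R;
  eta : 'rV[int]_n -> 'rV[R]_n -> R }.
Arguments cap {R n}.

Section wave_packets.
Variables (R : realType) (n : nat) (L delta : R) (W : wave_packets R n).
Implicit Types (t : cap W) (k : 'rV[int]_n).

Definition caprad : R := L `^ (- 2^-1).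

Definition theta t : set 'rV[R]_n := eball (omega t) caprad.

Definition nurad : R := L `^ ((1 + delta) / 2).

Definition nu k : 'rV[R]_n := nurad *: map_mx intr k.

(* W is a wave packet decomposition at scale L with parameter delta.
   K: overlap numbers and ratio of the radii to nurad; kappa: ratio of the
   smaller concentric balls; c: width, relative to caprad, of the neighbourhood
   on which psit is 1; A: derivative bounds. *)
Record is_wave_packets (K : nat) (kappa c : R) (A : nat -> R) : Prop := {
  omega_ball : forall t, eball 0 1 (omega t);
  theta_cover : eball 0 1 `<=` \bigcup_t theta t;
  theta_overlap : overlap_le K theta;
  radius_ge : forall k, K%:R^-1 * nurad <= radius W k;
  radius_le : forall k, radius W k <= K%:R * nurad;
  nu_cover : \bigcup_k eball (nu k) (radius W k) = setT;
  nu_overlap : overlap_le K (fun k => eball (nu k) (radius W k));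
  psi_smooth : forall t, smooth (psi t);
  psi_bounds : forall t, deriv_bounds A caprad (psi t);
  psi_01 : forall t xi, 0 <= psi t xi <= 1;
  psi_supp : forall t, supp (psi t) `<=` eball (omega t) (kappa * caprad);
  psi_sum : forall xi, eball 0 1 xi -> \sum_(t : cap W) psi t xi = 1;
  eta_smooth : forall k, smooth (eta W k);
  eta_bounds : forall k, deriv_bounds A nurad (eta W k);
  eta_01 : forall k y, 0 <= eta W k y <= 1;
  eta_supp : forall k, supp (eta W k) `<=` eball (nu k) (radius W k);
  eta_sum : forall y, \sum_(k \in setT) eta W k y = 1;
  psit_smooth : forall t, smooth (psit t);
  psit_bounds : forall t, deriv_bounds A caprad (psit t);
  psit_supp : forall t, supp (psit t) `<=` theta t;
  psit_1 : forall t xi, enbhd (c * caprad) (supp (psi t)) xi -> psit t xi = 1 }.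

(* The piece f_{theta,nu}. *)
Definition packet (f : 'rV[R]_n -> R[i]) (p : cap W * 'rV[int]_n)
    (xi : 'rV[R]_n) : R[i] :=
  (psit p.1 xi)%:C%C *
  ifourier (fun y => (eta W p.2 y)%:C%C *
    fourier (fun z => (psi p.1 z)%:C%C * f z) y) xi.

Definition tube (p : cap W * 'rV[int]_n) : set 'rV[R]_(n + 1) :=
  [set x | eball 0 L x /\
    enorm (hpart x + (2 * tpart x) *: omega p.1 - nu p.2) <=
      L `^ (2^-1 + delta)].

Definition dirvec t : 'rV[R]_(n + 1) :=
  row_mx (- (2 *: omega t)) (const_mx 1).

(* G(theta) *)
Definition direction t : 'rV[R]_(n + 1) := (enorm (dirvec t))^-1 *: dirvec t.

End wave_packets.

(* For each scale L, a wave packet decomposition with parameter delta, with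
   constants uniform in L. *)
Definition uniform_wave_packets (R : realType) n (delta : R)
    (W : R -> wave_packets R n) : Prop :=
  exists K kappa c A, [/\ 0 < kappa < 1, 0 < c &
    forall L, 1 <= L -> is_wave_packets L delta (W L) K kappa c A].

(* Late and without notations: mpoly conflicts with the analysis library. *)
Import -(notations) mpoly.

Section complete_intersection.
Variables (R : realType) (d j : nat) (P : 'I_j -> mpoly d R).
Implicit Types (z : 'rV[R]_d).

Definition zset : set 'rV[R]_d :=
  [set x | forall l, meval (fun i => x ord0 i) (P l) = 0].

Definition gradients z : 'M[R]_(j, d) :=
  \matrix_(l, i) meval (fun i' => z ord0 i') (mderiv i (P l)).

(* The coordinates of the wedge product of the rows of a matrix, that is, its
   maximal minors. *)
Definition wedge (M : 'M[R]_(j, d)) : {ffun {ffun 'I_j -> 'I_d} -> R} :=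
  [ffun s : {ffun 'I_j -> 'I_d} => \det (colsub s M)].

Definition nonsingular z : Prop := zset z /\ wedge (gradients z) != 0.

Definition transverse_complete_intersection : Prop :=
  forall z, zset z -> wedge (gradients z) != 0.

(* The tangent space at a nonsingular point z. *)
Definition tangent_space z : set 'rV[R]_d :=
  [set v | forall l, dot (row l (gradients z)) v = 0].

End complete_intersection.

Definition total_degree (R : realType) d (p : mpoly d R) : nat :=
  (msize p).-1.

Section concentration.
Variables (R : realType) (n : nat) (L delta : R) (W : wave_packets R n).
Variables (j : nat) (P : 'I_j -> mpoly (n + 1) R) (E : R).

(* T_{theta,nu} is E L^(-1/2)-tangent to Z(P). *)
Definition tangent (p : cap W * 'rV[int]_n) : Prop :=
  tube L delta p `<=` enbhd (E * L `^ 2^-1) (zset P) `&` eball 0 L /\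
  forall z, nonsingular P z ->
    enbhd (2 * (E * L `^ 2^-1)) (tube L delta p) z -> eball 0 (2 * L) z ->
    angle (direction p.1) (tangent_space P z) <= E * L `^ (- 2^-1).

(* f is concentrated in wave packets tangent to Z(P), with RapDec(L)
   quantified by the constants CN. *)
Definition concentrated (CN : nat -> R) (f : 'rV[R]_n -> R[i]) : Prop :=
  forall N : nat,
    (\esum_(p in [set p | ~ tangent p]) L2norm (packet f p) <=
      (CN N * L ^- N)%:E * L2norm f)%E.

End concentration.

(* f in L^2(R^n) with support in B^n(0,1), as a class of functions modulo null
   sets. *)
Definition L2_ball (R : realType) n (f : 'rV[R]_n -> R[i]) : Prop :=
  [/\ cmeasurable f, (L2norm f < +oo)%E &
      {ae leb R n, forall x, ~ eball 0 1 x -> f x = 0}].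

(* thr is an admissible meaning of a << b, namely 0 < a < thr b. *)
Definition smallness_threshold (R : realType) (thr : R -> R) : Prop :=
  forall b, 0 < b -> 0 < thr b <= b.

(* For q = +oo, q^-1 is 0. *)
Definition beta_bound (R : realType) (n : nat) (q : \bar R) (k : nat) : R :=
  (n + k)%:R / 2 * (fine (q^-1)%E - 2^-1) + k%:R / (2 * k.+1%:R).

(* Main.v *)
(** Fix [k] and put [g = n + 1 - k]. For a large integer [N] let [S = N^(k+1)],
    [L = S^2] and [D = 2nN]. The test function [f] is a product of bumps: of
    width [1/S] at the origin in the first [g] variables, and, in each of the
    other [k - 1] variables, a comb of [N] bumps of width [S^-2] with spacing
    [1/D]. If [|x_i|] is small compared with [S] for [i <= g], the other [x_i] are
    close to [2 pi D Z], and [x_{n+1}] is close to [2 pi D^2 Z], then the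
    phase is close to [2 pi Z] on the support of [f], so that [Ef(x)] is
    comparable to the integral of [f]. The indicator function [H] of the set
    of these [x] is [n]-dimensional up to scale [S], because [D^(k+1) >= S].

    As [f] lives in [|xi_i| <= 1/S] for [i <= g], its wave packets are, up to
    rapidly decaying terms, tangent to the coordinate plane
    [x_1 = ... = x_{n+1-m} = 0]. Comparing the powers of [N] on the two sides
    of the estimate gives [beta_bound n q k <= beta] up to a multiple of
    [eps]. *)
Require Import Defs.
From mathcomp Require Import all_boot all_order all_algebra.
From mathcomp Require Import all_classical all_reals all_analysis.
From mathcomp Require Import measurable_realfun complex.
From mathcomp Require mpoly.
From mathcomp Require Import ring lra zify.
Import Order.TTheory GRing.Theory Num.Def Num.Theory.
Import numFieldNormedType.Exports.
Local Open Scope classical_set_scope.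
Local Open Scope ring_scope.
Set Implicit Arguments.
Unset Strict Implicit.
Unset Printing Implicit Defensive.

(** * Lebesgue measure on row vectors *)

(** The size of [S] is dictated by the dimension condition: a ball of radius [r >= D^2] meets the
    set of [H] in measure at most about [r^(n+1) / D^(k+1)], which stays below [r^n] up to
    [r = D^(k+1)]. One plane serves every [k <= m], as [n + 1 - m <= g].

    The obstacle is concentration, with constants [C_N] fixed before the scale. Any power of [S] may
    be lost there, so integration by parts is replaced by finite differences, and Plancherel by
    supremum times size of support. The rapid decay must come from powers of [X = L^delta], with
    exponents of order [1/delta]. Taking [E = X^2] makes room for it: tubes have radius [S X], while
    a non-tangent packet whose cap meets the support of [f] has [|nu_l|] much larger than [S X] for
    some variable in which [f] varies at scale [1/S]. The price [E^C = L^(2 delta C)] is absorbed in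
    the loss [eps].

    For the exponents: with [V] the volume of the support of [f], [|Ef|] is at least about [V] on a
    set of measure about [S^(n+k)] and the norm of [f] is about [sqrt V], so [sqrt V * S^((n+k)/q)]
    is bounded by about [L^beta]. *)

Section lebesgue_rV.
Variable R : realType.
Local Notation mu := (@lebesgue_measure R).

Definition pbox n (A : 'I_n -> set R) : set 'rV[R]_n :=
  [set v | forall i, A i (v ord0 i)].

Lemma measurable_pbox n (A : 'I_n -> set R) :
  (forall i, measurable (A i : set (measurableTypeR R))) -> measurable (pbox A).
Proof.
move=> mA.
rewrite (_ : pbox A = \big[setI/setT]_(i < n) ((fun v : 'rV[R]_n => v ord0 i) @^-1` A i)).
  apply: bigsetI_measurable => i _; rewrite -[X in measurable X]setTI.
  by apply: (@measurable_coord _ (measurableTypeR R) n i) => //; exact: mA.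
rewrite -bigcap_seq; apply/seteqP; split => v /= h.
  by move=> i /= _; exact: h.
by move=> i; apply: (h i) => /=; rewrite mem_index_enum.
Qed.

Lemma leb_pbox n (A : 'I_n -> set R) (a : 'I_n -> R) :
  (forall i, measurable (A i : set (measurableTypeR R))) ->
  (forall i, mu (A i) = (a i)%:E) -> leb R n (pbox A) = (\prod_i a i)%:E.
Proof.
elim: n A a => [|n IH] A a mA ma.
  rewrite big_ord0 /= (_ : pbox A = setT) ?diracT//.
  by apply/seteqP; split => // v _ [].
have -> : leb R n.+1 (pbox A) =
    product_measure1 mu (leb R n) (A ord0 `*` pbox (fun i => A (lift ord0 i))).
  rewrite [LHS]/= /leb_step /pushforward; congr (_ _).
  have e0 : (ord0 : 'I_n.+1) = lshift n (ord0 : 'I_1) by exact/val_inj.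
  have el i : lift ord0 i = rshift 1 i :> 'I_n.+1 by exact/val_inj.
  have c0 (x : R) (v : 'rV[R]_n) : (rV_cons (x, v)) ord0 ord0 = x.
    by rewrite /rV_cons [X in fun_of_matrix _ _ X]e0; apply: etrans (row_mxEl _ _ _ _) _; rewrite mxE.
  have cl (x : R) (v : 'rV[R]_n) i : (rV_cons (x, v)) ord0 (lift ord0 i) = v ord0 i.
    by rewrite /rV_cons [X in fun_of_matrix _ _ X]el; exact: row_mxEr.
  apply/seteqP; split => -[x v] /=.
    move=> h; split => /=; first by rewrite -(c0 x v); exact: h.
    by move=> i; rewrite -(cl x v i); exact: h.
  move=> [/= h0 h1] i; case: (unliftP ord0 i) => [j ->|->].
    by rewrite cl; exact: h1.
  by rewrite c0.
rewrite product_measure1E//; last by exact: measurable_pbox.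
rewrite big_ord_recl EFinM; congr (_ * _)%E; first exact: ma.
exact: IH.
Qed.

Lemma lebesgue_measure_shift (h : R) (A : set (measurableTypeR R)) : measurable A ->
  mu ((fun x => x + h) @^-1` A) = mu A.
Proof.
move=> mA.
have mf : measurable_fun setT (fun x : measurableTypeR R => x + h : measurableTypeR R).
  exact: measurable_funD.
apply: esym; apply: (@lebesgue_measure_unique R (pushforward mu (fun x : measurableTypeR R => x + h : measurableTypeR R))) => //.
move=> _ [[a b] _ <-] /=; rewrite /pushforward.
rewrite (_ : _ @^-1` _ = `]a - h, b - h]%classic); last first.
  by apply/seteqP; split => x /=; rewrite !in_itv/= ltrBlDr lerBrDr.
by rewrite !lebesgue_measure_itv/= !lte_fin ltrD2r -!EFinD; case: ifP => // _; congr EFin; ring.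
Qed.

Lemma rV_cons_shift n (v : 'rV[R]_n.+1) x (u : 'rV[R]_n) :
  rV_cons (x, u) + v = rV_cons (x + v ord0 ord0, u + \row_i v ord0 (lift ord0 i)).
Proof.
have e0 : (ord0 : 'I_n.+1) = lshift n (ord0 : 'I_1) by exact/val_inj.
have el i : lift ord0 i = rshift 1 i :> 'I_n.+1 by exact/val_inj.
have c0 (y : R) (w : 'rV[R]_n) : (rV_cons (y, w)) ord0 ord0 = y.
  by rewrite /rV_cons [X in fun_of_matrix _ _ X]e0; apply: etrans (row_mxEl _ _ _ _) _; rewrite mxE.
have cl (y : R) (w : 'rV[R]_n) i : (rV_cons (y, w)) ord0 (lift ord0 i) = w ord0 i.
  by rewrite /rV_cons [X in fun_of_matrix _ _ X]el; exact: row_mxEr.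
apply/rowP => i; rewrite mxE; case: (unliftP ord0 i) => [j ->|->].
  by rewrite !cl !mxE.
by rewrite !c0.
Qed.

Lemma measurable_addv n (v : 'rV[R]_n) : measurable_fun setT (fun x : 'rV[R]_n => x + v).
Proof.
apply: measurable_rV => i; under eq_fun do rewrite mxE.
by apply: measurable_funD => //; exact: measurable_coord.
Qed.

(** By induction along the iterated product: the sections are shifted by the induction hypothesis,
    the first coordinate by the one-dimensional invariance. *)
Lemma leb_shift n (v : 'rV[R]_n) (A : set 'rV[R]_n) : measurable A ->
  leb R n ((fun x => x + v) @^-1` A) = leb R n A.
Proof.
elim: n v A => [|n IH] v A mA.
  rewrite (_ : _ @^-1` _ = A)//; apply/seteqP.
  by split=> x /=; rewrite [x + v](_ : _ = x)//; apply/rowP; case.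
rewrite /= /leb_step /pushforward.
set B := @rV_cons R n @^-1` A.
have mB : measurable B.
  by rewrite -[X in measurable X]setTI; exact: (@measurable_rV_cons R n).
pose v0 := v ord0 ord0; pose v' := \row_i v ord0 (lift ord0 i).
rewrite (_ : (_ @^-1` _) = (fun p => (p.1 + v0, p.2 + v')) @^-1` B); last first.
  by apply/seteqP; split => -[x u]; rewrite /= /B /= rV_cons_shift.
have mx := measurable_fun_xsection (leb R n) mB.
transitivity (\int[mu]_x (leb R n (xsection B ((x : R) + v0)%R)))%E.
  rewrite /product_measure1; apply: eq_integral => x _ /=.
  rewrite -(IH v' (xsection B (x + v0))); last exact: measurable_xsection.
  congr (leb R n _); apply/seteqP; split => u /=; rewrite /xsection /= !inE/=;
    by [].
have mf : measurable_fun setT (fun x : measurableTypeR R => x + v0 : measurableTypeR R).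
  exact: measurable_funD.
have := @ge0_integral_pushforward _ _ _ _ R (fun x : measurableTypeR R => x + v0 : measurableTypeR R) mf mu setT
  (leb R n \o xsection B) measurableT mx.
rewrite preimage_setT => <- //.
rewrite /product_measure1; apply: eq_measure_integral => C mC _.
exact: lebesgue_measure_shift.
Qed.

Lemma integral_shift n (v : 'rV[R]_n) (f : 'rV[R]_n -> R) :
  (leb R n).-integrable setT (EFin \o f) ->
  \int[leb R n]_x f (x + v) = \int[leb R n]_x f x.
Proof.
move=> intf; rewrite /Rintegral; congr fine.
have mf : measurable_fun setT (EFin \o f) by case/integrableP : intf.
have mv := measurable_addv v.
have pe : forall A, measurable A -> A `<=` setT -> pushforward (leb R n) (fun x => x + v) A = leb R n A.
  by move=> A mA _; exact: leb_shift.
have intfs : (leb R n).-integrable setT ((EFin \o f) \o (fun x => x + v)).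
  apply/integrableP; split; first exact: measurableT_comp.
  case/integrableP : intf => _; apply: le_lt_trans; rewrite le_eqVlt; apply/orP; left; apply/eqP.
  rewrite -[LHS](@ge0_integral_pushforward _ _ _ _ R (fun x : 'rV[R]_n => x + v) mv (leb R n) setT (fun x => `|(f x)%:E|%E))//.
    exact: eq_measure_integral.
  exact: measurableT_comp.
have := @integral_pushforward _ _ _ _ R (fun x : 'rV[R]_n => x + v) mv (leb R n) setT (EFin \o f) mf.
rewrite preimage_setT => <- //.
exact: eq_measure_integral.
Qed.

End lebesgue_rV.

(** * Integrals bounded by supremum times measure of the support *)

Section crude_bounds.
Context d (T : measurableType d) (R : realType) (mu : {measure set T -> \bar R}).
Local Open Scope ereal_scope.

(* Unlike [ge0_le_integral], no measurability is required. *)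
Lemma ge0_le_integral_nm (f g : T -> \bar R) : (forall x, 0 <= f x) ->
  (forall x, f x <= g x) -> \int[mu]_x f x <= \int[mu]_x g x.
Proof.
move=> f0 fg; have g0 x : 0 <= g x by exact: le_trans (fg x).
rewrite !ge0_integralTE//; apply: le_ereal_sup => _ [h hf <-].
by exists h => // x; exact: le_trans (hf x) (fg x).
Qed.

Lemma integral_le_cst (f : T -> \bar R) (B : set T) (M : R) : measurable B ->
  (0 <= M)%R -> (forall x, 0 <= f x) -> (forall x, f x <= M%:E) ->
  (forall x, ~ B x -> f x = 0) -> \int[mu]_x f x <= M%:E * mu B.
Proof.
move=> mB M0 f0 fM fB.
apply: (@le_trans _ _ (\int[mu]_x (M%:E * (\1_B x)%:E))).
  apply: ge0_le_integral_nm => // x; rewrite indicE.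
  have [xB|xB] := boolP (x \in B); first by rewrite mule1.
  by rewrite mule0 fB// => Bx; rewrite mem_set in xB.
rewrite ge0_integralZl_EFin//; last first.
  by apply/measurable_EFinP; exact: measurable_indic.
by rewrite integral_indic// setIT.
Qed.

(** The integrals of the positive and negative parts both lie in [[0, M * b]], hence so does the
    absolute value of their difference. This suits the integrand of [ifourier], of which only size
    and support are estimated. *)
Lemma normr_Rintegral_le (f : T -> R) (B : set T) (M b : R) : measurable B ->
  mu B <= b%:E -> (0 <= M)%R -> (forall x, `|f x| <= M)%R ->
  (forall x, ~ B x -> f x = 0%R) -> (`|Rintegral mu setT f| <= M * b)%R.
Proof.
move=> mB Bb M0 fM fB.
have b0 : (0 <= b)%R by rewrite -lee_fin; exact: le_trans Bb.
have part (g : T -> \bar R) : (forall x, 0 <= g x) -> (forall x, g x <= M%:E) ->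
  (forall x, ~ B x -> g x = 0) -> exists2 r : R, \int[mu]_x g x = r%:E & (0 <= r <= M * b)%R.
  move=> g0 gM gB; have := integral_le_cst mB M0 g0 gM gB.
  move=> /le_trans /(_ (lee_wpmul2l _ Bb)) => /(_ ltac:(by rewrite lee_fin)).
  have := @integral_ge0 _ _ _ mu setT g (fun x _ => g0 x).
  case: (\int[mu]_x g x) => [r||]//=.
  by rewrite !lee_fin => r0 rM; exists r => //; rewrite r0 rM.
rewrite /Rintegral integralE.
have [r -> /andP[r0 rM]] := part ((EFin \o f)^\+) ltac:(done)
  ltac:(by move=> x; rewrite funeposE ge_max !lee_fin M0 andbT; apply: le_trans (fM x); exact: ler_norm)
  ltac:(by move=> x nB; rewrite funeposE /= fB// maxxx).
have [s -> /andP[s0 sM]] := part ((EFin \o f)^\-) ltac:(done)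
  ltac:(by move=> x; rewrite funenegE ge_max -EFinN !lee_fin M0 andbT; apply: le_trans (fM x); rewrite -normrN; exact: ler_norm)
  ltac:(by move=> x nB; rewrite funenegE /= fB// oppr0 maxxx).
by rewrite -EFinB /= ler_norml; lra.
Qed.

End crude_bounds.

(** * Open sets and continuous functions are Borel for the product sigma-algebra *)

Section continuous_rV.
Variable R : realType.

(** An open set is the union of the countably many boxes [bx p], with rational centre and side
    [2 / (p.2 + 1)], that it contains. *)
Lemma open_measurable_rV n (U : set 'rV[R]_n) : open U -> measurable U.
Proof.
move=> oU.
pose bx (p : 'rV[rat]_n * nat) : set 'rV[R]_n :=
  pbox (fun i => `]ratr (p.1 ord0 i) - p.2.+1%:R^-1, ratr (p.1 ord0 i) + p.2.+1%:R^-1[%classic).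
rewrite (_ : U = \bigcup_p (if `[< bx p `<=` U >] then bx p else set0)).
  apply: countable_bigcupT_measurable => [|p]; first exact: countableP.
  by case: ifP => _ //; apply: measurable_pbox => i; exact: measurable_itv.
apply/seteqP; split => [x Ux|x [p _]]; last first.
  by case: ifPn => // /asboolP; exact.
have /nbhs_ballP[e /= e0 eU] : nbhs x U by exact: open_nbhs_nbhs.
have [k ke] : exists k : nat, k.+1%:R^-1 < e / 2 :> R.
  by have := near_infty_natSinv_lt (PosNum (divr_gt0 e0 (ltr0n R 2))) => -[k _ /(_ k (leqnn k))] /=; exists k.
have k0 : 0 < k.+1%:R^-1 :> R by rewrite invr_gt0 ltr0n.
have /choice[q qP] : forall i : 'I_n, exists q : rat, ratr q \in `]x ord0 i - k.+1%:R^-1, x ord0 i + k.+1%:R^-1[.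
  by move=> i; apply: rat_in_itvoo; rewrite ltrD2l gtrN.
exists (\row_i q i, k) => //; rewrite ifT.
  by move=> i /=; rewrite mxE in_itv/=; move: (qP i); rewrite in_itv/= => /andP[h1 h2]; apply/andP; split; [rewrite ltrBlDr|rewrite -ltrBlDr].
apply/asboolP => y /= by_; apply: eU; split => // a i; rewrite ord1.
have := by_ i; rewrite /= mxE in_itv/= => /andP[? ?].
move: (qP i); rewrite in_itv/= => /andP[? ?].
rewrite /ball/= ltr_norml.
have close (x' y' c k' : R) : c - k' < y' -> y' < c + k' -> x' - k' < c -> c < x' + k' ->
  k' < e / 2 -> - e < x' - y' < e by lra.
by apply: close ke; eassumption.
Qed.

Lemma continuous_measurable_rV n (g : 'rV[R]_n -> R) : continuous g ->
  measurable_fun setT g.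
Proof.
move=> /continuousP cg; apply: (measurability _ (RGenOpens.measurableE R)).
move=> _ [_ [a [b ->] <-]]; rewrite setTI; apply: open_measurable_rV.
exact/cg/interval_open.
Qed.

End continuous_rV.

(** * Differences and oscillatory integrals *)

Section differences.
Variable R : realType.
Implicit Types V : zmodType.

Definition dif V (v : V) (u : V -> R) : V -> R := fun x => u (x + v) - u x.

(** Discrete form of derivative bounds: each difference gains a factor [t], the ratio of the step
    [v] to the length scale of [u]. *)
Definition dif_bd V (v : V) (t : R) (M : nat) (B : R) (u : V -> R) :=
  forall j, (j <= M)%N -> forall x, `|iter j (dif v) u x| <= B * t ^+ j.

Lemma iter_dif_comp V V' (p : V -> V') v v' (u : V' -> R) j :
  (forall x, p (x + v) = p x + v') ->
  iter j (dif v) (u \o p) = iter j (dif v') u \o p.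
Proof.
by move=> pv; elim: j => //= j ->; apply/funext => x; rewrite /dif /= pv.
Qed.

Lemma iter_difD V (v : V) (u w : V -> R) j :
  iter j (dif v) (u \+ w) = iter j (dif v) u \+ iter j (dif v) w.
Proof.
elim: j => //= j ->; apply/funext => x; rewrite /dif /=; ring.
Qed.

Lemma iter_difZ V (v : V) (c : R) (u : V -> R) j :
  iter j (dif v) (fun x => c * u x) = fun x => c * iter j (dif v) u x.
Proof. by elim: j => //= j ->; apply/funext => x; rewrite /dif /=; ring. Qed.

Lemma difM V (v : V) (u w : V -> R) :
  dif v (u \* w) = (dif v u \* (fun x => w (x + v))) \+ (u \* dif v w).
Proof. by apply/funext => x; rewrite /dif /=; ring. Qed.

(** Each use of the product rule [difM] doubles the number of terms, whence [2 ^+ j]; the translate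
    of [w] in it obeys the same bounds as [w]. *)
Lemma iter_difM V (v : V) (t A B : R) j (u w : V -> R) : 0 <= t ->
  dif_bd v t j A u -> dif_bd v t j B w ->
  forall x, `|iter j (dif v) (u \* w) x| <= 2 ^+ j * (A * B) * t ^+ j.
Proof.
move=> t0; elim: j A B u w => [|j IH] A B u w bu bw x.
  have := bu 0%N isT x; have := bw 0%N isT x.
  by rewrite /= !expr0 !mulr1 mul1r normrM => ? ?; exact: ler_pM.
rewrite iterSr difM iter_difD /= (le_trans (ler_normD _ _))//.
have bdu : dif_bd v t j (A * t) (dif v u).
  by move=> i ij y; rewrite -iterSr -mulrA -exprS; exact: bu.
have bdw : dif_bd v t j (B * t) (dif v w).
  by move=> i ij y; rewrite -iterSr -mulrA -exprS; exact: bw.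
have bu' : dif_bd v t j A u by move=> i ij; apply: bu; exact: leqW.
have bw' : dif_bd v t j B (fun y => w (y + v)).
  move=> i ij y; have -> : (fun y => w (y + v)) = w \o (fun y => y + v) by [].
  rewrite (@iter_dif_comp _ _ _ _ v); last by [].
  by apply: bw; exact: leqW.
have := lerD (IH _ _ _ _ bdu bw' x) (IH _ _ _ _ bu' bdw x).
move=> /le_trans; apply; rewrite !exprS le_eqVlt; apply/orP; left; apply/eqP; ring.
Qed.

Lemma dif_bd_ge0 V (v : V) t M B u : dif_bd v t M B u -> 0 <= B.
Proof. by move=> /(_ 0%N isT 0); rewrite expr0 mulr1; exact: le_trans. Qed.

Lemma dif_bdS V (v : V) t M B M' B' u : (M' <= M)%N -> 0 <= t -> B <= B' ->
  dif_bd v t M B u -> dif_bd v t M' B' u.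
Proof.
move=> MM t0 BB bu j jM x; apply: le_trans (bu j (leq_trans jM MM) x) _.
by apply: ler_wpM2r => //; exact: exprn_ge0.
Qed.

Lemma dif_bdM V (v : V) t A B M u w : 0 <= t -> dif_bd v t M A u ->
  dif_bd v t M B w -> dif_bd v t M (2 ^+ M * (A * B)) (u \* w).
Proof.
move=> t0 bu bw j jM x.
have bu' : dif_bd v t j A u by apply: dif_bdS bu.
have bw' : dif_bd v t j B w by apply: dif_bdS bw.
apply: le_trans (iter_difM t0 bu' bw' x) _.
apply: ler_wpM2r; first exact: exprn_ge0.
apply: ler_wpM2r; first by rewrite mulr_ge0// (dif_bd_ge0 bu, dif_bd_ge0 bw).
by rewrite ler_weXn2l// ler1n.
Qed.

Lemma dif_bd_prod V (v : V) t M (I : Type) (r : seq I) (B : R) (u : I -> V -> R) :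
  0 <= t -> (forall i, dif_bd v t M B (u i)) ->
  dif_bd v t M ((2 ^+ M * B) ^+ size r) (fun x => \prod_(i <- r) u i x).
Proof.
move=> t0 bu; elim: r => [|a r IH].
  have -> : (fun x : V => \prod_(i <- [::]) u i x) = cst 1.
    by apply/funext => x; rewrite big_nil.
  move=> [|j] _ x; first by rewrite /= normr1 !expr0 mulr1.
  suff -> : iter j.+1 (dif v) (cst 1) x = 0 by rewrite normr0 expr0 mul1r exprn_ge0.
  elim: j x => [|j IH] x; first by rewrite /= /dif subrr.
  by rewrite iterS {1}/dif !IH subrr.
rewrite (_ : (fun _ => _) = u a \* (fun x => \prod_(i <- r) u i x)).
  by rewrite /= exprS -mulrA; exact: dif_bdM.
by apply/funext => x; rewrite big_cons.
Qed.

Lemma dif_bd_sum V (v : V) t M (I : Type) (r : seq I) (B : R) (u : I -> V -> R) :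
  0 <= t -> (forall i, dif_bd v t M B (u i)) ->
  dif_bd v t M ((size r)%:R * B) (fun x => \sum_(i <- r) u i x).
Proof.
move=> t0 bu; elim: r => [|a r IH].
  have -> : (fun x : V => \sum_(i <- [::]) u i x) = (fun x => 0 * 0).
    by apply/funext => x; rewrite big_nil mulr0.
  by move=> j _ x; rewrite iter_difZ !mul0r normr0.
rewrite (_ : (fun _ => _) = u a \+ (fun x => \sum_(i <- r) u i x)); last first.
  by apply/funext => x; rewrite big_cons.
move=> j jM x; rewrite iter_difD /= (le_trans (ler_normD _ _))//.
by rewrite -natr1 addrC mulrDl mulrDl mul1r lerD// (IH, bu).
Qed.

Lemma derivative_lipschitz (f df : R -> R) (B : R) :
  (forall s : R, is_derive s 1 f (df s)) -> (forall s, `|df s| <= B) ->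
  forall s h, `|f (s + h) - f s| <= `|h| * B.
Proof.
move=> fdf dfB.
have cf : continuous f.
  by move=> x; apply/differentiable_continuous/derivable1_diffP; apply: ex_derive.
have main a b : a <= b -> `|f b - f a| <= (b - a) * B.
  move=> ab.
  have [|c _ ->] := @MVT_segment R f df a b ab (fun x _ => fdf x).
    exact: continuous_subspaceT.
  rewrite normrM mulrC (ger0_norm (_ : 0 <= b - a)) ?subr_ge0//.
  by apply: ler_wpM2l => //; rewrite subr_ge0.
move=> s h; have [h0|h0] := leP 0 h.
  by have := main s (s + h); rewrite (ger0_norm h0) (addrAC s h) subrr add0r; apply; rewrite lerDl.
have := main (s + h) s; rewrite (ltr0_norm h0) opprD addrA subrr sub0r distrC; apply.
by rewrite gerDl ltW.
Qed.

Lemma iter_dif_derivatives (g : nat -> R -> R) (B : nat -> R) (h : R) :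
  (forall a (s : R), is_derive s 1 (g a) (g a.+1 s)) ->
  (forall a s, `|g a s| <= B a) ->
  forall j a s, `|iter j (dif h) (g a) s| <= `|h| ^+ j * B (a + j)%N.
Proof.
move=> gd gB.
have D j a (s : R) : is_derive s 1 (iter j (dif h) (g a)) (iter j (dif h) (g a.+1) s).
  elim: j a s => [|j IH] a s; first exact: gd.
  rewrite !iterS /dif; apply: is_deriveB.
  have := IH a (s + h); set F := iter j _ _ => -[dF FE].
  have E : (fun h0 : R => h0^-1 *: (((fun x => F (x + h)) \o shift s) (h0 *: (1 : R)) - F (s + h)))
         = (fun h0 : R => h0^-1 *: ((F \o shift (s + h)) (h0 *: (1 : R)) - F (s + h))).
    by apply/funext => z; rewrite /= addrA.
  split; first by rewrite /derivable E.
  by rewrite /derive E.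
elim=> [|j IH] a s; first by rewrite /= expr0 mul1r addn0.
rewrite iterS exprS -mulrA; apply: (derivative_lipschitz (D j a)) => z.
by rewrite addnS -addSn; exact: IH.
Qed.

Lemma dif_bd_smooth n (g : 'rV[R]_n -> R) A r M (i : 'I_n) (h : R) : 0 < r ->
  smooth g -> deriv_bounds A r g ->
  dif_bd (h *: delta_mx ord0 i) (`|h| / r) M (\sum_(j < M.+1) `|A j|) g.
Proof.
move=> r0 sg bg j jM x.
pose gam a (s : R) := pderiv (nseq a i) g (x + s *: delta_mx ord0 i).
have D a (s : R) : is_derive s 1 (gam a) (gam a.+1 s).
  set F := pderiv (nseq a i) g.
  have dF := @diff_derivable _ _ _ F (x + s *: delta_mx ord0 i) (delta_mx ord0 i) (sg (nseq a i) _).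
  have E : (fun h0 : R => h0^-1 *: ((gam a \o shift s) (h0 *: (1 : R)) - gam a s))
    = (fun h0 : R => h0^-1 *: ((F \o shift (x + s *: delta_mx ord0 i)) (h0 *: delta_mx ord0 i) - F (x + s *: delta_mx ord0 i))).
    apply/funext => z; rewrite /= /gam -/F; congr (_ *: (F _ - _)).
    by rewrite scalerDl -scalerA scale1r addrCA addrA.
  split; first by rewrite /derivable E.
  by rewrite /derive E.
have B a s : `|gam a s| <= A a * r ^- a by have := bg (nseq a i) (x + s *: delta_mx ord0 i); rewrite size_nseq.
have := iter_dif_derivatives h D B j 0 0.
have -> : iter j (dif h) (gam 0%N) = iter j (dif (h *: delta_mx ord0 i)) g \o (fun s => x + s *: delta_mx ord0 i).
  by rewrite -(@iter_dif_comp _ _ _ h)// => s; rewrite scalerDl addrA.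
rewrite /= scale0r addr0 add0n => /le_trans; apply.
have hr : 0 <= `|h| ^+ j / r ^+ j.
  by apply: divr_ge0; apply: exprn_ge0 => //; exact: ltW.
rewrite expr_div_n mulrCA; apply: ler_wpM2r => //.
rewrite (le_trans (ler_norm _))//.
have jM' : (j < M.+1)%N by [].
by rewrite (bigD1 (Ordinal jM'))//= lerDl sumr_ge0.
Qed.

End differences.

(** * Decay of trigonometric integrals *)

Section trigonometric_integrals.
Variable R : realType.

Definition cube n (rho : R) : set 'rV[R]_n := pbox (fun=> `[- rho, rho]%classic).

Arguments cube : clear implicits.

Lemma measurable_cube n rho : measurable (cube n rho).
Proof. by apply: measurable_pbox => i; exact: measurable_itv. Qed.

Lemma leb_cube n rho : 0 <= rho -> leb R n (cube n rho) = ((2 * rho) ^+ n)%:E.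
Proof.
move=> rho0; rewrite (@leb_pbox R n _ (fun=> 2 * rho)).
- by rewrite prodr_const card_ord.
- by move=> i; exact: measurable_itv.
move=> i; rewrite lebesgue_measure_itv/= lte_fin -EFinB opprK -mulr2n mulr_natl.
by case: ifPn => //; rewrite -leNgt => h; congr EFin; lra.
Qed.

(** The radius [rho] is recorded because each difference enlarges the support, whose volume enters
    the decay estimate. *)
Record nice n (rho : R) (u : 'rV[R]_n -> R) : Prop := Nice {
  nice_measurable : measurable_fun setT u;
  nice_bounded : exists B : R, forall x, `|u x| <= B;
  nice_supp : forall x, ~ cube n rho x -> u x = 0 }.

Lemma nice_integrable n rho (u : 'rV[R]_n -> R) : 0 <= rho -> nice rho u ->
  (leb R n).-integrable setT (EFin \o u).
Proof.
move=> rho0 [mu [B uB] us]; apply/integrableP; split; first exact/measurable_EFinP.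
have B0 : 0 <= B by apply: le_trans (uB 0).
apply: le_lt_trans (@integral_le_cst _ _ R (leb R n) (fun x => `|(u x)%:E|)%E (cube n rho) B _ _ _ _ _) _ => //.
- exact: measurable_cube.
- by move=> x /us ->; rewrite /= normr0.
- by rewrite [X in (_ * X)%E]leb_cube// -EFinM ltry.
Qed.

Lemma nice_mul n rho (c u : 'rV[R]_n -> R) : measurable_fun setT c ->
  (forall x, `|c x| <= 1) -> nice rho u -> nice rho (c \* u).
Proof.
move=> mc c1 [mu [B uB] us]; split; first exact: measurable_funM.
  exists B => x; rewrite /= normrM -[leRHS]mul1r; apply: ler_pM => //.
by move=> x /us; rewrite /= => ->; rewrite mulr0.
Qed.

Lemma nice_shift n rho (h : R) (i : 'I_n) (u : 'rV[R]_n -> R) :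
  nice rho u -> nice (rho + `|h|) (fun x => u (x + h *: delta_mx ord0 i)).
Proof.
move=> [mu [B uB] us]; split; [|by exists B => x; exact: uB|].
  by apply: (measurableT_comp mu); exact: measurable_addv.
move=> x cx; apply: us => cx'; apply: cx => j; have := cx' j.
rewrite /= !in_itv/= !mxE eqxx /=; have := ler_norm h; have := ler_norm (- h); rewrite normrN.
have aux (a b c : R) : - b <= c -> b <= c -> 0 <= c ->
  - rho <= a + b * (j == i)%:R <= rho -> - (rho + c) <= a <= rho + c.
  by case: eqP => _; rewrite ?mulr1 ?mulr0; lra.
by move=> h1 h2; apply: aux.
Qed.

Lemma nice_dif n rho (h : R) (i : 'I_n) (u : 'rV[R]_n -> R) : `|h| <= 1 ->
  nice rho u -> nice (rho + 1) (dif (h *: delta_mx ord0 i) u).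
Proof.
move=> h1 nu; have [mv [C vC] vs] := nice_shift h i nu.
have [mu [B uB] us] := nu; split; first exact: measurable_funB.
  by exists (C + B) => x; rewrite /dif (le_trans (ler_normB _ _))//; exact: lerD.
have aux (a b : R) : - b <= a <= b -> b <= rho + 1 -> - (rho + 1) <= a <= rho + 1 by lra.
move=> x cx; rewrite /dif vs ?us ?subr0// => cx'; apply: cx => j; have := cx' j;
  rewrite /= !in_itv/= => /aux; apply; rewrite ?lerD2l ?lerDl//.
Qed.

Lemma measurable_dot n (y : 'rV[R]_n) : measurable_fun setT (dot y).
Proof.
rewrite /dot; apply: measurable_sum => i; apply: measurable_funM => //; exact: measurable_coord.
Qed.

Lemma dotDr n (y x v : 'rV[R]_n) : dot y (x + v) = dot y x + dot y v.
Proof. by rewrite /dot -big_split; apply: eq_bigr => i _; rewrite mxE mulrDr. Qed.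

Lemma dot_delta n (y : 'rV[R]_n) h i : dot y (h *: delta_mx ord0 i) = y ord0 i * h.
Proof.
rewrite /dot (bigD1 i)//= !mxE !eqxx mulr1 big1 ?addr0// => j ji.
by rewrite !mxE (negbTE ji) andbF !mulr0.
Qed.

Section alternating.
Variable c : R -> R.
Hypothesis mc : measurable_fun setT c.
Hypothesis c1 : forall s, `|c s| <= 1.
Hypothesis cpi : alternating c pi.
Variables (n : nat) (y : 'rV[R]_n).

(** With [c] the cosine or the sine: real or imaginary part of the Fourier transform of the real
    function [u]. *)
Definition trig_int (u : 'rV[R]_n -> R) : R :=
  \int[leb R n]_x (c (dot y x) * u x).

(* A translation by [pi / y_i] in the direction [i] changes the sign of
   [c (dot y x)]; this replaces integration by parts. *)
Lemma trig_int_dif rho u (i : 'I_n) : 0 <= rho -> nice rho u ->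
  pi <= `|y ord0 i| ->
  trig_int (dif ((pi / y ord0 i) *: delta_mx ord0 i) u) = - 2 * trig_int u.
Proof.
move=> rho0 nu yi; set v := _ *: _.
have yi0 : y ord0 i != 0.
  by rewrite -normr_gt0; apply: lt_le_trans yi; exact: pi_gt0.
have mcy : measurable_fun setT (c \o dot y) by apply: measurableT_comp => //; exact: measurable_dot.
have cy1 x : `|(c \o dot y) x| <= 1 by exact: c1.
have ng : nice rho ((c \o dot y) \* u) by exact: nice_mul.
have ngv := nice_shift (pi / y ord0 i) i ng.
have ig := nice_integrable rho0 ng.
have igv := nice_integrable (addr_ge0 rho0 (normr_ge0 _)) ngv.
have gv x : ((c \o dot y) \* u) (x + v) = - (c (dot y x) * u (x + v)).
  by rewrite /= dotDr dot_delta mulrCA divff// mulr1 cpi mulNr.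
have iN : (leb R n).-integrable setT (EFin \o (fun x => - 1 * ((c \o dot y) \* u) (x + v))).
  by have := integrableZl measurableT (-1) igv; apply: eq_integrable => // x _.
rewrite /trig_int (_ : (fun x => _) = fun x => (- 1 * ((c \o dot y) \* u) (x + v)) - ((c \o dot y) \* u) x); last first.
  by apply/funext => x; rewrite gv /dif /=; ring.
rewrite RintegralB// RintegralZl// integral_shift//.
by rewrite /=; ring.
Qed.

(** Passing from [u] to its difference doubles the integral up to sign, hence does not decrease its
    size; after [M] differences the sup bound applies on a cube enlarged by [M], each step being at
    most 1. *)
Lemma trig_int_decay rho u (i : 'I_n) M (t B : R) : 0 <= rho -> nice rho u ->
  pi <= `|y ord0 i| -> 0 <= t ->
  dif_bd ((pi / y ord0 i) *: delta_mx ord0 i) t M B u ->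
  `|trig_int u| <= B * t ^+ M * (2 * (rho + M%:R)) ^+ n.
Proof.
move=> rho0 nu yi t0; set v := _ *: _ => bu.
have h1 : `|pi / y ord0 i| <= 1.
  rewrite normrM normfV ger0_norm ?pi_ge0// ler_pdivrMr ?mul1r//.
  by apply: lt_le_trans yi; exact: pi_gt0.
have rM m : 0 <= rho + m%:R by rewrite addr_ge0.
have nm m : nice (rho + m%:R) (iter m (dif v) u).
  elim: m => [|m IH]; first by rewrite addr0.
  by rewrite -natr1 addrA; apply: nice_dif.
have step m : `|trig_int u| <= `|trig_int (iter m (dif v) u)|.
  elim: m => // m /le_trans; apply.
  rewrite iterS (trig_int_dif (rM m) (nm m) yi) normrM normrN.
  by rewrite ler_peMl// ger0_norm//; lra.
apply: le_trans (step M) _.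
rewrite /trig_int; apply: (@normr_Rintegral_le _ _ R (leb R n) _ (cube n (rho + M%:R)) (B * t ^+ M) ((2 * (rho + M%:R)) ^+ n)).
- exact: measurable_cube.
- by rewrite [X in (X <= _)%E]leb_cube.
- by apply: mulr_ge0; [exact: dif_bd_ge0 bu|exact: exprn_ge0].
- move=> x; rewrite normrM -[leRHS]mul1r; apply: ler_pM => //.
  exact: bu.
- by move=> x cx; rewrite (nice_supp (nm M)) ?mulr0.
Qed.

End alternating.

End trigonometric_integrals.
Arguments cube {R} n rho.

(** * Euclidean norm, complex modulus and Lebesgue norms *)

Section norms.
Variable R : realType.

Lemma dot_ge0 n (v : 'rV[R]_n) : 0 <= dot v v.
Proof. by apply: sumr_ge0 => i _; rewrite -expr2 sqr_ge0. Qed.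

Lemma enorm_ge0 n (v : 'rV[R]_n) : 0 <= enorm v.
Proof. exact: sqrtr_ge0. Qed.

Lemma sqr_enorm n (v : 'rV[R]_n) : enorm v ^+ 2 = dot v v.
Proof. by rewrite sqr_sqrtr// dot_ge0. Qed.

Lemma coord_le_enorm n (v : 'rV[R]_n) i : `|v ord0 i| <= enorm v.
Proof.
rewrite -(@ler_pXn2r _ 2)// ?nnegrE ?enorm_ge0// sqr_enorm.
rewrite real_normK ?num_real// /dot (bigD1 i)//= -expr2 lerDl.
by apply: sumr_ge0 => j _; rewrite -expr2 sqr_ge0.
Qed.

Lemma enorm_le_sum n (v : 'rV[R]_n) : enorm v <= \sum_i `|v ord0 i|.
Proof.
have s0 : 0 <= \sum_i `|v ord0 i| by apply: sumr_ge0.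
rewrite -(@ler_pXn2r _ 2)// ?nnegrE ?enorm_ge0// sqr_enorm expr2 mulr_suml.
apply: ler_sum => i _; rewrite -expr2 -real_normK ?num_real// expr2.
by apply: ler_wpM2l => //; rewrite (bigD1 i)//= lerDl sumr_ge0.
Qed.

Lemma enorm0 n : enorm (0 : 'rV[R]_n) = 0.
Proof. by rewrite /enorm /dot big1 ?sqrtr0// => i _; rewrite mxE mul0r. Qed.

Lemma measurable_enorm n : measurable_fun setT (@enorm R n).
Proof.
rewrite /enorm; have -> : (fun v : 'rV[R]_n => Num.sqrt (dot v v)) =
    (fun x : R => Num.sqrt x) \o (fun v => dot v v) by [].
apply: measurableT_comp.
  by apply: continuous_measurable_fun; exact: sqrt_continuous.
by rewrite /dot; apply: measurable_sum => i; apply: measurable_funM; exact: measurable_coord.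
Qed.

Lemma measurable_eball n (x : 'rV[R]_n) r : measurable (eball x r).
Proof.
have := measurableT_comp (@measurable_enorm n) (measurable_addv (- x)).
move=> /(_ measurableT `]-oo, r]%classic); rewrite setTI.
rewrite (_ : _ @^-1` _ = eball x r); first by apply; exact: measurable_itv.
by apply/seteqP; split => y; rewrite /= in_itv.
Qed.

Lemma cabs_ge0 (z : R[i]) : 0 <= cabs z.
Proof. by case: z => a b; exact: sqrtr_ge0. Qed.

Lemma cabs_real (x : R) : cabs (x%:C)%C = `|x|.
Proof. by rewrite /cabs /= expr0n addr0 sqrtr_sqr. Qed.

Lemma cabsM (z w : R[i]) : cabs (z * w) = cabs z * cabs w.
Proof. exact: ComplexField.Normc.normcM. Qed.

Lemma cabs_ge_Re (z : R[i]) : `|complex.Re z| <= cabs z.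
Proof.
case: z => a b; rewrite /cabs /= -sqrtr_sqr ler_wsqrtr//.
by rewrite lerDl sqr_ge0.
Qed.

Lemma cabs_le (z : R[i]) : cabs z <= `|complex.Re z| + `|complex.Im z|.
Proof.
case: z => a b; rewrite /cabs /= -(@ler_pXn2r _ 2)// ?nnegrE ?sqrtr_ge0 ?addr_ge0//.
rewrite sqr_sqrtr ?addr_ge0 ?sqr_ge0//.
rewrite -(real_normK (num_real a)) -(real_normK (num_real b)) sqrrD.
by rewrite lerD2r lerDl mulrn_wge0// mulr_ge0.
Qed.


Section Lp.
Context d (T : measurableType d) (mu : {measure set T -> \bar R}).
Local Open Scope ereal_scope.

Lemma Lnorm2_le (g : T -> \bar R) (B : set T) (M b : R) : measurable B ->
  (0 <= M)%R -> (0 <= b)%R -> mu B <= (b ^+ 2)%:E ->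
  (forall x, `|g x| <= M%:E) -> (forall x, ~ B x -> g x = 0) ->
  Lnorm mu 2%:E g <= (M * b)%:E.
Proof.
move=> mB M0 b0 Bb gM gB; rewrite unlock.
have h : \int[mu]_x `|g x| `^ 2 <= (M ^+ 2 * b ^+ 2)%:E.
  apply: le_trans (_ : _ <= (M ^+ 2)%:E * mu B) _; last first.
    by rewrite [leRHS]EFinM; apply: lee_wpmul2l => //; rewrite lee_fin sqr_ge0.
  apply: integral_le_cst => //.
  - exact: sqr_ge0.
  - by move=> x; exact: poweR_ge0.
  - move=> x; have := gM x; case: (g x) => [r||]//=; rewrite lee_fin => rM.
    rewrite lee_fin powR_mulrn//.
    by rewrite ler_pXn2r// nnegrE.
  - by move=> x /gB ->; rewrite abse0 poweR0r.
apply: le_trans (_ : (M ^+ 2 * b ^+ 2)%:E `^ 2^-1 <= _).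
  apply: gt0_ler_poweR; rewrite ?invr_ge0// in_itv/= leey andbT.
    by apply: integral_ge0 => x _; exact: poweR_ge0.
  by rewrite lee_fin mulr_ge0// sqr_ge0.
by rewrite poweR_EFin lee_fin -exprMn powR12_sqrt ?sqr_ge0// sqrtr_sqr ger0_norm// mulr_ge0.
Qed.

(** Chebyshev's inequality on [B] for finite [q]. For [q = +oo] the exponent is 0, and [M] above the
    essential supremum would put [B], of positive measure, inside a null set. *)
Lemma Lnorm_ge (q : \bar R) (g : T -> \bar R) (B : set T) (M m : R) :
  1 <= q -> measurable B -> (0 <= M)%R -> (0 < m)%R -> m%:E <= mu B ->
  (forall x, B x -> M%:E <= `|g x|) ->
  (M * m `^ fine (q^-1)%E)%:E <= Lnorm mu q g.
Proof.
move=> q1 mB M0 m0 Bm gM; rewrite unlock; case: q q1 => [r||]//=; last first.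
  move=> _; have muT : 0 < mu setT.
    apply: lt_le_trans (_ : m%:E <= _); first by rewrite lte_fin.
    by apply: le_trans Bm _; apply: le_measure => //; rewrite ?inE.
  rewrite muT /inve /= powRr0 mulr1 leNgt; apply/negP => lt.
  have := @ess_sup_inf.ess_sup_ge _ _ R mu (abse \o g); case=> N [mN N0 sN].
  have : mu B <= mu N.
    apply: le_measure; rewrite ?inE// => x Bx; apply: sN => /= h.
    by have := le_lt_trans (le_trans (gM _ Bx) h) lt; rewrite ltxx.
  by rewrite N0 => /(le_trans Bm); rewrite lee_fin leNgt m0.
rewrite lee_fin => r1; have r0 : (0 < r)%R by exact: lt_le_trans r1.
have -> : fine (r%:E^-1)%E = (r^-1)%R.
  by rewrite /inve gt_eqF.
have h : (M `^ r * m)%:E <= \int[mu]_x `|g x| `^ r.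
  rewrite EFinM.
  apply: le_trans (_ : (M `^ r)%:E * mu B <= _).
    by apply: lee_wpmul2l => //; rewrite lee_fin powR_ge0.
  rewrite (_ : _ * _ = \int[mu]_x ((M `^ r)%:E * (\1_B x)%:E)); last first.
    rewrite ge0_integralZl_EFin ?powR_ge0//; last first.
      by apply/measurable_EFinP; exact: measurable_indic.
    by rewrite integral_indic// setIT.
  apply: ge0_le_integral_nm => x.
    by rewrite -EFinM lee_fin mulr_ge0 ?powR_ge0.
  rewrite indicE; case: (boolP (x \in B)) => [|_]; last by rewrite mule0 poweR_ge0.
  rewrite inE mule1 => /gM; rewrite -poweR_EFin => Mg.
  by apply: gt0_ler_poweR; rewrite ?(ltW r0)// in_itv/= ?leey ?andbT ?lee_fin ?abse_ge0.
have <- : (M `^ r * m)%:E `^ r^-1 = (M * m `^ r^-1)%:E.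
  by rewrite poweR_EFin powRM ?powR_ge0 ?(ltW m0)// -powRrM divff ?gt_eqF// powRr1.
apply: gt0_ler_poweR; rewrite ?invr_ge0 ?(ltW r0)// in_itv/= leey andbT.
  by rewrite lee_fin mulr_ge0 ?powR_ge0// ltW.
by apply: integral_ge0 => x _; exact: poweR_ge0.
Qed.

End Lp.

Lemma L2norm_le n (g : 'rV[R]_n -> R[i]) (B : set 'rV[R]_n) (M b : R) :
  measurable B -> 0 <= M -> 0 <= b -> (leb R n B <= (b ^+ 2)%:E)%E ->
  (forall x, cabs (g x) <= M) -> (forall x, ~ B x -> g x = 0) ->
  (L2norm g <= (M * b)%:E)%E.
Proof.
move=> mB M0 b0 Bb gM gB; apply: (@Lnorm2_le _ _ (leb R n) _ B) => // x.
  by rewrite /= lee_fin ger0_norm ?cabs_ge0.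
by move=> /gB ->; rewrite cabs_real normr0.
Qed.

Lemma L2norm_ge n (g : 'rV[R]_n -> R[i]) (B : set 'rV[R]_n) (M b : R) :
  measurable B -> 0 <= M -> 0 < b -> ((b ^+ 2)%:E <= leb R n B)%E ->
  (forall x, B x -> M <= cabs (g x)) -> ((M * b)%:E <= L2norm g)%E.
Proof.
move=> mB M0 b0 Bb gM.
have := @Lnorm_ge _ _ (leb R n) 2%:E (fun x => (cabs (g x))%:E) B M (b ^+ 2) _ mB M0 (exprn_gt0 _ b0) Bb.
rewrite (_ : fine (2%:E^-1)%E = 2^-1); last by rewrite /inve gt_eqF.
rewrite powR12_sqrt ?sqr_ge0// sqrtr_sqr gtr0_norm//; apply.
  by rewrite lee_fin ler1n.
by move=> x /gM h; rewrite /= lee_fin ger0_norm ?cabs_ge0.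
Qed.

End norms.

(** * The test function *)

Section combs.
Variable R : realType.
Local Notation mu := (@lebesgue_measure R).

Definition comb_set (x0 s w : R) (Z : nat) : set R :=
  [set x | exists2 z, (z < Z)%N & `|x - (x0 + s * z%:R)| <= w].

Lemma comb_setS x0 s w Z : comb_set x0 s w Z.+1 =
  comb_set x0 s w Z `|` `[x0 + s * Z%:R - w, x0 + s * Z%:R + w]%classic.
Proof.
have itvE x c : `|x - c| <= w <-> (c - w <= x <= c + w).
  by rewrite ler_norml; split=> /andP[? ?]; apply/andP; split; lra.
apply/seteqP; split => x /=.
  move=> [z zZ h]; move: zZ; rewrite ltnS leq_eqVlt => /predU1P[zE|zZ].
    by right; rewrite /= in_itv/=; apply/itvE; rewrite -zE.
  by left; exists z.
move=> [[z zZ h]|]; first by exists z => //; exact: ltnW.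
by rewrite /= in_itv /= => /itvE h; exists Z.
Qed.

Lemma comb_set0 x0 s w : comb_set x0 s w 0 = set0.
Proof. by apply/seteqP; split => x // [z]. Qed.

Lemma measurable_comb_set x0 s w Z :
  measurable (comb_set x0 s w Z : set (measurableTypeR R)).
Proof.
elim: Z => [|Z IH]; first by rewrite comb_set0.
by rewrite comb_setS; apply: measurableU => //; exact: measurable_itv.
Qed.

Lemma lebesgue_measure_centred (c w : R) : 0 <= w ->
  mu `[c - w, c + w]%classic = (2 * w)%:E.
Proof.
move=> w0; rewrite lebesgue_measure_itv/= lte_fin -EFinB.
by case: ifPn => [_|]; [congr EFin; ring|rewrite -leNgt => h; congr EFin; lra].
Qed.

Lemma comb_set_measure_le x0 s w Z : 0 <= w ->
  (mu (comb_set x0 s w Z) <= (2 * w * Z%:R)%:E)%E.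
Proof.
move=> w0; elim: Z => [|Z IH]; first by rewrite comb_set0 measure0 mulr0.
rewrite comb_setS; apply: le_trans (measureU2 _ _ _) _.
- exact: measurable_comb_set.
- exact: measurable_itv.
rewrite -[Z.+1%:R]natr1 mulrDr mulr1 EFinD; apply: leeD => //.
by rewrite [X in (X <= _)%E]lebesgue_measure_centred.
Qed.

Lemma comb_set_measure x0 s w Z : 0 <= w -> 2 * w < s ->
  mu (comb_set x0 s w Z) = (2 * w * Z%:R)%:E.
Proof.
move=> w0 ws; elim: Z => [|Z IH]; first by rewrite comb_set0 measure0 mulr0.
rewrite comb_setS measureU.
- rewrite [X in (X + _)%E]IH [X in (_ + X)%E]lebesgue_measure_centred//.
  by rewrite -EFinD -[Z.+1%:R]natr1 mulrDr mulr1.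
- exact: measurable_comb_set.
- exact: measurable_itv.
apply/seteqP; split => x //= [[z zZ]]; rewrite in_itv/= ler_norml.
move=> /andP[_ h1] /andP[h2 _].
have : s * z%:R + s <= s * Z%:R.
  by rewrite -[X in _ + X]mulr1 -mulrDr natr1 ler_wpM2l ?ler_nat//; lra.
move: h1 h2; move: (s * z%:R) (s * Z%:R) => u v *; lra.
Qed.

Lemma comb_set_measure1 x0 s w : 0 <= w -> mu (comb_set x0 s w 1) = (2 * w)%:E.
Proof.
by move=> w0; rewrite comb_setS comb_set0 set0U mulr0 addr0 lebesgue_measure_centred.
Qed.

(** The teeth that meet the interval have centres in an interval of length [2 * (r + w)]; counted
    from the first of them, [z1], there are at most [2 * (r + w) / s + 1]. *)
Lemma comb_set_itv_measure_le (x0 s w : R) Z (x r : R) : 0 < s -> 0 <= w -> 0 <= r ->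
  (mu (comb_set x0 s w Z `&` `[(x - r)%R, (x + r)%R]%classic) <=
    (2 * w * (2 * (r + w) / s + 1))%:E)%E.
Proof.
move=> s0 w0 r0.
pose P z := `|x0 + s * z%:R - x| <= r + w.
have inP z y : `|y - (x0 + s * z%:R)| <= w -> x - r <= y <= x + r -> P z.
  rewrite /P !ler_norml => /andP[h1 h2] /andP[h3 h4]; apply/andP.
  by move: h1 h2 h3 h4; move: (s * z%:R) => u *; split; lra.
have C0 : 0 <= 2 * (r + w) / s by rewrite divr_ge0 ?(ltW s0)//; lra.
have [[z0 Pz0]|nP] := pselect (exists z, P z); last first.
  rewrite (_ : _ `&` _ = set0) ?measure0 ?lee_fin; first by rewrite mulr_ge0//; lra.
  apply/seteqP; split => y //= [[z _ h]]; rewrite in_itv/= => h'.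
  by case: nP; exists z; apply: inP h h'.
have exP : exists z, P z by exists z0.
case: (ex_minnP exP) => z1 Pz1 z1min.
pose m := (Num.truncn (2 * (r + w) / s)).+1.
apply: le_trans (_ : mu (comb_set (x0 + s * z1%:R) s w m) <= _)%E.
  apply: le_measure; rewrite ?inE; [|exact: measurable_comb_set|].
    by apply: measurableI; [exact: measurable_comb_set|exact: measurable_itv].
  move=> y [[z zZ h]] /=; rewrite in_itv/= => h'.
  have Pz := inP _ _ h h'; have zz1 := z1min _ Pz.
  exists (z - z1)%N; last first.
    by rewrite -addrA -mulrDr -natrD subnKC.
  rewrite /m ltnS truncn_ge_nat// natrB// ler_pdivlMr//.
  move: Pz Pz1; rewrite /P !ler_norml => /andP[? ?] /andP[? ?].
  rewrite mulrBl (mulrC _ s) (mulrC _ s).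
  by lra.
apply: le_trans (comb_set_measure_le _ _ _ w0) _.
rewrite lee_fin ler_wpM2l//; first by lra.
by rewrite /m -[(Num.truncn _).+1%:R]natr1 lerD2r truncn_le.
Qed.

End combs.

(** * A one-dimensional bump *)

Section bump.
Variable R : realType.

(** Regularity is stated through differences of every step, the form in which the decay of
    trigonometric integrals uses it. *)
Record bump_function (C : nat -> R) (a b : R) (phi : R -> R) : Prop := Bump {
  bump_ge0 : forall s, 0 <= phi s;
  bump_dif : forall h j s, `|iter j (dif h) phi s| <= C j * `|h| ^+ j;
  bump_supp : forall s, 1 < `|s| -> phi s = 0;
  bump_a : 0 < a;
  bump_b : 0 < b <= 1;
  bump_ge : forall s, `|s| <= b -> a <= phi s }.

(* A one-dimensional bump is obtained by restricting to a line one of the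
   cutoffs of a wave packet decomposition at unit scale. *)
Lemma exists_bump n delta (W : wave_packets R n) K kappa c A : (0 < n)%N ->
  0 < kappa < 1 -> is_wave_packets 1 delta W K kappa c A ->
  exists C a b phi, @bump_function C a b phi.
Proof.
move=> n0 /andP[kappa0 kappa1] hW; pose i0 := Ordinal n0.
have cr : caprad (1 : R) = 1 by rewrite /caprad powR1.
have sum1 : \sum_(t : cap W) psi t 0 = 1.
  by apply: (psi_sum hW); rewrite /eball /= subr0 enorm0.
have [[t pt]|/forallNP np] := pselect (exists t : cap W, psi t 0 != 0); last first.
  move: sum1; rewrite big1 => [/eqP|t _]; first by rewrite eq_sym oner_eq0.
  by apply/eqP; apply: contra_notT (np t).
have p0 : 0 < psi t 0.
  by rewrite lt_neqAle eq_sym pt; case/andP: (psi_01 hW t 0).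
(* The support of [psi t] contains 0 and has diameter at most [2 * kappa < 2], so doubling the
   argument brings it into [[-1, 1]]. *)
pose p (s : R) : 'rV[R]_n := (2 * s) *: delta_mx ord0 i0.
have pD h s : p (s + h) = p s + (2 * h) *: delta_mx ord0 i0.
  by rewrite /p mulrDr scalerDl.
pose phi := psi t \o p.
pose C j := (\sum_(i < j.+1) `|A i|) * 2 ^+ j.
have phid h j s : `|iter j (dif h) phi s| <= C j * `|h| ^+ j.
  rewrite (@iter_dif_comp _ _ _ p h ((2 * h) *: delta_mx ord0 i0))//.
  have := @dif_bd_smooth R n _ A _ j i0 (2 * h) _ (psi_smooth hW t) (psi_bounds hW t).
  rewrite cr ltr01 divr1 => /(_ isT) /(_ j (leqnn j) (p s)); rewrite /= => /le_trans; apply.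
  by rewrite normrM (ger0_norm (_ : 0 <= 2)) // exprMn mulrA.
have C1 : 0 <= C 1%N by rewrite mulr_ge0 ?sumr_ge0 ?exprn_ge0.
(* By the first difference bound, [phi] drops by at most [phi 0 / 2] within distance [b] of 0. *)
pose b := Num.min 1 (phi 0 / (2 * (C 1%N + 1))).
have phi0 : 0 < phi 0 by rewrite /phi /= /p mulr0 scale0r.
exists C, (phi 0 / 2), b, phi; split.
- by move=> s; case/andP: (psi_01 hW t (p s)).
- exact: phid.
- move=> s s1; apply/eqP; apply: contraTT s1 => ps; rewrite -leNgt.
  have e1 : eball (omega t) (kappa * caprad 1) (p s).
    by apply: (psi_supp hW); apply: subset_closure.
  have e0 : eball (omega t) (kappa * caprad 1) 0.
    by apply: (psi_supp hW); apply: subset_closure.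
  have := coord_le_enorm (p s - omega t) i0.
  have := coord_le_enorm (0 - omega t) i0.
  move: e1 e0; rewrite /eball /= cr mulr1 => e1 e0 /le_trans /(_ e0) h0 /le_trans /(_ e1).
  move: h0; rewrite !mxE !eqxx mulr1; move: (omega t ord0 i0 : R) => w.
  by rewrite !ler_norml => /andP[? ?] /andP[? ?]; apply/andP; split; lra.
- by rewrite divr_gt0.
- rewrite /b lt_min ltr01 /= ge_min lexx andbT divr_gt0// mulr_gt0//; lra.
move=> s; rewrite /b le_min => /andP[s1 sb].
have := phid s 1%N 0; rewrite /= /dif add0r expr1.
have : C 1%N * `|s| <= phi 0 / 2.
  move: sb; rewrite ler_pdivlMr ?mulr_gt0//; last by lra.
  have := normr_ge0 s; move: (`|s|) => u; nra.
rewrite ler_norml => ? /andP[? ?]; lra.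
Qed.

End bump.

Section test_function.
Variables (R : realType) (C : nat -> R) (a b : R) (phi : R -> R).
Hypothesis hphi : bump_function C a b phi.

Definition comb (lam D : R) (Z : nat) (s : R) : R :=
  \sum_(z <- iota 0 Z) phi (lam * (s - z%:R / D)).

Lemma bump_le s : `|phi s| <= C 0%N.
Proof. by have := bump_dif hphi 0 0 s; rewrite expr0 mulr1. Qed.

Lemma bump_continuous : continuous phi.
Proof.
move=> s; apply/cvgrPdist_lt => e e0.
have C1 : 0 <= C 1%N by have := bump_dif hphi 1 1 0; rewrite normr1 expr1n mulr1; exact: le_trans.
have d0 : 0 < e / (C 1%N + 1) by rewrite divr_gt0//; lra.
near=> t.
have := bump_dif hphi (t - s) 1 s; rewrite /= /dif subrKC expr1 distrC => /le_lt_trans; apply.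
have : `|t - s| < e / (C 1%N + 1).
  by rewrite distrC; near: t; apply: cvgr_dist_lt => //; exact: cvg_id.
rewrite ltr_pdivlMr; last by lra.
have := normr_ge0 (t - s); move: (`|t - s|) => u; nra.
Unshelve. all: by end_near. Qed.

Lemma comb_ge0 lam D Z s : 0 <= comb lam D Z s.
Proof. by apply: sumr_ge0 => z _; exact: bump_ge0 hphi _. Qed.

Lemma measurable_comb lam D Z : measurable_fun setT (comb lam D Z).
Proof.
apply: measurable_sum => z; apply: (measurableT_comp (f := phi)).
  by apply: continuous_measurable_fun; exact: bump_continuous.
by apply: measurable_funM => //; apply: measurable_funB.
Qed.

Lemma bump_neq0 (lam s c : R) : 0 < lam -> phi (lam * (s - c)) != 0 ->
  `|s - c| <= lam^-1.
Proof.
move=> l0; apply: contra_neqT; rewrite -ltNge => h; apply: (bump_supp hphi).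
by rewrite normrM gtr0_norm// -ltr_pdivrMl// mulr1.
Qed.

Lemma comb_supp (lam D : R) Z s : 0 < lam -> comb lam D Z s != 0 ->
  comb_set 0 D^-1 lam^-1 Z s.
Proof.
move=> l0; apply: contra_neqP => ns; rewrite /comb big_seq big1// => z.
rewrite mem_iota /= add0n => zZ; apply/eqP/negPn/negP => /(bump_neq0 l0) h.
by apply: ns; exists z => //; rewrite add0r mulrC.
Qed.

(** Teeth of half-width [1 / lam] at spacing [1 / D > 2 / lam] are disjoint, so at most one term is
    nonzero. *)
Lemma comb_le (lam D : R) Z s : 0 < D -> 2 * D < lam -> comb lam D Z s <= C 0%N.
Proof.
move=> D0 Dl; have l0 : 0 < lam by lra.
have [[z [zZ pz]]|nz] := pselect (exists z, z \in iota 0 Z /\ phi (lam * (s - z%:R / D)) != 0); last first.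
  rewrite /comb big_seq big1; last first.
    by move=> z zZ; apply/eqP/negPn/negP => h; apply: nz; exists z.
  exact: le_trans (bump_le 0).
rewrite /comb (bigD1_seq z) ?iota_uniq//= big1 ?addr0.
  by apply: le_trans (bump_le (lam * (s - z%:R / D))); exact: ler_norm.
move=> y yz; apply/eqP/negPn/negP => /(bump_neq0 l0) h.
have := bump_neq0 l0 pz => h'.
have dist : `|y%:R / D - z%:R / D| <= 2 * lam^-1.
  rewrite -normrN opprB (_ : _ - _ = (s - y%:R / D) - (s - z%:R / D)); last by ring.
  by rewrite (le_trans (ler_normB _ _))//; lra.
move: dist; rewrite -mulrBl normrM (gtr0_norm (_ : 0 < D^-1)) ?invr_gt0//.
rewrite ler_pdivrMr// mulrAC => dist.
have lt1 : 2 * D / lam < 1 by rewrite ltr_pdivrMr ?mul1r.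
have := le_lt_trans dist lt1.
have sep (u v : nat) : (u < v)%N -> 1 <= `|u%:R - v%:R| :> R.
  by move=> uv; rewrite distrC -natrB ?(ltnW uv)// ger0_norm// ler1n subn_gt0.
rewrite ltNge => /negP[]; move: yz; rewrite neq_ltn => /orP[/sep//|/sep].
by rewrite distrC.
Qed.

Lemma comb_ge (lam D : R) Z s : 0 < lam -> comb_set 0 D^-1 (b / lam) Z s ->
  a <= comb lam D Z s.
Proof.
move=> l0 [z zZ h]; rewrite /comb (bigD1_seq z) ?iota_uniq ?mem_iota//=.
apply: ler_wpDr; first by apply: sumr_ge0 => y _; exact: bump_ge0 hphi _.
apply: (bump_ge hphi); rewrite normrM gtr0_norm// mulrC -ler_pdivlMr//.
by move: h; rewrite add0r mulrC.
Qed.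

Variables (n : nat) (lam : 'I_n -> R) (Z : 'I_n -> nat) (D : R).
Hypothesis D0 : 0 < D.
Hypothesis Dlam : forall i, 2 * D < lam i.

Let lam0 i : 0 < lam i.
Proof. by apply: lt_trans (Dlam i); rewrite mulr_gt0. Qed.

Definition ftest (x : 'rV[R]_n) : R := \prod_i comb (lam i) D (Z i) (x ord0 i).

Definition fsupp : set 'rV[R]_n := pbox (fun i => comb_set 0 D^-1 (lam i)^-1 (Z i)).
Definition fcore : set 'rV[R]_n := pbox (fun i => comb_set 0 D^-1 (b / lam i) (Z i)).
Definition fvol : R := \prod_i (2 * (Z i)%:R / lam i).

Lemma measurable_ftest : measurable_fun setT ftest.
Proof.
apply: measurable_prod => i _.
apply: (measurableT_comp (f := comb (lam i) D (Z i))); first exact: measurable_comb.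
exact: measurable_coord.
Qed.

Lemma ftest_ge0 x : 0 <= ftest x.
Proof. by apply: prodr_ge0 => i _; exact: comb_ge0. Qed.

Lemma ftest_le x : ftest x <= C 0%N ^+ n.
Proof.
rewrite -[X in _ ^+ X]card_ord -prodr_const; apply: ler_prod => i _.
by rewrite comb_ge0 comb_le.
Qed.

Lemma ftest_supp x : ftest x != 0 -> fsupp x.
Proof.
by rewrite /ftest => /prodf_neq0 h i; apply: comb_supp => //; apply: h.
Qed.

Lemma ftest_ge x : fcore x -> a ^+ n <= ftest x.
Proof.
move=> h; rewrite -[X in _ ^+ X]card_ord -prodr_const; apply: ler_prod => i _.
by rewrite (ltW (bump_a hphi)) comb_ge.
Qed.

Lemma measurable_fsupp : measurable fsupp.
Proof. by apply: measurable_pbox => i; exact: measurable_comb_set. Qed.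

Lemma measurable_fcore : measurable fcore.
Proof. by apply: measurable_pbox => i; exact: measurable_comb_set. Qed.

Let il i : 2 * (lam i)^-1 < D^-1.
Proof.
by rewrite ltr_pdivrMr// mulrC ltr_pdivlMr//.
Qed.

Lemma leb_fsupp : leb R n fsupp = fvol%:E.
Proof.
apply: leb_pbox => i; first exact: measurable_comb_set.
by rewrite comb_set_measure// ?invr_ge0 ?(ltW (lam0 i))//; congr EFin; rewrite mulrAC.
Qed.

Lemma leb_fcore : leb R n fcore = (b ^+ n * fvol)%:E.
Proof.
have /andP[b0 b1] := bump_b hphi.
rewrite -[X in _ ^+ X]card_ord -prodr_const -big_split /=.
apply: leb_pbox => i; first exact: measurable_comb_set.
rewrite comb_set_measure.
- by congr EFin; ring.
- by rewrite divr_ge0 ?(ltW b0) ?(ltW (lam0 i)).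
apply: le_lt_trans (il i); rewrite ler_wpM2l//.
by rewrite ler_pdivrMr// mulVf ?gt_eqF.
Qed.

Lemma fvol_gt0 : (forall i, (0 < Z i)%N) -> 0 < fvol.
Proof.
move=> Z0; apply: prodr_gt0 => i _.
by rewrite divr_gt0// mulr_gt0// ltr0n.
Qed.

(** The disjointness of the teeth is not exploited: the factor [Zm ^+ n] is a polynomial loss,
    harmless against rapid decay. *)
Lemma dif_bd_ftest M (i : 'I_n) (h : R) (Zm : nat) : (forall j, (Z j <= Zm)%N) ->
  dif_bd (h *: delta_mx ord0 i) (`|h| * lam i) M
    ((2 ^+ M * (Zm%:R * \sum_(j < M.+1) `|C j|)) ^+ n) ftest.
Proof.
move=> ZZm; set v := _ *: _; set B := \sum_(_ < _) _.
have t0 : 0 <= `|h| * lam i by rewrite mulr_ge0// ltW.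
have CB j : (j <= M)%N -> C j <= B.
  move=> jM; apply: le_trans (ler_norm _) _.
  have jM' : (j < M.+1)%N by [].
  by rewrite /B (bigD1 (Ordinal jM'))//= lerDl sumr_ge0.
have B0 : 0 <= B by exact: sumr_ge0.
rewrite (_ : ftest = fun x => \prod_(j <- enum 'I_n) comb (lam j) D (Z j) (x ord0 j)); last first.
  by apply/funext => x; rewrite /ftest big_enum.
have {2}-> : n = size (enum 'I_n) by rewrite size_enum_ord.
apply: dif_bd_prod => // j.
apply: (@dif_bdS _ _ _ _ M ((Z j)%:R * B)) => //.
  by apply: ler_wpM2r => //; rewrite ler_nat.
rewrite -{1}(size_iota 0 (Z j)); apply: dif_bd_sum => // z.
move=> m mM x.
pose p (y : 'rV[R]_n) : R := lam j * (y ord0 j - z%:R / D).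
rewrite (_ : (fun y => _) = phi \o p)//.
rewrite (@iter_dif_comp _ _ _ p v (lam j * h * (j == i)%:R)); last first.
  by move=> y; rewrite /p !mxE eqxx /=; ring.
apply: le_trans (bump_dif hphi _ _ _) _.
have -> : `|lam j * h * (j == i)%:R| = `|h| * lam i * (j == i)%:R.
  rewrite !normrM normr_nat (gtr0_norm (lam0 j)).
  by case: eqP => [->|_]; rewrite ?mulr0// mulr1 mulr1 mulrC.
have Cm : 0 <= C m.
  by have := bump_dif hphi 1 m 0; rewrite normr1 expr1n mulr1; exact: le_trans.
apply: ler_pM => //.
  by rewrite exprn_ge0// mulr_ge0.
  exact: CB.
apply: lerXn2r; rewrite ?nnegrE ?(mulr_ge0 t0)//.
by rewrite ler_piMr// lern1 leq_b1.
Qed.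

End test_function.

(** * Wave packets and tangency to a coordinate plane *)

Section packets.
Variables (R : realType) (n : nat) (L delta : R) (W : wave_packets R n).
Variables (K : nat) (kappa c : R) (A : nat -> R).
Hypothesis L1 : 1 <= L.
Hypothesis hW : is_wave_packets L delta W K kappa c A.

Lemma caprad_gt0 : 0 < caprad L.
Proof. by apply: powR_gt0; exact: lt_le_trans L1. Qed.

Lemma caprad_le1 : caprad L <= 1.
Proof.
by rewrite /caprad -[leRHS](powRr0 L); apply: ler_powR.
Qed.

Lemma deriv_bounds0 m (g : 'rV[R]_m -> R) (B : nat -> R) r x : deriv_bounds B r g -> `|g x| <= B 0%N.
Proof. by move=> /(_ [::] x); rewrite /= expr0 invr1 mulr1. Qed.

Lemma measurable_centred_box (x : 'rV[R]_n) r :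
  measurable (pbox (fun i => `[x ord0 i - r, x ord0 i + r]%classic)).
Proof. by apply: measurable_pbox => i; exact: measurable_itv. Qed.

Lemma leb_centred_box (x : 'rV[R]_n) r : 0 <= r ->
  leb R n (pbox (fun i => `[x ord0 i - r, x ord0 i + r]%classic)) = ((2 * r) ^+ n)%:E.
Proof.
move=> r0; rewrite -[X in _ ^+ X]card_ord -prodr_const.
apply: leb_pbox => i; first exact: measurable_itv.
exact: lebesgue_measure_centred.
Qed.

Lemma eball_sub_box (x : 'rV[R]_n) r :
  eball x r `<=` pbox (fun i => `[x ord0 i - r, x ord0 i + r]%classic).
Proof.
move=> y; rewrite /eball /= => h i; rewrite /= in_itv/=.
have := le_trans (coord_le_enorm (y - x) i) h.
by rewrite !mxE ler_distl.
Qed.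

Lemma Re_real_fourier (u v : 'rV[R]_n -> R) y :
  complex.Re (fourier (fun z => (u z)%:C%C * (v z)%:C%C) y) = trig_int cos y (u \* v).
Proof.
rewrite /fourier /cintegral /= /trig_int; congr (Rintegral _ _ _); apply/funext => x.
rewrite /=; ring.
Qed.

Lemma Im_real_fourier (u v : 'rV[R]_n -> R) y :
  complex.Im (fourier (fun z => (u z)%:C%C * (v z)%:C%C) y) = trig_int sin y (u \* v).
Proof.
rewrite /fourier /cintegral /= /trig_int; congr (Rintegral _ _ _); apply/funext => x.
rewrite /=; ring.
Qed.

Lemma radius_ge0 k : 0 <= Defs.radius W k.
Proof.
apply: le_trans (radius_ge hW k); rewrite mulr_ge0 ?invr_ge0//; exact: powR_ge0.
Qed.

(** Supremum times support, twice: the inverse transform integrates over a box of side [2 * radius]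
    (the 4 comes from real and imaginary parts), and the packet lives in a box of side
    [2 * caprad L <= 2]. The factor [(2 * pi) ^- n] is bounded by 1. *)
Lemma packet_L2norm_le (v : 'rV[R]_n -> R) (p : cap W * 'rV[int]_n) (Q : R) :
  0 <= Q ->
  (forall y, eta W p.2 y != 0 ->
    `|trig_int cos y (psi p.1 \* v)| <= Q /\ `|trig_int sin y (psi p.1 \* v)| <= Q) ->
  (L2norm (packet (fun z => (v z)%:C%C) p) <=
    (A 0%N * (4 * Q * (2 * Defs.radius W p.2) ^+ n) * 2 ^+ n)%:E)%E.
Proof.
move=> Q0 hQ.
have A0 : 0 <= A 0%N by apply: le_trans (deriv_bounds0 0 (psit_bounds hW p.1)).
have r0 := radius_ge0 p.2.
set B := pbox (fun i => `[(nu L delta p.2) ord0 i - Defs.radius W p.2, (nu L delta p.2) ord0 i + Defs.radius W p.2]%classic).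
have etaB y : ~ B y -> eta W p.2 y = 0.
  move=> By; apply/eqP/negPn/negP => h; apply: By; apply: eball_sub_box.
  by apply: (eta_supp hW); apply: subset_closure.
have eta1 y : `|eta W p.2 y| <= 1.
  by have /andP[h0 h1] := eta_01 hW p.2 y; rewrite ger0_norm.
pose G := fun y => fourier (fun z => (psi p.1 z)%:C%C * (v z)%:C%C) y.
have core y (s s' t t' : R) : `|s| <= 1 -> `|s'| <= 1 -> t = s * eta W p.2 y -> t' = s' * eta W p.2 y ->
    `|t * complex.Re (G y) + t' * complex.Im (G y)| <= 2 * Q.
  move=> s1 s'1 -> ->.
  have [->|h] := eqVneq (eta W p.2 y) 0.
    by rewrite !mulr0 !mul0r addr0 normr0 mulr_ge0.
  have [hc hs] := hQ y h.
  rewrite /G Re_real_fourier Im_real_fourier (le_trans (ler_normD _ _))// !normrM.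
  rewrite mulr_natl mulr2n; apply: lerD; rewrite -[leRHS]mul1r; apply: ler_pM => //.
    by rewrite -[leRHS]mul1r; apply: ler_pM.
  by rewrite -[leRHS]mul1r; apply: ler_pM.
have inner xi : cabs (ifourier (fun y => (eta W p.2 y)%:C%C * G y) xi) <= 4 * Q * (2 * Defs.radius W p.2) ^+ n.
  rewrite /ifourier cabsM cabs_real.
  have pi1 : `|(2 * pi) ^- n : R| <= 1.
    rewrite normrV ?unitfE ?expf_neq0 ?mulf_neq0 ?pnatr_eq0 ?gt_eqF ?pi_gt0//.
    rewrite invf_le1; last by rewrite normr_gt0 expf_neq0 ?mulf_neq0 ?pnatr_eq0 ?gt_eqF ?pi_gt0.
    rewrite ger0_norm ?exprn_ge0 ?mulr_ge0 ?pi_ge0//; apply: exprn_ege1.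
    by have := pi_ge2 R; lra.
  rewrite -[leRHS]mul1r; apply: ler_pM => //; first exact: cabs_ge0.
  apply: le_trans (cabs_le _) _.
  have -> : 4 * Q * (2 * Defs.radius W p.2) ^+ n =
    2 * Q * (2 * Defs.radius W p.2) ^+ n + 2 * Q * (2 * Defs.radius W p.2) ^+ n by ring.
  apply: lerD; apply: (@normr_Rintegral_le _ _ R (leb R n) _ B).
  - exact: measurable_centred_box.
  - by rewrite [X in (X <= _)%E]leb_centred_box.
  - by rewrite mulr_ge0.
  - move=> y; case E: (G y) => [g1 g2]; have := core y (cos (- dot y xi)) (- sin (- dot y xi)).
    rewrite normrN => /(_ _ _ (cos_max _) (sin_max _) erefl erefl); rewrite E /=.
    by apply: le_trans; rewrite le_eqVlt; apply/orP; left; apply/eqP; congr (`| _ |); ring.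
  - by move=> y /etaB ->; rewrite /= ; case: (G y) => g1 g2 /=; ring.
  - exact: measurable_centred_box.
  - by rewrite [X in (X <= _)%E]leb_centred_box.
  - by rewrite mulr_ge0.
  - move=> y; case E: (G y) => [g1 g2]; have := core y (sin (- dot y xi)) (cos (- dot y xi)).
    move=> /(_ _ _ (sin_max _) (cos_max _) erefl erefl); rewrite E /=.
    by apply: le_trans; rewrite le_eqVlt; apply/orP; left; apply/eqP; congr (`| _ |); ring.
  - by move=> y /etaB ->; rewrite /= ; case: (G y) => g1 g2 /=; ring.
have I0 : 0 <= 4 * Q * (2 * Defs.radius W p.2) ^+ n by rewrite !mulr_ge0// exprn_ge0// mulr_ge0.
apply: (@L2norm_le _ _ _ (pbox (fun i => `[(omega p.1) ord0 i - caprad L, (omega p.1) ord0 i + caprad L]%classic))).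
- exact: measurable_centred_box.
- by rewrite mulr_ge0.
- exact: exprn_ge0.
- rewrite [X in (X <= _)%E]leb_centred_box ?(ltW caprad_gt0)//.
  rewrite lee_fin -exprM mulnC exprM; apply: lerXn2r; rewrite ?nnegrE ?mulr_ge0 ?(ltW caprad_gt0)//.
  have := caprad_le1; lra.
- move=> xi; rewrite /packet cabsM cabs_real; apply: ler_pM; [exact: normr_ge0|exact: cabs_ge0| |exact: inner].
  exact: deriv_bounds0 (psit_bounds hW p.1).
move=> xi h; rewrite /packet (_ : psit p.1 xi = 0) ?mul0r//.
apply/eqP/negPn/negP => h'; apply: h; apply: eball_sub_box.
by apply: (psit_supp hW); apply: subset_closure.
Qed.

(** Volume count: the boxes of half-side [caprad L / n] inside the caps overlap at most [K] times
    and all lie in the cube of half-side 2. *)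
Lemma card_cap_le : (0 < n)%N ->
  #|cap W|%:R <= K%:R * (2 * n%:R / caprad L) ^+ n :> R.
Proof.
move=> n0; pose r0 := caprad L / n%:R.
have n0' : 0 < n%:R :> R by rewrite ltr0n.
have c0 := caprad_gt0.
have r00 : 0 < r0 by rewrite divr_gt0.
pose Q (t : cap W) := pbox (fun i => `[(omega t) ord0 i - r0, (omega t) ord0 i + r0]%classic).
have Qth t : Q t `<=` theta L t.
  move=> x h; rewrite /theta /eball /=; apply: le_trans (enorm_le_sum _) _.
  have -> : caprad L = \sum_(i < n) r0.
    by rewrite sumr_const card_ord -mulr_natr /r0 divfK// gt_eqF.
  apply: ler_sum => i _; have := h i; by rewrite /= in_itv/= !mxE ler_distl.
have Q2 t : Q t `<=` cube n (2 : R).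
  move=> x h i; have := h i; rewrite /= !in_itv/=.
  have := coord_le_enorm (omega t) i.
  have := omega_ball hW t; rewrite /eball /= subr0 => o1 /le_trans /(_ o1).
  have r01 : r0 <= 1.
    rewrite /r0 ler_pdivrMr// mul1r; apply: le_trans caprad_le1 _.
    by rewrite ler1n.
  rewrite ler_norml; move: (omega t ord0 i : R) (x ord0 i : R) => o y.
  by move=> /andP[? ?] /andP[? ?]; apply/andP; split; lra.
have mQ t : measurable (Q t) by exact: measurable_centred_box.
have main : (\sum_(t : cap W) leb R n (Q t) <= K%:R%:E * leb R n (cube n (2 : R)))%E.
  under eq_bigr => t _ do rewrite -[Q t]setIT -integral_indic//.
  rewrite -ge0_integral_sum//; last first.
    by move=> t; apply/measurable_EFinP; exact: measurable_indic.
  apply: integral_le_cst => //.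
  - exact: measurable_cube.
  - by move=> x; apply: sume_ge0 => t _; rewrite lee_fin.
  - move=> x; rewrite sumEFin lee_fin.
    under eq_bigr => t _ do rewrite indicE.
    rewrite -natr_sum ler_nat -(big_mkcond (fun t => x \in Q t) (fun=> 1%N)) sum1_card.
    rewrite cardE; apply: (theta_overlap hW (x := x)); first exact: enum_uniq.
    move=> t; rewrite mem_enum => ht; apply: Qth.
    by move: ht; rewrite unfold_in => /asboolP.
  - move=> x nx; apply: big1 => t _; rewrite indicE memNset// => /Q2; exact: nx.
have e t : leb R n (Q t) = ((2 * r0) ^+ n)%:E by apply: leb_centred_box; exact: ltW.
move: main; rewrite (eq_bigr (fun=> ((2 * r0) ^+ n)%:E)); last by move=> t _; exact: e.
rewrite sumEFin [X in (_ * X)%E]leb_cube// -EFinM lee_fin sumr_const.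
move=> main.
have r0n : 0 < (2 * r0) ^+ n by rewrite exprn_gt0// mulr_gt0.
rewrite -(ler_pM2r r0n) (mulr_natl ((2 * r0) ^+ n)).
apply: le_trans main _; rewrite -(mulrA K%:R) -exprMn.
rewrite (_ : 2 * n%:R / caprad L * (2 * r0) = 2 * 2)//.
rewrite /r0; field; by rewrite !gt_eqF.
Qed.

End packets.

(** * A coordinate plane as a transverse complete intersection *)

Section coordinate_plane.
Variables (R : realType) (n J : nat).
Hypothesis Jn : (J <= n)%N.

Definition plane_ix (l : 'I_J) : 'I_(n + 1) := lshift 1 (widen_ord Jn l).

Definition coord_poly (l : 'I_J) : mpoly.mpoly (n + 1) R :=
  mpoly.mpolyX R (mpoly.mnm1 (plane_ix l)).

Lemma plane_ix_inj : injective plane_ix.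
Proof. by move=> i j /lshift_inj /(congr1 val) /= ij; exact/val_inj. Qed.

Lemma total_degree_coord_poly l : total_degree (coord_poly l) = 1%N.
Proof. by rewrite /total_degree /coord_poly mpoly.msizeX mpoly.mdeg1. Qed.

Lemma zset_coord_poly : zset coord_poly =
  [set x : 'rV[R]_(n + 1) | forall l, x ord0 (plane_ix l) = 0].
Proof.
by apply/seteqP; split => x /= h l; have := h l; rewrite /coord_poly mpoly.mevalXU.
Qed.

Lemma gradients_coord_poly z l i :
  gradients coord_poly z l i = (plane_ix l == i)%:R.
Proof.
rewrite mxE /coord_poly mpoly.mderivX mpoly.mevalZ mpoly.mnm1E.
case: eqP => [->|_]; last by rewrite mul0r.
rewrite mul1r mpoly.mevalX big1// => j _.
by rewrite mpoly.mnmBE subnn expr0.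
Qed.

(** The minor on the columns [plane_ix l] is the determinant of the identity. *)
Lemma transverse_coord_poly : transverse_complete_intersection coord_poly.
Proof.
move=> z _; apply/negP => /eqP /ffunP /(_ [ffun l => plane_ix l]).
rewrite !ffunE (_ : colsub _ _ = 1%:M) ?det1; first by apply/eqP/oner_neq0.
apply/matrixP => i j; rewrite mxE gradients_coord_poly ffunE mxE.
by rewrite (inj_eq plane_ix_inj).
Qed.

Lemma tangent_space_coord_poly z : tangent_space coord_poly z =
  [set v : 'rV[R]_(n + 1) | forall l, v ord0 (plane_ix l) = 0].
Proof.
have e l (v : 'rV[R]_(n + 1)) : dot (row l (gradients coord_poly z)) v = v ord0 (plane_ix l).
  rewrite /dot (bigD1 (plane_ix l))//= mxE gradients_coord_poly eqxx mul1r big1 ?addr0// => i il.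
  by rewrite mxE gradients_coord_poly eq_sym (negbTE il) mul0r.
by apply/seteqP; split => v /= h l; have := h l; rewrite e.
Qed.

Definition plane_proj (v : 'rV[R]_(n + 1)) : 'rV[R]_(n + 1) :=
  \row_i (if [exists l, plane_ix l == i] then 0 else v ord0 i).

Lemma plane_projE v i :
  plane_proj v ord0 i = if [exists l, plane_ix l == i] then 0 else v ord0 i.
Proof. by rewrite mxE. Qed.

Lemma plane_projP v l : plane_proj v ord0 (plane_ix l) = 0.
Proof. by rewrite mxE ifT//; apply/existsP; exists l. Qed.

Lemma plane_proj_neq v i : (forall l, plane_ix l != i) -> plane_proj v ord0 i = v ord0 i.
Proof.
by move=> h; rewrite mxE ifF//; apply/negbTE/negP => /existsP[l]; rewrite (negbTE (h l)).
Qed.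

Lemma sum_plane (F : 'I_(n + 1) -> R) (c : R) : (forall i, 0 <= F i) ->
  (forall i, (forall l, plane_ix l != i) -> F i = 0) ->
  (forall l, F (plane_ix l) <= c) -> 0 <= c -> \sum_i F i <= n%:R * c.
Proof.
move=> F0 Fz Fc c0; rewrite big_split_ord /= [X in _ + X]big1 ?addr0.
  rewrite -[X in X%:R]card_ord mulr_natl -sumr_const; apply: ler_sum => i _.
  have [iJ|iJ] := ltnP i J.
    have := Fc (Ordinal iJ); congr (F _ <= c); exact/val_inj.
  rewrite Fz// => l; apply/negP => /eqP /(congr1 val) /= li.
  by move: iJ; rewrite -li leqNgt ltn_ord.
move=> i _; apply: Fz => l; apply/negP => /eqP /(congr1 val) /= li.
by have := leq_trans (ltn_ord l) Jn; rewrite li ltnNge leq_addr.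
Qed.

End coordinate_plane.

Section acos_bound.
Variable R : realType.

(** With [t = acos rho], the mean value theorem gives [sin t = t * cos c] for some [c] in [[0, t]],
    and [cos c >= cos t >= 1/2]. *)
Lemma acos_le_sin (rho : R) : 2^-1 <= rho <= 1 ->
  acos rho <= 2 * Num.sqrt (1 - rho ^+ 2).
Proof.
move=> /andP[r0 r1].
have rr : -1 <= rho <= 1 by lra.
have t0 := acos_ge0 rr; have tpi := acos_lepi rr.
set t := acos rho in t0 tpi *.
have ct : cos t = rho by rewrite /t acosK// in_itv/=.
rewrite -(sin_acos rr) -/t.
have [c ct'] : exists2 c, c \in `[0, t] & sin t - sin 0 = cos c * (t - 0).
  apply: (@MVT_segment R sin cos) => //.
  by apply: continuous_subspaceT; exact: continuous_sin.
rewrite sin0 !subr0 => ->.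
have : rho <= cos c.
  move: ct'; rewrite in_itv/= => /andP[c0 ct2].
  rewrite -ct leNgt ltr_cos ?in_itv/= ?c0 ?t0 ?tpi ?(le_trans ct2)//.
  by rewrite -leNgt.
move=> h; nra.
Qed.

Lemma enormZ n (s : R) (v : 'rV[R]_n) : enorm (s *: v) = `|s| * enorm v.
Proof.
rewrite /enorm -sqrtr_sqr -sqrtrM ?sqr_ge0//; congr Num.sqrt.
by rewrite /dot mulr_sumr; apply: eq_bigr => i _; rewrite !mxE; ring.
Qed.

Lemma angle_le n (v w : 'rV[R]_n) (V : set 'rV[R]_n) (c : R) : 0 <= c ->
  V w -> w != 0 -> acos (dot v w / (enorm v * enorm w)) <= c -> angle v V <= c.
Proof.
move=> c0 Vw w0 h; rewrite /angle; set A := [set _ | _ in _].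
have Aw : A (acos (dot v w / (enorm v * enorm w))) by exists w.
(* [inf] is 0 on a set without lower bound, and [0 <= c] covers that case. *)
have [lA|nA] := pselect (has_lbound A).
  by apply: le_trans h; apply: ge_inf.
by rewrite inf_out// => -[_ /nA].
Qed.

End acos_bound.

(** * Tangency of tubes to the coordinate plane *)

Section tangency.
Variables (R : realType) (n J : nat) (Jn : (J <= n)%N).
Variables (S L delta X : R) (W : wave_packets R n).
Hypothesis n0 : (0 < n)%N.
Hypothesis LS : L = S ^+ 2.
Hypothesis XL : X = L `^ delta.
Hypothesis X8 : 8 * n%:R <= X.
Hypothesis S8 : 8 * n%:R <= S.

Let S0 : 0 < S.
Proof. by apply: lt_le_trans S8; rewrite mulr_gt0// ltr0n. Qed.

Lemma powR_half : L `^ 2^-1 = S.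
Proof. by rewrite LS powR12_sqrt ?sqr_ge0// sqrtr_sqr gtr0_norm. Qed.

Lemma powR_Nhalf : L `^ (- 2^-1) = S^-1.
Proof. by rewrite powRN powR_half. Qed.

Lemma powR_half_delta : L `^ (2^-1 + delta) = S * X.
Proof.
have L0 : L != 0 by rewrite LS sqrf_eq0 gt_eqF.
by rewrite powRD ?L0 ?implybT// powR_half XL.
Qed.

Lemma tangent_coord_poly (p : cap W * 'rV[int]_n) :
  (forall i : 'I_n, (i < J)%N -> `|omega p.1 ord0 i| <= 2 / S) ->
  (forall i : 'I_n, (i < J)%N -> `|nu L delta p.2 ord0 i| <= X ^+ 2 * S / (4 * n%:R)) ->
  tangent L delta (coord_poly R Jn) (X ^+ 2) p.
Proof.
move=> homega hnu.
have n1 : 1 <= n%:R :> R by rewrite ler1n.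
have X0 : 0 < X by apply: lt_le_trans X8; rewrite mulr_gt0// ltr0n.
have Sn := S8; have Xn := X8; have S0' := S0.
have XS2 : 0 < X ^+ 2 * S by rewrite mulr_gt0// exprn_gt0.
split.
  move=> x [xL hx]; split => //.
  rewrite powR_half zset_coord_poly; exists (plane_proj Jn x).
    by move=> l; exact: plane_projP.
  apply: le_lt_trans (enorm_le_sum _) _.
  (* Bound for one of the first [J] coordinates on the tube: its radius, the drift [2 * t * omega]
     with [|t| <= S^2] and [|omega| <= 2 / S], and [nu]. As [8 * n <= X], [n] times this stays below
     [E * S = X^2 * S]. *)
  pose c := S * X + 4 * S + X ^+ 2 * S / (4 * n%:R).
  apply: le_lt_trans (_ : _ <= n%:R * c) _.
    apply: (@sum_plane _ _ _ Jn) => //.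
    - by move=> i h; rewrite 2!mxE plane_proj_neq// subrr normr0.
    - move=> l; rewrite 2!mxE plane_projP oppr0 addr0.
      pose i := widen_ord Jn l.
      have iJ : (i < J)%N by exact: ltn_ord l.
      move: (nu L delta p.2) hx (hnu i iJ) => nv hx h4.
      have h1 := le_trans (coord_le_enorm _ i) hx.
      have h2 : `|tpart x| <= S ^+ 2.
        rewrite -LS; move: xL; rewrite /eball /= subr0; apply: le_trans.
        rewrite /tpart; have := coord_le_enorm x (rshift n ord0).
        by rewrite /rsubmx mxE.
      have h3 := homega i iJ.
      move: h1; rewrite powR_half_delta !mxE /plane_ix -/i.
      move: h3 h4 h2; move: (omega p.1 ord0 i : R) (nv ord0 i : R) (tpart x) (x ord0 (lshift 1 i) : R).
      move=> w v t y hw hv ht hy.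
      rewrite (_ : y = (y + 2 * t * w - v) - 2 * t * w + v); last by ring.
      rewrite /c; apply: le_trans (ler_normD _ _) _; apply: lerD => //.
      apply: le_trans (ler_normB _ _) _; apply: lerD => //.
      rewrite !normrM (ger0_norm (_ : 0 <= 2))//.
      apply: le_trans (_ : 2 * S ^+ 2 * (2 / S) <= _).
        by apply: ler_pM => //; rewrite ?mulr_ge0// ler_wpM2l.
      by rewrite le_eqVlt; apply/orP; left; apply/eqP; field; rewrite gt_eqF.
    - by rewrite /c !addr_ge0 ?mulr_ge0 ?invr_ge0 ?exprn_ge0 ?(ltW S0) ?(ltW X0).
  rewrite /c (_ : n%:R * _ = S * (n%:R * X + 4 * n%:R + X ^+ 2 / 4)); last by field; rewrite gt_eqF//; lra.
  rewrite [ltRHS]mulrC ltr_pM2l//.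
  by move: n1 X8; move: (n%:R : R) => m m1 Xm; nra.
move=> z _ _ _; rewrite powR_Nhalf tangent_space_coord_poly.
(* The angle is tested on the orthogonal projection [w] of [v]: the cosine is [enorm w / enorm v],
   and [v] leaves the plane by at most [4 / S] in each coordinate, so the angle is at most
   [8 * n / S <= X^2 / S]. *)
set v := dirvec p.1; set w := plane_proj Jn v.
have vlast : v ord0 (rshift n ord0) = 1 by rewrite /v /dirvec row_mxEr mxE.
have wlast : w ord0 (rshift n ord0) = 1.
  by rewrite plane_proj_neq// => l; apply/negP => /eqP /(congr1 val) /= li;
     have := leq_trans (ltn_ord l) Jn; rewrite li ltnNge leq_addr.
have w1 : 1 <= enorm w by have := coord_le_enorm w (rshift n ord0); rewrite wlast normr1.
have v1 : 1 <= enorm v by have := coord_le_enorm v (rshift n ord0); rewrite vlast normr1.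
have w0 : w != 0 by apply/eqP => w0; move: w1; rewrite w0 enorm0 ler10.
have dvw : dot v w = enorm w ^+ 2.
  rewrite sqr_enorm; apply: eq_bigr => i _; rewrite /w plane_projE.
  by case: ifP => _ //; rewrite !mulr0.
have diff : enorm v ^+ 2 - enorm w ^+ 2 <= n%:R * (4 / S) ^+ 2.
  rewrite !sqr_enorm /dot -sumrB; apply: (@sum_plane _ _ _ Jn) => //.
  - move=> i; rewrite /w plane_projE; case: ifP => _; last by rewrite subrr.
    by rewrite mul0r subr0 -expr2 sqr_ge0.
  - by move=> i h; rewrite /w plane_proj_neq// subrr.
  - move=> l; rewrite plane_projP mul0r subr0 -expr2 /v /dirvec /plane_ix row_mxEl !mxE.
    rewrite -real_normK ?num_real//; apply: lerXn2r; rewrite ?nnegrE ?divr_ge0 ?(ltW S0)//.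
    rewrite normrN normrM (ger0_norm (_ : 0 <= 2))//.
    have := homega (widen_ord Jn l) (ltn_ord l); lra.
  - by rewrite sqr_ge0.
pose s := (enorm v)^-1.
have s0 : 0 < s by rewrite invr_gt0; lra.
apply: (@angle_le _ _ _ w) => //.
- by rewrite divr_ge0 ?exprn_ge0 ?(ltW X0) ?(ltW S0).
- by move=> l; exact: plane_projP.
have -> : direction p.1 = s *: v by [].
rewrite enormZ gtr0_norm// (_ : dot (s *: v) w = s * enorm w ^+ 2); last first.
  by rewrite -dvw /dot mulr_sumr; apply: eq_bigr => i _; rewrite !mxE mulrA.
have -> : s * enorm w ^+ 2 / (s * enorm v * enorm w) = enorm w / enorm v.
  by field; rewrite !gt_eqF//; lra.
set rho := enorm w / enorm v.
have v2 : 1 <= enorm v ^+ 2 by exact: exprn_ege1.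
have rho2 : 1 - rho ^+ 2 <= n%:R * (4 / S) ^+ 2.
  apply: le_trans diff; rewrite /rho expr_div_n.
  rewrite -[X in X - _](@divff _ (enorm v ^+ 2)) ?gt_eqF//; last by lra.
  rewrite -mulrBl ler_pdivrMr; last by lra.
  have : 0 <= enorm v ^+ 2 - enorm w ^+ 2.
    rewrite !sqr_enorm /dot -sumrB; apply: sumr_ge0 => i _.
    rewrite /w plane_projE; case: ifP => _; last by rewrite subrr.
    by rewrite mul0r subr0 -expr2 sqr_ge0.
  by move: v2; nra.
have rho0 : 0 <= rho by rewrite divr_ge0 ?enorm_ge0.
have nS : n%:R * (4 / S) ^+ 2 <= (4 * n%:R / S) ^+ 2.
  rewrite !expr_div_n !exprMn mulrA ler_wpM2r ?invr_ge0 ?exprn_ge0 ?(ltW S0)//.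
  move: n1; move: (n%:R : R) => m m1; nra.
have nS2 : 4 * n%:R / S <= 2^-1 by rewrite ler_pdivrMr//; lra.
have nS0 : 0 <= 4 * n%:R / S by rewrite divr_ge0// ltW.
have rho1 : rho <= 1.
  rewrite /rho ler_pdivrMr; last by lra.
  rewrite mul1r -(@ler_pXn2r _ 2)// ?nnegrE ?enorm_ge0// !sqr_enorm /dot.
  apply: ler_sum => i _; rewrite /w plane_projE; case: ifP => _ //.
  by rewrite mul0r -expr2 sqr_ge0.
have rho12 : 2^-1 <= rho by nra.
apply: le_trans (acos_le_sin _) _; first by rewrite rho12.
apply: le_trans (_ : 2 * (4 * n%:R / S) <= _).
  rewrite ler_wpM2l//; apply: le_trans (ler_wsqrtr (le_trans rho2 nS)) _.
  by rewrite sqrtr_sqr ger0_norm.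
rewrite (_ : 2 * _ = 8 * n%:R / S); last by ring.
rewrite ler_wpM2r ?invr_ge0 ?(ltW S0)//.
by move: n1 X8; move: (n%:R : R) => m m1 Xm; nra.
Qed.

End tangency.

(** * Concentration of the test function *)

Section lattice_sums.
Variable R : realType.

Definition int_wt (z : int) : R := ((1 + (absz z)%:R) ^+ 2)^-1.
(** A weight on [Z^n] of total mass at most [4 ^+ n]; packet bounds carry it as a factor so that
    they can be summed over all [nu]. *)
Definition lattice_wt n (k : 'rV[int]_n) : R := \prod_i int_wt (k ord0 i).

Lemma int_wt_gt0 z : 0 < int_wt z.
Proof. by rewrite invr_gt0 exprn_gt0// ltr_wpDr. Qed.

Lemma lattice_wt_gt0 n (k : 'rV[int]_n) : 0 < lattice_wt k.
Proof. by apply: prodr_gt0 => i _; exact: int_wt_gt0. Qed.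

Lemma lattice_wt_ge n (k : 'rV[int]_n) (m : R) : 0 <= m ->
  (forall i, (absz (k ord0 i))%:R <= m) -> ((1 + m) ^- 2) ^+ n <= lattice_wt k.
Proof.
move=> m0 km; rewrite -[X in _ ^+ X]card_ord -prodr_const; apply: ler_prod => i _.
rewrite invr_ge0 exprn_ge0 ?addr_ge0//= /int_wt lef_pV2 ?posrE ?exprn_gt0 ?ltr_wpDr//.
by apply: lerXn2r; rewrite ?nnegrE ?addr_ge0// lerD2l.
Qed.

Lemma sum_inv_sqr B : \sum_(d < B) (((1 + d%:R) ^+ 2)^-1 : R) <= 2.
Proof.
(* The subtracted term makes the induction close, as in a telescoping sum. *)
suff : \sum_(d < B) (((1 + d%:R) ^+ 2)^-1 : R) <= 2 - 2 / (1 + B%:R).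
  move/le_trans; apply; rewrite gerBl divr_ge0// addr_ge0//.
elim: B => [|B IH]; first by rewrite big_ord0 addr0 divr1 subrr.
rewrite big_ord_recr /=; apply: le_trans (lerD IH (lexx _)) _.
rewrite -[B.+1%:R]natr1; set x : R := B%:R.
have x0 : 0 <= x by rewrite ler0n.
rewrite -subr_ge0.
have -> : 2 - 2 / (1 + (x + 1)) - (2 - 2 / (1 + x) + ((1 + x) ^+ 2)^-1) = x / ((1 + x) ^+ 2 * (2 + x)).
  by field; rewrite !gt_eqF//; lra.
by rewrite divr_ge0// mulr_ge0 ?exprn_ge0//; lra.
Qed.

(** The entries in [s] are bounded, so sign and absolute value embed [s] into a finite type on which
    the sum factors; each coordinate contributes two signs times [sum_inv_sqr], at most 4. *)
Lemma sum_lattice_wt (I : finType) n (s : seq (I * 'rV[int]_n)) : uniq s ->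
  \sum_(x <- s) lattice_wt x.2 <= #|I|%:R * 4 ^+ n.
Proof.
move=> us; pose B := \max_(x <- s) \max_i absz (x.2 ord0 i).
have BP x i : x \in s -> (absz (x.2 ord0 i) < B.+1)%N.
  move=> xs; rewrite ltnS /B (big_rem x)//= leq_max; apply/orP; left.
  exact: (leq_bigmax (F := fun i => absz (x.2 ord0 i))).
pose enc (x : I * 'rV[int]_n) : I * {ffun 'I_n -> bool * 'I_B.+1} :=
  (x.1, [ffun i => (x.2 ord0 i < 0, inord (absz (x.2 ord0 i)))]).
pose w (j : bool * 'I_B.+1) : R := ((1 + (j.2 : nat)%:R) ^+ 2)^-1.
have encE x : x \in s -> lattice_wt x.2 = \prod_i w ((enc x).2 i).
  move=> xs; apply: eq_bigr => i _; rewrite /w /int_wt ffunE /= inordK//; exact: BP.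
have enc_inj : {in s &, injective enc}.
  move=> [t k] [t' k'] xs ys [-> /ffunP e]; congr pair; apply/rowP => i.
  have := e i; rewrite !ffunE => -[es /(congr1 val)].
  rewrite /= !inordK; [|exact: (BP _ i ys)|exact: (BP _ i xs)] => ea.
  move: es ea; case: (k ord0 i) => u; case: (k' ord0 i) => v //=; first by move=> _ ->.
  by move=> _ [->].
rewrite big_seq (eq_bigr _ encE) -big_seq.
rewrite -(big_map enc predT (fun y => \prod_i w (y.2 i))) big_uniq ?map_inj_in_uniq//=.
have w0 j : 0 <= w j by rewrite invr_ge0 exprn_ge0// addr_ge0.
apply: le_trans (_ : \sum_(y : I * {ffun 'I_n -> bool * 'I_B.+1}) \prod_i w (y.2 i) <= _).
  rewrite big_mkcond; apply: ler_sum => y _; case: ifP => // _.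
  by apply: prodr_ge0 => i _.
rewrite -(pair_bigA _ (fun (t : I) (g : {ffun 'I_n -> bool * 'I_B.+1}) => \prod_i w (g i)))/= sumr_const mulr_natl.
apply: ler_wMn2r; rewrite -(bigA_distr_bigA (fun i j => w j)) /=.
rewrite prodr_const card_ord; apply: lerXn2r; rewrite ?nnegrE ?sumr_ge0//.
rewrite -(pair_bigA _ (fun (s : bool) (d : 'I_B.+1) => ((1 + (d : nat)%:R) ^+ 2)^-1))/=.
rewrite sumr_const card_bool mulr2n.
by have := sum_inv_sqr B.+1; lra.
Qed.

Lemma esum_lattice_le (I : finType) n (P : set (I * 'rV[int]_n)) (F : I * 'rV[int]_n -> \bar R) (c : R) :
  0 <= c -> (forall p, P p -> (F p <= (c * lattice_wt p.2)%:E)%E) ->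
  (\esum_(p in P) F p <= (#|I|%:R * 4 ^+ n * c)%:E)%E.
Proof.
move=> c0 FP; apply: ge_ereal_sup => _ [A [fA AP] <-].
rewrite fsbig_finite//=.
apply: (@le_trans _ _ (\sum_(x <- finmap.enum_fset (fset_set A)) (c * lattice_wt x.2)%:E)).
  rewrite big_seq [leRHS]big_seq; apply: lee_sum => x xA; apply: FP; apply: AP.
  by move: xA; rewrite in_fset_set// inE.
rewrite sumEFin lee_fin -mulr_sumr mulrC ler_wpM2r//; apply: sum_lattice_wt.
exact: finmap.fset_uniq.
Qed.

End lattice_sums.

Lemma dif_bd_le_step (R : realType) (V : zmodType) (v : V) (t t' : R) M B (u : V -> R) :
  0 <= t -> t <= t' -> dif_bd v t M B u -> dif_bd v t' M B u.
Proof.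
move=> t0 tt bu j jM x; apply: le_trans (bu j jM x) _.
rewrite ler_wpM2l ?(dif_bd_ge0 bu)//; apply: lerXn2r; rewrite ?nnegrE//.
exact: le_trans tt.
Qed.

(** * Decay of the localized Fourier transforms *)

Section packet_decay.
Variables (R : realType) (n : nat) (S L delta X : R) (W : wave_packets R n).
Variables (K : nat) (kappa cc : R) (A : nat -> R).
Variables (C : nat -> R) (a b : R) (phi : R -> R).
Variables (lam : 'I_n -> R) (Z : 'I_n -> nat) (D : R) (Zm J : nat).
Hypothesis n0 : (0 < n)%N.
Hypothesis LS : L = S ^+ 2.
Hypothesis XL : X = L `^ delta.
Hypothesis d01 : 0 < delta <= 1.
Hypothesis X8 : 8 * n%:R * (K%:R + 4) <= X.
Hypothesis S8 : 8 * n%:R <= S.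
Hypothesis SK : K%:R <= S.
Hypothesis hW : is_wave_packets L delta W K kappa cc A.
Hypothesis hphi : bump_function C a b phi.
Hypothesis D0 : 0 < D.
Hypothesis Dlam : forall i, 2 * D < lam i.
Hypothesis Slam : forall i, S <= lam i <= S ^+ 2.
Hypothesis ZZm : forall i, (0 < Z i <= Zm)%N.
Hypothesis ZmS : Zm%:R <= S.
Hypothesis lamJ : forall i : 'I_n, (i < J)%N -> lam i = S.
Hypothesis fJ : forall x, fsupp lam Z D x -> forall i : 'I_n, `|x ord0 i| <= 1 /\
  ((i < J)%N -> `|x ord0 i| <= S^-1).

Local Notation f := (ftest phi lam Z D).

Let n1 : 1 <= n%:R :> R. Proof. by rewrite ler1n. Qed.
Let S1 : 1 <= S. Proof. by have h1 := n1; have h2 := S8; lra. Qed.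
Let S0 : 0 < S. Proof. by have := S1; lra. Qed.
Let L1 : 1 <= L. Proof. by rewrite LS exprn_ege1// S1. Qed.
Let X80 : 8 * n%:R <= X.
Proof.
have h1 := n1; have h2 := X8; apply: le_trans h2; rewrite ler_peMr ?mulr_ge0//.
by have : 0 <= K%:R :> R by []; lra.
Qed.
Let X1 : 1 <= X. Proof. by have h1 := n1; have h2 := X80; lra. Qed.
Let X0 : 0 < X. Proof. by have := X1; lra. Qed.

Lemma capradE : caprad L = S^-1.
Proof. by rewrite /caprad (powR_Nhalf n0 LS S8). Qed.

Lemma nuradE : nurad L delta = S * L `^ (delta / 2).
Proof.
rewrite /nurad mulrDl mul1r powRD ?(powR_half n0 LS S8)//.
by rewrite [L == 0]gt_eqF ?implybT//; exact: lt_le_trans L1.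
Qed.

Lemma nurad_le : nurad L delta <= S * X.
Proof.
have /andP[h0 _] := d01.
by rewrite nuradE ler_wpM2l ?(ltW S0)// XL; apply: ler_powR; [exact: L1|lra].
Qed.

Lemma nurad_ge1 : 1 <= nurad L delta.
Proof.
have /andP[h0 _] := d01.
rewrite nuradE -[leLHS]mulr1; apply: ler_pM => //.
by rewrite -[leLHS](powRr0 L); apply: ler_powR; [exact: L1|lra].
Qed.

Lemma nurad_le_sqr : nurad L delta <= S ^+ 2.
Proof.
have /andP[h0 h1] := d01.
rewrite -LS /nurad -[leRHS]powRr1; last by exact: le_trans L1.
by apply: ler_powR; [exact: L1|lra].
Qed.

Let lam0 i : 0 < lam i.
Proof. by have /andP[h _] := Slam i; exact: lt_le_trans h. Qed.

Lemma nice_packet (t : cap W) : nice 1 (psi t \* f).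
Proof.
split.
- apply: measurable_funM; last by apply: measurable_ftest; exact: hphi.
  apply: continuous_measurable_rV => x.
  exact/differentiable_continuous/(psi_smooth hW t [::] x).
- exists (1 * C 0%N ^+ n) => x; rewrite normrM; apply: ler_pM => //.
    by have /andP[h0 h1] := psi_01 hW t x; rewrite ger0_norm.
  by rewrite ger0_norm ?(ftest_ge0 hphi)// (ftest_le hphi).
move=> x cx; rewrite /= (_ : f x = 0) ?mulr0//.
apply/eqP/negPn/negP => /(ftest_supp hphi D0 Dlam) /fJ h; apply: cx => i.
by rewrite /= in_itv/=; have [h1 _] := h i; rewrite -ler_norml.
Qed.

(** Depends on [n], [M] and the bounds [A], [C], but not on the scale, as the constants in RapDec
    must. *)
Definition decay_cst (M : nat) : R :=
  2 ^+ M * ((\sum_(j < M.+1) `|A j|) * (2 ^+ M * \sum_(j < M.+1) `|C j|) ^+ n) *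
    (2 * (1 + M%:R)) ^+ n * pi ^+ M.

Lemma decay_cst_ge0 M : 0 <= decay_cst M.
Proof.
by rewrite /decay_cst !mulr_ge0 ?exprn_ge0 ?pi_ge0 ?mulr_ge0 ?addr_ge0// sumr_ge0// => i _;
   rewrite mulr_ge0// exprn_ge0// mulr_ge0 ?exprn_ge0 ?sumr_ge0.
Qed.

(** In the variable [i] the comb varies at scale [1 / lam i] and [psi t] at the coarser [1 / S], so
    each difference of step [pi / y_i] gains [pi * lam i / |y_i|]. The factor [S ^+ n] bounds
    [Zm ^+ n]. *)
Lemma packet_decay (c : R -> R) (t : cap W) (i : 'I_n) (y : 'rV[R]_n) M :
  measurable_fun setT c -> (forall s, `|c s| <= 1) -> alternating c pi ->
  pi <= `|y ord0 i| ->
  `|trig_int c y (psi t \* f)| <= decay_cst M * S ^+ n * (lam i / `|y ord0 i|) ^+ M.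
Proof.
move=> mc c1 cpi yi.
have y0 : 0 < `|y ord0 i| by apply: lt_le_trans yi; exact: pi_gt0.
set h := pi / y ord0 i.
have hE : `|h| = pi / `|y ord0 i| by rewrite normrM normfV ger0_norm ?pi_ge0.
have t0 : 0 <= `|h| * lam i by rewrite mulr_ge0// ltW.
have bpsi : dif_bd (h *: delta_mx ord0 i) (`|h| * lam i) M (\sum_(j < M.+1) `|A j|) (psi t).
  have := @dif_bd_smooth R n (psi t) A (caprad L) M i h (caprad_gt0 L1) (psi_smooth hW t) (psi_bounds hW t).
  apply: dif_bd_le_step; first by rewrite divr_ge0// ltW// caprad_gt0.
  by rewrite capradE invrK ler_wpM2l//; have /andP[] := Slam i.
have ZZm' j : (Z j <= Zm)%N by have /andP[] := ZZm j.
have bf := dif_bd_ftest hphi D0 Dlam (M := M) i h ZZm'.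
have bu := dif_bdM t0 bpsi bf.
apply: le_trans (trig_int_decay mc c1 cpi ler01 (nice_packet t) yi t0 bu) _.
rewrite hE (_ : pi / `|y ord0 i| * lam i = pi * (lam i / `|y ord0 i|)); last by ring.
rewrite [(pi * _) ^+ M]exprMn /decay_cst.
set T := \sum_(_ < _) _; set U := \sum_(_ < _) _; set V := (lam i / _) ^+ M.
have V0 : 0 <= V by rewrite exprn_ge0// divr_ge0// ltW.
have U0 : 0 <= U by exact: sumr_ge0.
have T0 : 0 <= T by exact: sumr_ge0.
have p0 : 0 <= pi ^+ M :> R by rewrite exprn_ge0// pi_ge0.
have q0 : 0 <= (2 * (1 + M%:R)) ^+ n :> R by rewrite exprn_ge0// mulr_ge0// addr_ge0.
have -> : 2 ^+ M * (T * (2 ^+ M * U) ^+ n) * (2 * (1 + M%:R)) ^+ n * pi ^+ M * S ^+ n * V =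
  2 ^+ M * (T * ((2 ^+ M * U) ^+ n * S ^+ n)) * (pi ^+ M * V) * (2 * (1 + M%:R)) ^+ n by ring.
rewrite ler_wpM2r// ler_wpM2r ?mulr_ge0// ler_wpM2l ?exprn_ge0// ler_wpM2l//.
rewrite -exprMn; apply: lerXn2r; rewrite ?nnegrE ?mulr_ge0 ?exprn_ge0 ?(ltW S0)//.
by rewrite -mulrA ler_wpM2l ?exprn_ge0// mulrC ler_wpM2l.
Qed.

Lemma eta_near (k : 'rV[int]_n) y i : eta W k y != 0 ->
  `|y ord0 i - nu L delta k ord0 i| <= K%:R * nurad L delta.
Proof.
move=> h; have : eball (nu L delta k) (Defs.radius W k) y.
  by apply: (eta_supp hW); apply: subset_closure.
rewrite /eball /= => h1; have := le_trans (coord_le_enorm _ i) h1.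
by rewrite 2!mxE => /le_trans; apply; exact: radius_le hW k.
Qed.

Lemma nuE (k : 'rV[int]_n) i : `|nu L delta k ord0 i| = nurad L delta * (absz (k ord0 i))%:R.
Proof.
rewrite !mxE normrM gtr0_norm; last by apply: lt_le_trans nurad_ge1.
by rewrite -intr_norm natr_absz.
Qed.

(* Far frequencies are controlled by the coordinate in which they are far;
   the remaining polynomially many ones by the coordinate transverse to the
   plane. *)
Lemma nontangent_decay (P M : nat) (c : R -> R) (p : cap W * 'rV[int]_n) y (l : 'I_n) :
  measurable_fun setT c -> (forall s, `|c s| <= 1) -> alternating c pi ->
  S ^+ (P + 12 * n) <= X ^+ M ->
  (l < J)%N -> X ^+ 2 * S / (4 * n%:R) < `|nu L delta p.2 ord0 l| ->
  eta W p.2 y != 0 ->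
  `|trig_int c y (psi p.1 \* f)| <=
    (decay_cst (2 * (2 * n + P)) * 4 ^+ n + decay_cst M * 65 ^+ (2 * n)) * S ^+ n * S ^- P * lattice_wt R p.2.
Proof.
move=> mc c1 cpi XM lJ hl hy.
pose i := [arg max_(i > l) absz (p.2 ord0 i)]%N.
have imax j : (absz (p.2 ord0 j) <= absz (p.2 ord0 i))%N.
  by rewrite /i; case: arg_maxnP => // i' _; apply.
set k := absz (p.2 ord0 i) in imax.
have S6 : 1 <= S ^+ 6 by exact: exprn_ege1 S1.
have Sn0 : 0 <= S ^+ n by rewrite exprn_ge0// ltW.
have SP0 : 0 <= S ^- P by rewrite invr_ge0 exprn_ge0// ltW.
have w0 := lattice_wt_gt0 R p.2.
have pi4 : pi <= 4 :> R by have [/andP[_]] := pihalf_02_cos_pihalf R; lra.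
have nr1 := nurad_ge1; have nrX := nurad_le.
have K0 : 0 <= K%:R :> R by [].
have S1' := S1; have S0' := S0; have X1' := X1; have X0' := X0; have n1' := n1.
have PD1 := @packet_decay c p.1 i y (2 * (2 * n + P)) mc c1 cpi.
have PD2 := @packet_decay c p.1 l y M mc c1 cpi.
move: PD1 PD2 (decay_cst_ge0 (2 * (2 * n + P))) (decay_cst_ge0 M).
move: (decay_cst (2 * (2 * n + P))) (decay_cst M) => d1 d2 PD1 PD2 d10 d20.
rewrite -!mulrA mulrDl.
(* Here [|y_i| >= k / 2], and once [k >= 4 * S^6] two orders of decay give [1 / (S^2 * k)]. Of the
   [2 * n + P] such pairs, [P] pay for [S ^- P] and [2 * n] for the lattice weight. The constant 64
   leaves room for [K <= k / 2] and [pi <= k / 2]. *)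
have [kT|kT] := leP (64 * S ^+ 6) k%:R.
  apply: ler_wpDr.
    by rewrite !mulr_ge0 ?d10 ?d20 ?exprn_ge0// ltW.
  have k0 : 0 < k%:R :> R by lra.
  have yk : k%:R / 2 <= `|y ord0 i|.
    have h1 := eta_near i hy; have h2 := nuE p.2 i; rewrite -/k in h2.
    have : `|nu L delta p.2 ord0 i| <= `|y ord0 i| + `|y ord0 i - nu L delta p.2 ord0 i|.
      rewrite -[X in `|X| <= _](subKr (y ord0 i)); exact: ler_normB.
    have : K%:R <= k%:R / 2 :> R.
      have : S <= S ^+ 6 by rewrite -[leLHS]expr1; apply: ler_weXn2l.
      have := SK; lra.
    move: h1 h2; move: (`|nu _ _ _ _ _|) (`|y _ _ - _|) (`|y ord0 i|) (nurad L delta) (k%:R : R) nr1.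
    move=> N1 N2 Y r kk r1 h1 h2 h3 h4; nra.
  have yi : pi <= `|y ord0 i| by apply: le_trans yk; lra.
  apply: le_trans (PD1 yi) _.
  rewrite -[leLHS]mulrA -[leRHS]mulrA ler_wpM2l ?d10 ?d20//.
  rewrite [leRHS]mulrCA ler_wpM2l//.
  have y0 : 0 < `|y ord0 i| by apply: lt_le_trans yi; exact: pi_gt0.
  have r1 : (lam i / `|y ord0 i|) ^+ 2 <= (S ^+ 2 * k%:R)^-1.
    have h1 : lam i / `|y ord0 i| <= 2 * S ^+ 2 / k%:R.
      rewrite ler_pdivrMr// mulrAC ler_pdivlMr//.
      have /andP[_ h] := Slam i; have := lam0 i; move: h yk; nra.
    apply: le_trans (_ : (2 * S ^+ 2 / k%:R) ^+ 2 <= _).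
      by apply: lerXn2r; rewrite ?nnegrE ?divr_ge0 ?mulr_ge0 ?exprn_ge0 ?(ltW S0) ?(ltW (lam0 i)).
    rewrite expr_div_n ler_pdivrMr ?exprn_gt0// ler_pdivlMl ?mulr_gt0 ?exprn_gt0//.
    rewrite (_ : S ^+ 2 * k%:R * (2 * S ^+ 2) ^+ 2 = 4 * S ^+ 6 * k%:R); last by ring.
    by rewrite expr2 ler_wpM2r ?(ltW k0)//; lra.
  rewrite exprM; apply: le_trans (_ : ((S ^+ 2 * k%:R)^-1) ^+ (2 * n + P) <= _).
    by apply: lerXn2r; rewrite ?nnegrE ?exprn_ge0 ?invr_ge0 ?mulr_ge0 ?exprn_ge0 ?divr_ge0 ?(ltW S0) ?(ltW (lam0 i)).
  have k1 : 1 <= k%:R :> R by lra.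
  have wk : ((1 + k%:R) ^- 2) ^+ n <= lattice_wt R p.2.
    by apply: lattice_wt_ge => // j; rewrite ler_nat.
  rewrite exprD mulrC mulrCA; apply: ler_pM.
  - by rewrite exprn_ge0// invr_ge0 mulr_ge0 ?exprn_ge0// ltW.
  - by rewrite exprn_ge0// invr_ge0 mulr_ge0 ?exprn_ge0// ltW.
  - rewrite exprVn lef_pV2 ?posrE ?exprn_gt0 ?mulr_gt0 ?exprn_gt0//.
    apply: lerXn2r; rewrite ?nnegrE ?mulr_ge0 ?exprn_ge0 ?(ltW S0)//.
    by have := k1; have := S1; nra.
  apply: le_trans (_ : 4 ^+ n * ((1 + k%:R) ^- 2) ^+ n <= _); last by rewrite ler_wpM2l ?exprn_ge0.
  rewrite exprM -exprMn; apply: lerXn2r; rewrite ?nnegrE ?exprn_ge0 ?mulr_ge0 ?invr_ge0 ?exprn_ge0 ?addr_ge0 ?(ltW S0)//.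
    by rewrite mulr_ge0// exprn_ge0// ltW.
  rewrite exprVn ler_pdivlMr ?exprn_gt0 ?addr_gt0// ler_pdivrMl ?exprn_gt0 ?mulr_gt0 ?exprn_gt0//.
  have : 1 <= S ^+ 2 by exact: exprn_ege1.
  move: (S ^+ 2) => s2 s21.
  rewrite (_ : (s2 * k%:R) ^+ 2 * 4 = (2 * (s2 * k%:R)) ^+ 2); last by ring.
  have sk : k%:R <= s2 * k%:R by rewrite ler_peMl// ltW.
  by apply: lerXn2r; rewrite ?nnegrE; lra.
apply: ler_wpDl.
  by rewrite !mulr_ge0 ?d10 ?d20 ?exprn_ge0// ltW.
(* Since [8 * n * (K + 4) <= X], the hypothesis on [nu_l] gives [|nu_l| > 2 * (K + 4) * S * X],
   whereas [y_l] is within [K * S * X] of [nu_l]. With [lam l = S], each order of decay then gains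
   [1 / X]. *)
have yl : S * X * 4 <= `|y ord0 l|.
  have h1 := eta_near l hy.
  have h3 : `|nu L delta p.2 ord0 l| <= `|y ord0 l| + `|y ord0 l - nu L delta p.2 ord0 l|.
    rewrite -[X in `|X| <= _](subKr (y ord0 l)); exact: ler_normB.
  have h4 : K%:R * nurad L delta <= K%:R * (S * X) by rewrite ler_wpM2l.
  have h5 : 2 * (K%:R + 4) * (S * X) <= X ^+ 2 * S / (4 * n%:R).
    rewrite ler_pdivlMr; last by lra.
    rewrite (_ : 2 * (K%:R + 4) * (S * X) * (4 * n%:R) = 8 * n%:R * (K%:R + 4) * (S * X)); last by ring.
    by rewrite (_ : X ^+ 2 * S = X * (S * X)) ?ler_wpM2r ?mulr_ge0 ?(ltW S0) ?(ltW X0)//; ring.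
  have SX0 : 0 < S * X by rewrite mulr_gt0.
  move: h1 h3 h4 h5 hl; move: (`|nu _ _ _ _ _|) (`|y _ _ - _|) (`|y ord0 l|) (K%:R * nurad L delta).
  move=> N1 N2 Y r *; nra.
have pil : pi <= `|y ord0 l|.
  apply: le_trans yl; have : 1 <= S * X by rewrite -[leLHS]mulr1; apply: ler_pM.
  by lra.
apply: le_trans (PD2 pil) _.
rewrite -[leLHS]mulrA -[leRHS]mulrA ler_wpM2l ?d10 ?d20//.
rewrite [leRHS]mulrCA ler_wpM2l//.
have y0 : 0 < `|y ord0 l| by apply: lt_le_trans pil; exact: pi_gt0.
apply: le_trans (_ : (X^-1) ^+ M <= _).
  apply: lerXn2r; rewrite ?nnegrE ?divr_ge0 ?invr_ge0 ?(ltW (lam0 l)) ?(ltW X0)//.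
  rewrite (lamJ lJ) ler_pdivrMr// ler_pdivlMl//.
  apply: le_trans yl; rewrite mulrC; have : 0 < S * X by rewrite mulr_gt0.
  by lra.
rewrite exprVn; apply: le_trans (_ : (S ^+ (P + 12 * n))^-1 <= _).
  by rewrite lef_pV2 ?posrE ?exprn_gt0.
rewrite exprD invfM mulrCA ler_wpM2l//.
(* In this case the lattice weight is at least [(65 * S^6) ^- (2 * n)], which is what the surplus
   [S ^+ (12 * n)] in the choice of [M] pays for. *)
have wk : ((1 + 64 * S ^+ 6) ^- 2) ^+ n <= lattice_wt R p.2.
  apply: lattice_wt_ge => [|j]; first by lra.
  by apply: le_trans (ltW kT); rewrite ler_nat.
apply: le_trans (_ : 65 ^+ (2 * n) * ((1 + 64 * S ^+ 6) ^- 2) ^+ n <= _); last by rewrite ler_wpM2l ?exprn_ge0.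
rewrite exprVn -exprM ler_pdivlMr ?exprn_gt0 ?addr_gt0 ?mulr_gt0 ?exprn_gt0//.
rewrite ler_pdivrMl ?exprn_gt0// (_ : 12 * n = 6 * (2 * n))%N; last by rewrite mulnA.
rewrite (exprM S); have := exprn_ege1 6 S1.
move: (S ^+ 6) (2 * n)%N => s e s1; rewrite -exprMn.
by apply: lerXn2r; rewrite ?nnegrE; lra.
Qed.

End packet_decay.

(** * Summation over the packets that are not tangent *)

Section concentration.
Variables (R : realType) (n : nat) (S L delta X : R) (W : wave_packets R n).
Variables (K : nat) (kappa cc : R) (A : nat -> R).
Variables (C : nat -> R) (a b : R) (phi : R -> R).
Variables (lam : 'I_n -> R) (Z : 'I_n -> nat) (D : R) (Zm J : nat).
Hypothesis n0 : (0 < n)%N.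
Hypothesis LS : L = S ^+ 2.
Hypothesis XL : X = L `^ delta.
Hypothesis d01 : 0 < delta <= 1.
Hypothesis X8 : 8 * n%:R * (K%:R + 4) <= X.
Hypothesis S8 : 8 * n%:R <= S.
Hypothesis SK : K%:R <= S.
Hypothesis hW : is_wave_packets L delta W K kappa cc A.
Hypothesis kappa1 : kappa <= 1.
Hypothesis hphi : bump_function C a b phi.
Hypothesis D0 : 0 < D.
Hypothesis Dlam : forall i, 2 * D < lam i.
Hypothesis Slam : forall i, S <= lam i <= S ^+ 2.
Hypothesis ZZm : forall i, (0 < Z i <= Zm)%N.
Hypothesis ZmS : Zm%:R <= S.
Hypothesis lamJ : forall i : 'I_n, (i < J)%N -> lam i = S.
Hypothesis fJ : forall x, fsupp lam Z D x -> forall i : 'I_n, `|x ord0 i| <= 1 /\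
  ((i < J)%N -> `|x ord0 i| <= S^-1).

Local Notation f := (ftest phi lam Z D).

Let n1 : 1 <= n%:R :> R. Proof. by rewrite ler1n. Qed.
Let S1 : 1 <= S. Proof. by have h1 := n1; have h2 := S8; lra. Qed.
Let S0 : 0 < S. Proof. by have := S1; lra. Qed.
Let L1 : 1 <= L. Proof. by rewrite LS exprn_ege1// S1. Qed.
Let X80 : 8 * n%:R <= X.
Proof.
have h1 := n1; have h2 := X8; apply: le_trans h2; rewrite ler_peMr ?mulr_ge0//.
by have : 0 <= K%:R :> R by []; lra.
Qed.
Let X1 : 1 <= X. Proof. by have h1 := n1; have h2 := X80; lra. Qed.
Let X0 : 0 < X. Proof. by have := X1; lra. Qed.


Hypothesis Jn : (J <= n)%N.
Hypothesis A00 : 0 <= A 0%N.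

Let lam0 i : 0 < lam i.
Proof. by have /andP[h _] := Slam i; exact: lt_le_trans h. Qed.

(** Crude on purpose: each factor of [fvol] is only bounded below by [S ^- 2], since a power of [S]
    may be lost here. *)
Lemma ftest_L2norm_ge :
  ((a ^+ n * (b ^+ n * S ^- n))%:E <= L2norm (fun z => (f z)%:C%C))%E.
Proof.
have /andP[b0 b1] := bump_b hphi.
apply: (@L2norm_ge _ _ _ (fcore b lam Z D)).
- exact: measurable_fcore.
- by rewrite exprn_ge0// ltW// (bump_a hphi).
- by rewrite mulr_gt0 ?exprn_gt0 ?invr_gt0 ?exprn_gt0 ?S0.
- rewrite (leb_fcore hphi Z D0 Dlam) lee_fin exprMn.
  apply: ler_pM; rewrite ?exprn_ge0 ?invr_ge0 ?exprn_ge0 ?(ltW b0) ?(ltW S0)//.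
    by rewrite -exprM ler_wiXn2l ?(ltW b0)// muln2 -addnn leq_addr.
  rewrite exprVn -exprM mulnC exprM -exprVn -[X in _ ^+ X]card_ord -prodr_const.
  apply: ler_prod => i _; rewrite invr_ge0 exprn_ge0 ?(ltW S0)//=.
  have /andP[_ h] := Slam i; have l0 := lam0 i.
  apply: le_trans (_ : (lam i)^-1 <= _); first by rewrite lef_pV2 ?posrE ?exprn_gt0 ?S0.
  rewrite -[leLHS]mul1r ler_wpM2r ?invr_ge0 ?(ltW l0)//.
  have : 1 <= (Z i)%:R :> R by rewrite ler1n; have /andP[] := ZZm i.
  by lra.
move=> x hx; rewrite cabs_real ger0_norm ?(ftest_ge0 hphi)//.
exact: (ftest_ge hphi).
Qed.

Definition concentration_decay (P M : nat) : R :=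
  decay_cst n A C (2 * (2 * n + P)) * 4 ^+ n + decay_cst n A C M * 65 ^+ (2 * n).

Definition concentration_cst (N M : nat) : R :=
  K%:R * (2 * n%:R) ^+ n * 4 ^+ n *
  (A 0%N * (4 * concentration_decay (5 * n + 2 * N) M * (2 * K%:R) ^+ n) * 2 ^+ n) /
  (a ^+ n * b ^+ n).

(** Either [psi p.1 * f] vanishes, or the cap meets the support of [f], so that [|omega_i| <= 2 / S]
    for [i < J]; then non-tangency can only be due to a large [nu_l]. *)
Lemma nontangent_trig_int (P M : nat) (c : R -> R) (p : cap W * 'rV[int]_n) y :
  measurable_fun setT c -> (forall s, `|c s| <= 1) -> alternating c pi ->
  S ^+ (P + 12 * n) <= X ^+ M ->
  ~ tangent L delta (coord_poly R Jn) (X ^+ 2) p ->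
  eta W p.2 y != 0 ->
  `|trig_int c y (psi p.1 \* f)| <=
    concentration_decay P M * S ^+ n * S ^- P * lattice_wt R p.2.
Proof.
move=> mc c1 cpi XM ntan hy.
have rhs0 : 0 <= concentration_decay P M * S ^+ n * S ^- P * lattice_wt R p.2.
  rewrite !mulr_ge0 ?exprn_ge0 ?invr_ge0 ?exprn_ge0 ?(ltW S0) ?(ltW (lattice_wt_gt0 _ _))//.
  by rewrite addr_ge0// mulr_ge0 ?decay_cst_ge0 ?exprn_ge0.
have [[x px]|np] := pselect (exists x, psi p.1 x * f x != 0); last first.
  rewrite (_ : trig_int _ _ _ = 0) ?normr0//.
  rewrite /trig_int /Rintegral integral0_eq// => x _.
  have -> : (psi p.1 \* f) x = 0 by apply/eqP/negPn/negP => h; apply: np; exists x.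
  by rewrite mulr0.
move: px; rewrite mulf_eq0 negb_or => /andP[px fx].
have xs := fJ (ftest_supp hphi D0 Dlam fx).
have xb : eball (omega p.1) (kappa * caprad L) x.
  by apply: (psi_supp hW); apply: subset_closure.
have homega (i : 'I_n) : (i < J)%N -> `|omega p.1 ord0 i| <= 2 / S.
  move=> iJ; have [_ /(_ iJ) h1] := xs i.
  have h2 := le_trans (coord_le_enorm _ i) xb.
  move: h2; rewrite 2!mxE (capradE n0 LS S8) => h2.
  have h3 : kappa * S^-1 <= S^-1 by rewrite ler_piMl// invr_ge0 ltW// S0.
  rewrite -[X in `|X|](subKr (x ord0 i)); apply: le_trans (ler_normB _ _) _.
  by lra.
have [l lJ hl] : exists2 l : 'I_n, (l < J)%N & X ^+ 2 * S / (4 * n%:R) < `|nu L delta p.2 ord0 l|.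
  apply: contrapT => hn; apply: ntan.
  apply: (@tangent_coord_poly R n J Jn S L delta X W n0 LS XL X80 S8) => // i iJ.
  by rewrite leNgt; apply/negP => h; apply: hn; exists i.
exact: (nontangent_decay n0 LS XL d01 X8 S8 SK hW hphi D0 Dlam Slam ZZm ZmS lamJ fJ mc c1 cpi XM lJ hl hy).
Qed.

(** The [5 * n] powers of [S] pay for the number of caps ([n]), the factor [S ^+ n] of the decay
    ([n]), the volume of the support of [eta] ([2 * n]) and the lower bound of the norm of [f]
    ([n]). The [2 * N] become [L ^- N], and [12 * n] is the cost of the lattice weight. *)
Lemma concentrated_ftest_le (N M : nat) : S ^+ (5 * n + 2 * N + 12 * n) <= X ^+ M ->
  (\esum_(p in [set p | ~ tangent L delta (coord_poly R Jn) (X ^+ 2) p])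
      L2norm (packet (W := W) (fun z => (f z)%:C%C) p) <=
    (concentration_cst N M * L ^- N)%:E * L2norm (fun z => (f z)%:C%C))%E.
Proof.
move=> XM; set P := (5 * n + 2 * N)%N in XM *.
set d := concentration_decay P M.
have d0 : 0 <= d by rewrite addr_ge0// mulr_ge0 ?decay_cst_ge0 ?exprn_ge0.
have SP0 : 0 <= S ^- P by rewrite invr_ge0 exprn_ge0// ltW// S0.
have Sn0 : 0 <= S ^+ n by rewrite exprn_ge0// ltW// S0.
pose c := A 0%N * (4 * (d * S ^+ n * S ^- P) * (2 * (K%:R * S ^+ 2)) ^+ n) * 2 ^+ n.
have c0 : 0 <= c.
  by rewrite /c !mulr_ge0 ?exprn_ge0 ?mulr_ge0 ?exprn_ge0// ltW// S0.
apply: le_trans (@esum_lattice_le R (cap W) n _ _ c c0 _) _.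
  move=> p ntan.
  have wp := lattice_wt_gt0 R p.2.
  have Q0 : 0 <= d * S ^+ n * S ^- P * lattice_wt R p.2 by rewrite !mulr_ge0// ltW.
  apply: le_trans (packet_L2norm_le L1 hW Q0 _) _.
    move=> y hy; split.
      apply: nontangent_trig_int => //; [exact: continuous_measurable_fun (@continuous_cos R)|exact: cos_max|exact: cosDpi].
    apply: nontangent_trig_int => //; [exact: continuous_measurable_fun (@continuous_sin R)|exact: sin_max|exact: sinDpi].
  rewrite lee_fin.
  have r0 := radius_ge0 hW p.2.
  have rr : Defs.radius W p.2 <= K%:R * S ^+ 2.
    apply: le_trans (radius_le hW p.2) _.
    by rewrite ler_wpM2l// (nurad_le_sqr n0 LS d01 S8).
  have -> : c * lattice_wt R p.2 =
    A 0%N * (4 * (d * S ^+ n * S ^- P * lattice_wt R p.2) * (2 * (K%:R * S ^+ 2)) ^+ n) * 2 ^+ n.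
    by rewrite /c; ring.
  rewrite ler_wpM2r ?exprn_ge0// ler_wpM2l// ler_wpM2l ?(mulr_ge0 _ Q0)//.
  by apply: lerXn2r; rewrite ?nnegrE ?mulr_ge0 ?exprn_ge0 ?(ltW S0)// ler_wpM2l.
have cst0 : 0 <= concentration_cst N M * L ^- N.
  have /andP[b0 _] := bump_b hphi.
  rewrite /concentration_cst -/P -/d.
  rewrite !mulr_ge0 ?invr_ge0 ?mulr_ge0 ?exprn_ge0 ?mulr_ge0 ?(ltW b0) ?(ltW (bump_a hphi)) ?exprn_ge0//.
  exact: le_trans L1.
apply: le_trans (_ : ((concentration_cst N M * L ^- N)%:E * (a ^+ n * (b ^+ n * S ^- n))%:E <= _)%E); last first.
  by apply: lee_wpmul2l; rewrite ?lee_fin//; exact: ftest_L2norm_ge.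
rewrite -EFinM lee_fin.
apply: le_trans (_ : K%:R * (2 * n%:R / caprad L) ^+ n * 4 ^+ n * c <= _).
  rewrite ler_wpM2r// ler_wpM2r ?exprn_ge0//; exact: (card_cap_le L1 hW n0).
have /andP[b0 _] := bump_b hphi; have a0 := bump_a hphi.
rewrite le_eqVlt; apply/orP; left; apply/eqP.
rewrite /c /concentration_cst -/P -/d (capradE n0 LS S8) invrK LS.
have -> : S ^- P = (S ^+ n) ^- 5 * S ^- (2 * N).
  by rewrite /P exprD (mulnC 5%N) exprM invfM.
have e1 : (2 * n%:R * S) ^+ n = (2 * n%:R) ^+ n * S ^+ n by rewrite exprMn.
have e2 : (2 * (K%:R * S ^+ 2)) ^+ n = (2 * K%:R) ^+ n * (S ^+ n) ^+ 2.
  by rewrite mulrA exprMn exprAC.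
have e3 : (S ^+ 2) ^+ N = S ^+ (2 * N) by rewrite exprM.
rewrite e1 e2 e3.
have s0 : S ^+ n != 0 by rewrite expf_neq0// gt_eqF// S0.
have q0 : S ^+ (2 * N) != 0 by rewrite expf_neq0// gt_eqF// S0.
have an0 : a ^+ n != 0 by rewrite expf_neq0// gt_eqF.
have bn0 : b ^+ n != 0 by rewrite expf_neq0// gt_eqF.
move: s0 q0 an0 bn0; move: (S ^+ n) (S ^+ (2 * N)) (a ^+ n) (b ^+ n) => s q an bn s0 q0 an0 bn0.
by field; rewrite s0 q0 an0 bn0.
Qed.

End concentration.

(** * The lower bound *)

Section cosine.
Variable R : realType.

(** By periodicity and because the cosine is 1-Lipschitz. *)
Lemma cos_ge_half (e : R) (m : nat) : `|e| <= 2^-1 -> 2^-1 <= cos (2 * pi * m%:R + e).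
Proof.
move=> he; have -> : cos (2 * pi * m%:R + e) = cos e.
  elim: m => [|m IH]; first by rewrite mulr0 add0r.
  rewrite -[m.+1%:R]natr1 mulrDr mulr1 -addrA (addrC _ e) addrA.
  by rewrite -IH -[RHS]cosD2pi; congr (cos (_ + _)); rewrite mulr_natl.
have := @derivative_lipschitz R cos (fun x => - sin x) 1 (fun s => is_derive_cos s) _ 0 e.
rewrite add0r cos0 mulr1 => /(_ _)/le_trans/(_ he).
move=> h; have := h (fun s => _); rewrite ler_norml => /(_ _)/andP[].
  by move=> s; rewrite normrN sin_max.
by lra.
Qed.

End cosine.

Section real_axis.
Variable R : realType.

Lemma leb_pbox_le n (A : 'I_n -> set R) (d : 'I_n -> R) :
  (forall i, measurable (A i : set (measurableTypeR R))) ->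
  (forall i, (lebesgue_measure (A i) <= (d i)%:E)%E) ->
  (leb R n (pbox A) <= (\prod_i d i)%:E)%E.
Proof.
move=> mA Ad.
have fin i : lebesgue_measure (A i) = (fine (lebesgue_measure (A i)))%:E.
  by rewrite fineK// ge0_fin_numE// (le_lt_trans (Ad i))// ltry.
rewrite (leb_pbox mA fin) lee_fin; apply: ler_prod => i _.
by rewrite fine_ge0//= -lee_fin -fin.
Qed.

Lemma prod_if_lt n g (x y : R) : (g <= n)%N ->
  \prod_(i < n) (if (i < g)%N then x else y) = x ^+ g * y ^+ (n - g).
Proof.
elim: n => [|n IH] gn.
  by move: gn; rewrite leqn0 => /eqP ->; rewrite big_ord0 !expr0 mulr1.
rewrite big_ord_recr /=; move: gn; rewrite leq_eqVlt => /predU1P[->|gn].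
  rewrite ltnSn subnn expr0 mulr1 exprSr; congr (_ * _).
  rewrite (eq_bigr (fun=> x)); first by rewrite prodr_const card_ord.
  by move=> i _; rewrite ifT// ltnW// ltnS ltn_ord.
by rewrite IH// ltnNge -ltnS gn /= -mulrA -exprSr subSn.
Qed.

End real_axis.

(** * The comb example: parameters and phase *)

Section example.
Variables (R : realType) (n g N : nat).
Hypothesis gn : (g < n)%N.
Hypothesis N0 : (0 < N)%N.

(* [ex_S] is the square root of the scale, and [g] stands for [n + 1 - k]. *)
Definition ex_S : R := N%:R ^+ (n - g + 2).
(** The factor [2 * n] keeps the tooth centres [a / D], [a < N], below [1 / (2 * n)], so that the
    support fits in the unit ball. *)
Definition ex_D : R := 2 * n%:R * N%:R.
Definition ex_lam (i : 'I_n) : R := if (i < g)%N then ex_S else ex_S ^+ 2.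
Definition ex_Z (i : 'I_n) : nat := if (i < g)%N then 1%N else N.
(** The phase error is at most [6 * c] per coordinate, hence at most [1/2] in total. *)
Definition ex_c : R := (12 * n%:R)^-1.

Local Notation S := ex_S.
Local Notation D := ex_D.
Local Notation c := ex_c.
Local Notation lam := ex_lam.
Local Notation Z := ex_Z.

(** Multiplied by a frequency [a / D], respectively by its square for the last coordinate, the
    spacing gives a multiple of [2 * pi]. For [i < g] there is a single tooth and the value 1 is a
    placeholder. *)
Definition ex_spacing (i : nat) : R :=
  if (i < g)%N then 1 else if (i < n)%N then 2 * pi * D else 2 * pi * D ^+ 2.
Definition ex_width (i : nat) : R := if (i < g)%N then c * S else c.
Definition ex_count (i : nat) : nat :=
  if (i < g)%N then 1%N else Num.truncn (c * S ^+ 2 / ex_spacing i).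

Definition ex_set : set 'rV[R]_(n + 1) :=
  pbox (fun i : 'I_(n + 1) => comb_set 0 (ex_spacing i) (ex_width i) (ex_count i)).

Lemma ex_n1 : 1 <= n%:R :> R.
Proof. by rewrite ler1n (leq_ltn_trans _ gn). Qed.

Lemma ex_N1 : 1 <= N%:R :> R.
Proof. by rewrite ler1n. Qed.

Lemma ex_S1 : 1 <= S.
Proof. by rewrite exprn_ege1// ex_N1. Qed.

Lemma ex_D2 : 2 <= D.
Proof.
have := ex_n1; have := ex_N1; rewrite /ex_D; move: (N%:R : R) (n%:R : R) => x y *; nra.
Qed.

Lemma ex_c0 : 0 < c.
Proof. by rewrite invr_gt0 mulr_gt0//; have := ex_n1; lra. Qed.

Lemma ex_c_le : c <= 12^-1.
Proof.
have := ex_n1 => h; rewrite /ex_c lef_pV2 ?posrE ?mulr_gt0//; lra.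
Qed.

Lemma ex_nc : n%:R * c = 12^-1.
Proof.
have h := ex_n1; rewrite /ex_c invfM mulrCA divff ?mulr1// gt_eqF//; lra.
Qed.

Lemma measurable_ex_set : measurable ex_set.
Proof. by apply: measurable_pbox => i; exact: measurable_comb_set. Qed.

Lemma ex_spacing_gt (i : nat) : (g <= i)%N -> 4 <= ex_spacing i.
Proof.
move=> gi; rewrite /ex_spacing ltnNge gi /=.
have p2 := pi_ge2 R; have d2 := ex_D2.
by case: ifP => _; nra.
Qed.

(* The last tooth of the comb still lies in the interval of radius [c S^2]. *)
Lemma ex_set_coord x (i : 'I_(n + 1)) : ex_set x -> exists2 z : nat,
  (if (i < g)%N then z = 0%N else True) &
  `|x ord0 i - ex_spacing i * z%:R| <= ex_width i /\
  `|x ord0 i| <= if (i < g)%N then c * S else c * S ^+ 2.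
Proof.
move=> /(_ i) [z zZ]; rewrite add0r => h; exists z.
  by move: zZ; rewrite /ex_count; case: ifP => // _; case: z h.
split => //; move: zZ h; rewrite /ex_count /ex_width; case: (ltnP i g) => ig zZ h.
  by move: zZ h; case: z => //= _; rewrite mulr0 subr0.
have s4 := ex_spacing_gt ig; have c0 := ex_c0; have c12 := ex_c_le.
have : ex_spacing i * (z%:R + 1) <= c * S ^+ 2.
  move: zZ; rewrite truncn_gt_nat -natr1 ler_pdivlMr 1?mulrC//; lra.
have : 0 <= ex_spacing i * z%:R by rewrite mulr_ge0//; lra.
rewrite mulrDr mulr1; move: h; move: (ex_spacing i) s4 (ex_spacing i * z%:R) (c * S ^+ 2) (x ord0 i : R).
by move=> sp sp4 sz cS y; rewrite !ler_norml => /andP[? ?] ? ?; apply/andP; split; lra.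
Qed.

Lemma ex_fsupp_coord xi (i : 'I_n) : fsupp lam Z D xi -> exists2 a : nat,
  (if (i < g)%N then a = 0%N else (a < N)%N) &
  `|xi ord0 i - a%:R / D| <= if (i < g)%N then S^-1 else S ^- 2.
Proof.
move=> /(_ i) [a aZ]; rewrite add0r mulrC => h; exists a.
  by move: aZ; rewrite /ex_Z; case: ifP => // _; case: a h.
by move: h; rewrite /ex_lam; case: ifP.
Qed.

Lemma ex_ratio (a : nat) : (a < N)%N -> 0 <= a%:R / D <= (2 * n%:R)^-1.
Proof.
move=> aN; have d2 := ex_D2; have n1 := ex_n1; have N1 := ex_N1.
rewrite divr_ge0//; last by lra.
rewrite ler_pdivrMr; last by lra.
rewrite /ex_D mulrA mulVf ?mul1r ?ler_nat ?(ltnW aN)// gt_eqF//; lra.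
Qed.

Lemma ex_phase_near x xi (i : 'I_n) : ex_set x -> fsupp lam Z D xi ->
  exists m : nat, `|x ord0 (lshift 1 i) * xi ord0 i + tpart x * xi ord0 i ^+ 2 - 2 * pi * m%:R| <= 6 * c.
Proof.
move=> hx hxi.
have c0 := ex_c0; have n1 := ex_n1; have S1 := ex_S1; have d2 := ex_D2.
have [z zg [hz1 hz2]] := ex_set_coord (lshift 1 i) hx.
have [z' _ [ht1 ht2]] := ex_set_coord (rshift n ord0) hx.
have [a ag ha] := ex_fsupp_coord i hxi.
have tE : tpart x = x ord0 (rshift n ord0) by rewrite /tpart mxE.
move: ht1 ht2; rewrite -tE /ex_spacing /ex_width /= addn0 ltnn (ltnNge n g) (ltnW gn) /= => ht1 ht2.
move: zg hz1 hz2 ag ha; rewrite /ex_spacing /ex_width /=.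
have SS : S^-1 * S = 1 by rewrite mulVf// gt_eqF//; lra.
have S0 : 0 < S^-1 by rewrite invr_gt0; lra.
case: ltnP => ig.
  move=> -> _ hy -> hxi'; exists 0%N; rewrite mulr0 subr0.
  move: hxi'; rewrite mul0r subr0 => hxi'.
  apply: le_trans (ler_normD _ _) _.
  rewrite [`|x ord0 _ * _|]normrM [`|tpart x * _|]normrM normrX.
  apply: le_trans (_ : c * S * S^-1 + c * S ^+ 2 * (S^-1) ^+ 2 <= _).
    apply: lerD; apply: ler_pM => //; rewrite ?exprn_ge0//.
    by apply: lerXn2r; rewrite ?nnegrE// ltW.
  by rewrite -[X in X + _]mulrA -[X in _ + X]mulrA -exprMn (mulrC S) SS expr1n; lra.
rewrite ltn_ord => _ hy1 hy2 aN ha; exists (z * a + z' * a ^ 2)%N.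
have /andP[r0 r1] := ex_ratio aN.
have r2 : a%:R / D <= 2^-1.
  by apply: le_trans r1 _; rewrite lef_pV2 ?posrE//; lra.
set y : R := x ord0 (lshift 1 i) in hy1 hy2 *; set t := tpart x in ht1 ht2 *.
set s : R := xi ord0 i in ha *; set rho := a%:R / D in ha r0 r2.
have aE : a%:R = D * rho by rewrite /rho mulrC divfK// gt_eqF//; lra.
(* Deviations from the nearby teeth: the main terms [2 * pi * z * a] and [2 * pi * z' * a^2] cancel,
   leaving five errors of size at most [c], because [|y|, |t| <= c * S^2], [|eta| <= S ^- 2] and
   [rho <= 1/2]. *)
pose u := y - 2 * pi * D * z%:R; pose u' := t - 2 * pi * D ^+ 2 * z'%:R.
pose eta := s - rho.
have -> : y * s + t * s ^+ 2 - 2 * pi * (z * a + z' * a ^ 2)%:R =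
  u * rho + y * eta + u' * rho ^+ 2 + 2 * rho * (t * eta) + t * eta ^+ 2.
  by rewrite natrD !natrM aE /u /u' /eta; ring.
have S2 : S ^+ 2 * S ^- 2 = 1 by rewrite divff// expf_neq0// gt_eqF//; lra.
have S20 : 0 < S ^- 2 by rewrite invr_gt0 exprn_gt0//; lra.
have b1 : `|u * rho| <= c.
  rewrite normrM (ger0_norm r0) -[leRHS]mulr1; apply: ler_pM => //; lra.
have b2 : `|y * eta| <= c.
  by rewrite normrM -[leRHS]mulr1 -S2 mulrA; apply: ler_pM.
have b3 : `|u' * rho ^+ 2| <= c.
  rewrite normrM (ger0_norm (_ : 0 <= rho ^+ 2)) ?exprn_ge0// -[leRHS]mulr1; apply: ler_pM => //.
    by rewrite exprn_ge0.
  by rewrite exprn_ile1//; lra.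
have b4 : `|t * eta| <= c.
  by rewrite normrM -[leRHS]mulr1 -S2 mulrA; apply: ler_pM.
have b5 : `|t * eta ^+ 2| <= c.
  rewrite expr2 mulrA normrM -[leRHS]mulr1; apply: ler_pM => //.
  have S2g : 0 < S ^+ 2 by apply: exprn_gt0; lra.
  by apply: le_trans ha _; rewrite invf_le1//; exact: exprn_ege1.
have b4' : `|2 * rho * (t * eta)| <= c.
  have r20 : 0 <= 2 * rho by lra.
  rewrite normrM (ger0_norm r20); apply: le_trans b4.
  by rewrite ler_piMl//; lra.
move: b1 b2 b3 b4' b5.
move: (u * rho) (y * eta) (u' * rho ^+ 2) (2 * rho * (t * eta)) (t * eta ^+ 2) => e1 e2 e3 e4 e5.
by rewrite !ler_norml => /andP[? ?] /andP[? ?] /andP[? ?] /andP[? ?] /andP[? ?]; apply/andP; split; lra.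
Qed.

Lemma ex_cos_phase x xi : ex_set x -> fsupp lam Z D xi ->
  2^-1 <= cos (dot (hpart x) xi + tpart x * enorm xi ^+ 2).
Proof.
move=> hx hxi; have c0 := ex_c0.
have /choice[m hm] := fun i => ex_phase_near i hx hxi.
have -> : dot (hpart x) xi + tpart x * enorm xi ^+ 2 =
    2 * pi * (\sum_i m i)%N%:R +
    \sum_i (x ord0 (lshift 1 i) * xi ord0 i + tpart x * xi ord0 i ^+ 2 - 2 * pi * (m i)%:R).
  rewrite sqr_enorm /dot mulr_sumr -big_split /= natr_sum mulr_sumr -big_split /=.
  apply: eq_bigr => i _; rewrite /hpart mxE; ring.
apply: cos_ge_half; apply: le_trans (ler_norm_sum _ _ _) _.
apply: le_trans (ler_sum _ (fun i _ => hm i)) _.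
rewrite sumr_const card_ord (_ : 6 * c *+ n = 6 * (n%:R * c)).
  by rewrite ex_nc; lra.
by rewrite -[LHS]mulr_natl; ring.
Qed.

End example.

(** * Norms, dimension and mass in the example *)

Section example_estimates.
Variables (R : realType) (n g N : nat).
Hypothesis gn : (g < n)%N.
Hypothesis N8 : (8 * n <= N)%N.
Variables (C : nat -> R) (a b : R) (phi : R -> R).
Hypothesis hphi : bump_function C a b phi.

Local Notation S := (ex_S R n g N).
Local Notation D := (ex_D R n N).
Local Notation c := (ex_c R n).
Local Notation lam := (@ex_lam R n g N).
Local Notation Z := (@ex_Z n g N).
Local Notation f := (ftest phi lam Z D).
Local Notation X := (@ex_set R n g N).

Let n0 : (0 < n)%N. Proof. exact: leq_ltn_trans gn. Qed.
Let N0 : (0 < N)%N. Proof. by apply: leq_trans N8; rewrite muln_gt0. Qed.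
Let n1 : 1 <= n%:R :> R. Proof. by rewrite ler1n. Qed.
Let N8' : 8 * n%:R <= N%:R :> R. Proof. by rewrite -natrM ler_nat. Qed.
Let N1 : 1 <= N%:R :> R. Proof. exact: ex_N1 N0. Qed.
Let S1 : 1 <= S. Proof. exact: ex_S1 N0. Qed.
Let S0 : 0 < S. Proof. exact: lt_le_trans ltr01 S1. Qed.
Let D2 : 2 <= D. Proof. exact: ex_D2 gn N0. Qed.
Let D0 : 0 < D. Proof. by apply: lt_le_trans D2. Qed.
Let c0 : 0 < c. Proof. by rewrite /ex_c invr_gt0 mulr_gt0// ltr0n. Qed.

Lemma ex_S_ge : N%:R ^+ 3 <= S.
Proof. by apply: ler_weXn2l => //; rewrite addn2 !ltnS subn_gt0. Qed.

Lemma ex_N_le_S : N%:R <= S.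
Proof. by apply: le_trans ex_S_ge; rewrite -[leLHS]expr1 ler_weXn2l. Qed.

Lemma ex_S_le_sqr : S <= S ^+ 2.
Proof. by rewrite -[leLHS]expr1 ler_weXn2l. Qed.

Lemma ex_S8 : 8 * n%:R <= S.
Proof. exact: le_trans ex_N_le_S. Qed.

Lemma ex_Slam i : S <= lam i <= S ^+ 2.
Proof.
have h : S <= S ^+ 2 by rewrite -[leLHS]expr1 ler_weXn2l.
by rewrite /ex_lam; case: ifP => _; rewrite ?lexx h.
Qed.

Lemma ex_Dlam i : 2 * D < lam i.
Proof.
have /andP[h _] := ex_Slam i; apply: lt_le_trans h; apply: lt_le_trans ex_S_ge.
move: n1 N8' N1; rewrite /ex_D !exprS expr0 mulr1; move: (n%:R : R) (N%:R : R) => x y x1 h y1.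
have xy : 8 * x * y <= y * y by rewrite ler_wpM2r//; lra.
have : y * y <= y * (y * y) by rewrite ler_peMl//; nra.
nra.
Qed.

Lemma ex_Z_le i : (0 < Z i <= N)%N.
Proof. by rewrite /ex_Z; case: ifP => _; rewrite ?N0 ?leqnn. Qed.

Lemma ex_fsupp_small xi : fsupp lam Z D xi -> forall i : 'I_n,
  `|xi ord0 i| <= n%:R^-1 /\ ((i < g)%N -> `|xi ord0 i| <= S^-1).
Proof.
move=> hxi i; have [z zg hz] := ex_fsupp_coord i hxi.
have S8 := ex_S8; have S1' := S1; have n1' := n1; have S0' := S0.
have Si : S^-1 <= (2 * n%:R)^-1 by rewrite lef_pV2 ?posrE//; lra.
have n2 : (2 * n%:R)^-1 + (2 * n%:R)^-1 = n%:R^-1 :> R by field; rewrite gt_eqF//; lra.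
have n2' : 0 < (2 * n%:R)^-1 :> R by rewrite invr_gt0; lra.
case: ltnP zg hz => ig zg hz.
  by move: hz; rewrite zg mul0r subr0 => hz; split => //; apply: le_trans hz _; lra.
split => //; have /andP[r0 r1] := @ex_ratio R n g N gn N0 z zg.
have S2 : S ^- 2 <= S^-1.
  by rewrite lef_pV2 ?posrE ?S0 ?(exprn_gt0 2 S0)//; exact: ex_S_le_sqr.
rewrite (_ : xi ord0 i = z%:R / D + (xi ord0 i - z%:R / D)); last by rewrite addrC subrK.
by apply: le_trans (ler_normD _ _) _; rewrite (ger0_norm r0); lra.
Qed.

Lemma ex_fsupp_ball : fsupp lam Z D `<=` eball 0 1.
Proof.
move=> xi h; rewrite /eball /= subr0; apply: le_trans (enorm_le_sum _) _.
apply: le_trans (ler_sum _ (fun i _ => (ex_fsupp_small h i).1)) _.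
by rewrite sumr_const card_ord -[X in X <= _]mulr_natl divff// pnatr_eq0 -lt0n.
Qed.

Lemma ex_fvolE : fvol lam Z = (2 / S) ^+ g * (2 * N%:R / S ^+ 2) ^+ (n - g).
Proof.
rewrite -(prod_if_lt _ _ (ltnW gn)) /fvol; apply: eq_bigr => i _.
by rewrite /ex_Z /ex_lam; case: ifP => _; rewrite ?mulr1.
Qed.

Lemma ex_fvol_gt0 : 0 < fvol lam Z.
Proof. by apply: fvol_gt0 D0 ex_Dlam _ => i; have /andP[] := ex_Z_le i. Qed.

Let fc x : cabs (f x)%:C%C = f x.
Proof. by rewrite cabs_real ger0_norm// (ftest_ge0 hphi). Qed.

Let f_supp x : ~ fsupp lam Z D x -> f x = 0.
Proof. by move=> h; apply/eqP/negPn/negP => /(ftest_supp hphi D0 ex_Dlam). Qed.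

Let C0 : 0 <= C 0%N.
Proof. exact: le_trans (bump_le hphi 0). Qed.

Lemma ex_L2norm_le : (L2norm (fun z => (f z)%:C%C) <=
  (C 0%N ^+ n * Num.sqrt (fvol lam Z))%:E)%E.
Proof.
apply: (@L2norm_le _ _ _ (fsupp lam Z D)).
- exact: measurable_fsupp.
- exact: exprn_ge0.
- exact: sqrtr_ge0.
- by rewrite sqr_sqrtr ?(ltW ex_fvol_gt0)// (leb_fsupp Z D0 ex_Dlam).
- by move=> x; rewrite fc; exact: (ftest_le hphi Z D0 ex_Dlam).
- by move=> x h; rewrite f_supp.
Qed.

Lemma ex_L2_ball : L2_ball (fun z => (f z)%:C%C).
Proof.
split.
- split => /=; first by apply: measurable_ftest; exact: hphi.
  exact: measurable_cst.
- by apply: le_lt_trans ex_L2norm_le _; rewrite ltry.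
- by apply: nearW => x hx; rewrite f_supp// => /ex_fsupp_ball.
Qed.

Lemma ex_extension_ge x : X x ->
  2^-1 * a ^+ n * (b ^+ n * fvol lam Z) <= cabs (extension (fun z => (f z)%:C%C) x).
Proof.
move=> hx; apply: le_trans (cabs_ge_Re _); apply: le_trans (ler_norm _).
rewrite /extension /cintegral /= Rintegral_mkcond.
set G := _ \_ _.
have a0 := bump_a hphi.
have GE xi : fsupp lam Z D xi -> 2^-1 * f xi <= G xi <= f xi.
  move=> h; have f0 := ftest_ge0 hphi lam Z D xi.
  rewrite /G patchE mem_set; last exact: ex_fsupp_ball.
  have hc := ex_cos_phase gn N0 hx h.
  rewrite /= mulr0 subr0 ler_wpM2r//= ler_piMl// cos_le1//.
have G0 xi : ~ fsupp lam Z D xi -> G xi = 0.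
  by move=> h; rewrite /G patchE; case: ifP => // _; rewrite /= f_supp// !mulr0 subr0.
have Gge xi : 0 <= G xi.
  have [/GE /andP[h _]|/G0 -> //] := pselect (fsupp lam Z D xi).
  by apply: le_trans h; rewrite mulr_ge0// (ftest_ge0 hphi).
have Gle xi : G xi <= C 0%N ^+ n.
  have [/GE /andP[_ h]|/G0 ->] := pselect (fsupp lam Z D xi); last exact: exprn_ge0.
  by apply: le_trans h _; exact: (ftest_le hphi Z D0 ex_Dlam).
(* The upper bound only ensures finiteness: [fine] would send [+oo] to 0. *)
have up : (\int[leb R n]_xi (G xi)%:E <= (C 0%N ^+ n)%:E * (fvol lam Z)%:E)%E.
  rewrite -(leb_fsupp Z D0 ex_Dlam).
  apply: integral_le_cst => //.
  - exact: measurable_fsupp.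
  - exact: exprn_ge0.
  - by move=> xi /G0 ->.
have lo : ((2^-1 * a ^+ n)%:E * (b ^+ n * fvol lam Z)%:E <= \int[leb R n]_xi (G xi)%:E)%E.
  rewrite -(leb_fcore hphi Z D0 ex_Dlam).
  have -> : ((2^-1 * a ^+ n)%:E * leb R n (fcore b lam Z D) =
    \int[leb R n]_x ((2^-1 * a ^+ n)%:E * (\1_(fcore b lam Z D) x)%:E))%E.
    rewrite ge0_integralZl_EFin ?mulr_ge0 ?exprn_ge0 ?(ltW a0)//; last first.
      by apply/measurable_EFinP; exact: measurable_indic (measurable_fcore _ _ _ _).
    by rewrite integral_indic ?setIT//; exact: measurable_fcore.
  apply: ge0_le_integral_nm => xi.
    by rewrite -EFinM lee_fin !mulr_ge0 ?exprn_ge0 ?(ltW a0).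
  rewrite -EFinM lee_fin indicE; case: (boolP (xi \in _)) => [|_]; last by rewrite mulr0.
  rewrite inE mulr1 => hxi.
  have s : fsupp lam Z D xi.
    apply: (ftest_supp hphi D0 ex_Dlam); rewrite gt_eqF//.
    by apply: lt_le_trans (ftest_ge hphi D0 ex_Dlam hxi); exact: exprn_gt0.
  have /andP[h _] := GE xi s; apply: le_trans h.
  by rewrite ler_wpM2l// (ftest_ge hphi D0 ex_Dlam).
move: lo up; rewrite -!EFinM /Rintegral.
case: (\int[leb R n]_xi (G xi)%:E)%E => [r||]//=; by rewrite !lee_fin.
Qed.

Lemma ex_set_ball : X `<=` eball 0 (S ^+ 2).
Proof.
move=> x hx; rewrite /eball /= subr0; apply: le_trans (enorm_le_sum _) _.
have S2 : S <= S ^+ 2 by rewrite -[leLHS]expr1 ler_weXn2l.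
apply: le_trans (_ : \sum_(i < n + 1) c * S ^+ 2 <= _).
  apply: ler_sum => i _; have [z _ [_]] := ex_set_coord gn N0 i hx.
  by case: ifP => // _ /le_trans; apply; rewrite ler_wpM2l// ltW.
rewrite sumr_const card_ord -[leLHS]mulr_natl mulrA ler_piMl ?exprn_ge0 ?(ltW S0)//.
rewrite natrD mulrDl mul1r (@ex_nc R n g gn); have := @ex_c_le R n g gn; lra.
Qed.

Definition ex_weight_fun : 'rV[R]_(n + 1) -> R := \1_X.

Lemma measurable_ex_weight : measurable_fun setT ex_weight_fun.
Proof. by apply: measurable_indic; exact: measurable_ex_set. Qed.

Lemma ex_weight_ge0 x : 0 <= ex_weight_fun x.
Proof. by rewrite /ex_weight_fun indicE. Qed.

Lemma ex_weight_le1 x : ex_weight_fun x <= 1.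
Proof. by rewrite /ex_weight_fun indicE lern1 leq_b1. Qed.

Definition ex_weight : weight R (n + 1) :=
  Weight measurable_ex_weight ex_weight_ge0 ex_weight_le1.

Lemma wleb_ex_set : wleb ex_weight X = leb R (n + 1) X.
Proof.
have mX := @measurable_ex_set R n g N.
by rewrite /wleb /= integral_indic// setIid.
Qed.

(** In an interval of radius [r] the coordinate sets have measure at most [2 * r], [2 * (r / D + 1)]
    and, for the last, [2 * (r / D^2 + 1)]. If [r <= D^2], the last is at most 4 and the others at
    most [4 * r]; otherwise the product gains [r / D^(n-g+2)], at most 1 because
    [r <= S <= D^(n-g+2)]. *)
Lemma ex_dimensional : dimensional ex_weight n%:R S (4 ^+ n.+1).
Proof.
move=> x r r1 rS; have mX := @measurable_ex_set R n g N.
have r0 : 0 < r by apply: lt_le_trans r1.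
rewrite /= integral_indic//; last exact: measurable_eball.
rewrite powR_mulrn ?(ltW r0)//.
pose I i : set R := comb_set 0 (ex_spacing R n g N i) (ex_width R n g N i) (ex_count R n g N i).
have mI (i : nat) (y : R) : measurable (I i `&` `[y - r, y + r]%classic : set (measurableTypeR R)).
  by apply: measurableI; [exact: measurable_comb_set|exact: measurable_itv].
pose d (i : nat) : R := if (i < g)%N then 2 * r else if (i < n)%N then 2 * (r / D + 1) else 2 * (r / D ^+ 2 + 1).
have Id (i : nat) (y : R) : (lebesgue_measure (I i `&` `[(y - r)%R, (y + r)%R]%classic) <= (d i)%:E)%E.
  have [ig|ig] := ltnP i g.
    rewrite /d ig; apply: (@le_trans _ _ (lebesgue_measure `[y - r, y + r]%classic)).
      by apply: le_measure; rewrite ?inE//=; exact: measurable_itv.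
    by rewrite lebesgue_measure_centred// ltW.
  have s4 := @ex_spacing_gt R n g N gn N0 _ ig; have s0 : 0 < ex_spacing R n g N i by apply: lt_le_trans s4.
  rewrite /I /ex_width ltnNge ig /=.
  apply: le_trans (comb_set_itv_measure_le _ _ _ s0 (ltW c0) (ltW r0)) _.
  rewrite lee_fin; have c12 := @ex_c_le R n g gn; have c0' := c0; have pi2 := pi_ge2 R.
  have ratio (s d' : R) : 0 < d' -> 2 * pi * d' <= s -> 2 * c * (2 * (r + c) / s + 1) <= 2 * (r / d' + 1).
    move=> d0 ds; have sp : 0 < s by apply: lt_le_trans ds; rewrite !mulr_gt0 ?pi_gt0.
    have h : 2 * (r + c) / s <= r / d'.
      rewrite ler_pdivrMr// mulrAC ler_pdivlMr//.
      apply: le_trans (_ : r * (2 * pi * d') <= _); last by rewrite ler_wpM2l// ltW.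
      have : 2 * (r + c) <= r * (2 * pi) by nra.
      move=> h; rewrite (_ : r * (2 * pi * d') = r * (2 * pi) * d'); last by ring.
      by rewrite ler_wpM2r// ltW.
    have h0 : 0 <= 2 * (r + c) / s by rewrite divr_ge0 ?(ltW sp)//; lra.
    nra.
  rewrite /d /ex_spacing ltnNge ig /=.
  by case: ifP => _; apply: ratio; rewrite ?exprn_gt0.
apply: (@le_trans _ _ (leb R (n + 1) (pbox (fun i : 'I_(n + 1) => I i `&` `[x ord0 i - r, x ord0 i + r]%classic)))).
  apply: le_measure; rewrite ?inE.
  - by apply: measurableI => //; exact: measurable_eball.
  - by apply: measurable_pbox => i; exact: mI.
  - move=> y [/= Xy By] i; split; first exact: Xy.
    exact: (eball_sub_box By).
apply: le_trans (leb_pbox_le (d := fun i => d i) _ _) _.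
- by move=> i; exact: mI.
- by move=> i; exact: Id.
rewrite lee_fin big_split_ord /= big_ord1 /= addn0.
rewrite (eq_bigr (fun i : 'I_n => if (i < g)%N then 2 * r else 2 * (r / D + 1))); last first.
  by move=> i _; rewrite /d ltn_ord.
rewrite (prod_if_lt _ _ (ltnW gn)) /d ltnn ltnNge (ltnW gn) /=.
have D1 : 1 <= D by apply: le_trans D2; lra.
have D0' := D0.
have ng : n = (g + (n - g))%N by rewrite subnKC// ltnW.
have [rD|rD] := leP r (D ^+ 2).
  have h1 : 2 * (r / D + 1) <= 4 * r.
    have : r / D <= r by rewrite ler_pdivrMr// ler_peMr// ltW.
    by lra.
  have h2 : 2 * (r / D ^+ 2 + 1) <= 4.
    have : r / D ^+ 2 <= 1 by rewrite ler_pdivrMr ?exprn_gt0// mul1r.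
    by lra.
  have rD0 : 0 <= r / D by rewrite divr_ge0 ?ltW.
  have rD20 : 0 <= r / D ^+ 2 by rewrite divr_ge0 ?exprn_ge0 ?ltW.
  rewrite [leRHS](_ : _ = (4 * r) ^+ g * (4 * r) ^+ (n - g) * 4); last first.
    by rewrite -exprD -ng exprMn exprSr; ring.
  apply: ler_pM => //; first by rewrite mulr_ge0// exprn_ge0//; lra.
    by lra.
  apply: ler_pM; rewrite ?exprn_ge0//; try lra.
    by apply: lerXn2r; rewrite ?nnegrE; lra.
  by apply: lerXn2r; rewrite ?nnegrE; lra.
have D20 : 0 < D ^+ 2 by rewrite exprn_gt0.
have h1 : 2 * (r / D + 1) <= 4 * (r / D).
  have : 1 <= r / D by rewrite ler_pdivlMr// mul1r (le_trans _ (ltW rD))// -[leLHS]expr1 ler_weXn2l.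
  by lra.
have h2 : 2 * (r / D ^+ 2 + 1) <= 4 * (r / D ^+ 2).
  have : 1 <= r / D ^+ 2 by rewrite ler_pdivlMr// mul1r ltW.
  by lra.
have rD0 : 0 <= r / D by rewrite divr_ge0 ?ltW.
have rD20 : 0 <= r / D ^+ 2 by rewrite divr_ge0 ?ltW.
apply: le_trans (_ : (4 * r) ^+ g * (4 * (r / D)) ^+ (n - g) * (4 * (r / D ^+ 2)) <= _).
  apply: ler_pM => //; first by rewrite mulr_ge0// exprn_ge0//; lra.
    by lra.
  apply: ler_pM; rewrite ?exprn_ge0//; try lra.
    by apply: lerXn2r; rewrite ?nnegrE; lra.
  by apply: lerXn2r; rewrite ?nnegrE; lra.
rewrite [leLHS](_ : _ = 4 ^+ n.+1 * r ^+ n * (r / D ^+ (n - g + 2))); last first.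
  have e1 : 4 ^+ n.+1 = 4 ^+ g * 4 ^+ (n - g) * 4 :> R by rewrite exprSr {1}ng exprD.
  have e2 : r ^+ n = r ^+ g * r ^+ (n - g) by rewrite {1}ng exprD.
  rewrite e1 e2 [(4 * r) ^+ g]exprMn [(4 * (r / D)) ^+ _]exprMn [(r / D) ^+ _]expr_div_n exprD.
  have Dm : D ^+ (n - g) != 0 by rewrite expf_neq0// gt_eqF.
  have Dn : D != 0 by rewrite gt_eqF.
  move: Dm Dn; move: (4 ^+ g) (4 ^+ (n - g)) (r ^+ g) (r ^+ (n - g)) (D ^+ (n - g)) D => x1 x2 x3 x4 x5 x6 h5 h6.
  by field; rewrite h5 h6.
rewrite ler_piMr ?mulr_ge0 ?exprn_ge0 ?(ltW r0)//.
rewrite ler_pdivrMr ?exprn_gt0// mul1r; apply: le_trans rS _.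
apply: lerXn2r; rewrite ?nnegrE ?(ltW D0)//.
by have n1' := n1; rewrite /ex_D ler_peMl//; lra.
Qed.

Definition ex_mass_cst : R := (2 * c) ^+ g * (c ^+ 2 / (2 * pi)) ^+ (n - g) *
  (c ^+ 2 / (2 * pi)) / (2 * n%:R) ^+ (n - g + 2).

Lemma ex_mass_cst_gt0 : 0 < ex_mass_cst.
Proof.
have n1' := n1.
have p0 : 0 < 2 * pi :> R by rewrite mulr_gt0 ?pi_gt0.
have c2 : 0 < c ^+ 2 / (2 * pi) by rewrite divr_gt0// exprn_gt0.
have n2 : 0 < 2 * n%:R :> R by lra.
have c2' : 0 < 2 * c by rewrite mulr_gt0.
by rewrite /ex_mass_cst divr_gt0 ?exprn_gt0// mulr_gt0// mulr_gt0 ?exprn_gt0.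
Qed.

(** The coordinates contribute [S^g], [(S^2 / D)^(n-g)] and [S^2 / D^2] up to constants, and
    [D^(n-g+2)] is a constant times [S]. *)
Lemma ex_mass_ge : ((ex_mass_cst * S ^+ (2 * n + 1 - g))%:E <= leb R (n + 1) X)%E.
Proof.
have s0 i : 0 < ex_spacing R n g N i.
  have [ig|ig] := ltnP i g; first by rewrite /ex_spacing ig.
  by apply: lt_le_trans (@ex_spacing_gt R n g N gn N0 _ ig).
have w0 i : 0 <= ex_width R n g N i.
  by rewrite /ex_width; case: ifP => _; rewrite ?mulr_ge0 ?(ltW c0) ?(ltW S0).
have c12 := @ex_c_le R n g gn; have c0' := c0.
rewrite (@leb_pbox R _ _ (fun i => 2 * ex_width R n g N i * (ex_count R n g N i)%:R)); last 2 first.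
- by move=> i; exact: measurable_comb_set.
- move=> i; have [ig|ig] := ltnP i g.
    by rewrite /ex_count ig mulr1 comb_set_measure1.
  rewrite comb_set_measure//; have := @ex_spacing_gt R n g N gn N0 _ ig.
  by rewrite /ex_width ltnNge ig /=; lra.
rewrite lee_fin.
pose e (i : nat) : R := if (i < g)%N then 2 * c * S else c ^+ 2 * S ^+ 2 / ex_spacing R n g N i.
(* Truncation loses at most a factor 2 from a number at least 2; that it is at least 2 follows from
   [N^6 <= S^2] and [8 * n <= N]. *)
have cnt (i : nat) : (g <= i)%N -> c * S ^+ 2 / ex_spacing R n g N i / 2 <= (ex_count R n g N i)%:R.
  move=> ig; rewrite /ex_count ltnNge ig /=.
  set y := c * _ / _; have := truncnS_gt y; rewrite -natr1.
  suff : 2 <= y by lra.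
  rewrite /y ler_pdivlMr//.
  apply: le_trans (_ : 2 * (8 * D ^+ 2) <= _).
    rewrite ler_wpM2l// /ex_spacing ltnNge ig /=.
    have pi4 : pi <= 4 :> R by have [/andP[_]] := pihalf_02_cos_pihalf R; lra.
    have D1 : D <= D ^+ 2 by rewrite -[leLHS]expr1 ler_weXn2l//; have := D2; lra.
    have D0' := D0; have pi2 := pi_ge2 R.
    by case: ifP => _; nra.
  have S6 : N%:R ^+ 6 <= S ^+ 2.
    by rewrite (exprM _ 3 2); apply: lerXn2r ex_S_ge; rewrite nnegrE ?exprn_ge0 ?(ltW S0).
  rewrite /ex_c ler_pdivlMl; last by have := n1; lra.
  apply: le_trans S6; rewrite /ex_D.
  have -> : 12 * n%:R * (2 * (8 * (2 * n%:R * N%:R) ^+ 2)) = (768 * n%:R ^+ 3) * N%:R ^+ 2 :> R by ring.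
  rewrite (_ : 6 = 4 + 2)%N// exprD ler_wpM2r ?exprn_ge0//.
  apply: le_trans (_ : (8 * n%:R) ^+ 4 <= _); last by apply: lerXn2r; rewrite ?nnegrE ?mulr_ge0.
  rewrite (_ : 768 * n%:R ^+ 3 = 64 * (12 * n%:R ^+ 3)); last by ring.
  rewrite (_ : (8 * n%:R) ^+ 4 = 64 * (64 * n%:R * n%:R ^+ 3)); last by ring.
  by rewrite ler_wpM2l// ler_wpM2r ?exprn_ge0//; have := n1; lra.
apply: le_trans (_ : \prod_(i < n + 1) e i <= _); last first.
  apply: ler_prod => i _; apply/andP; split.
    by rewrite /e; case: ifP => _; rewrite ?divr_ge0 ?mulr_ge0 ?exprn_ge0 ?(ltW c0) ?(ltW S0) ?(ltW (s0 _)).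
  rewrite /e /ex_width; case: ltnP => ig; first by rewrite /ex_count ig mulr1 mulrA.
  have := cnt i ig; have := s0 i; move: (ex_spacing _ _ _ _ _) => s sp h.
  rewrite (_ : c ^+ 2 * S ^+ 2 / s = 2 * c * (c * S ^+ 2 / s / 2)); first by rewrite ler_wpM2l//; lra.
  by field; rewrite gt_eqF.
rewrite big_split_ord /= big_ord1 /= addn0.
rewrite (eq_bigr (fun i : 'I_n => if (i < g)%N then 2 * c * S else c ^+ 2 * S ^+ 2 / (2 * pi * D))); last first.
  by move=> i _; rewrite /e /ex_spacing ltn_ord /=; case: (ltnP i g).
rewrite (prod_if_lt _ _ (ltnW gn)) /e /ex_spacing ltnn ltnNge (ltnW gn) /=.
rewrite le_eqVlt; apply/orP; left; apply/eqP.
rewrite /ex_mass_cst.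
have SE : S = N%:R ^+ (n - g) * N%:R ^+ 2 by rewrite /ex_S exprD.
have e1 : (c ^+ 2 * S ^+ 2 / (2 * pi * D)) ^+ (n - g) =
  (c ^+ 2 / (2 * pi)) ^+ (n - g) * (S ^+ (n - g)) ^+ 2 / ((2 * n%:R) ^+ (n - g) * N%:R ^+ (n - g)).
  rewrite (_ : c ^+ 2 * S ^+ 2 / (2 * pi * D) = c ^+ 2 / (2 * pi) * S ^+ 2 / (2 * n%:R * N%:R)); last first.
    have n1' : n%:R != 0 :> R by have := n1; lra.
    have N1' : N%:R != 0 :> R by have := N1; lra.
    have pi0 : pi != 0 :> R by rewrite gt_eqF ?pi_gt0.
    rewrite /ex_D; move: (n%:R : R) (N%:R : R) n1' N1' (pi : R) pi0 c S => u v u0 v0 w w0' c' s'.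
    by field; rewrite u0 v0 w0'.
  have key (y1 y2 y3 y4 : R) k : (y1 * y2 ^+ 2 / (y3 * y4)) ^+ k = y1 ^+ k * (y2 ^+ k) ^+ 2 / (y3 ^+ k * y4 ^+ k).
    by rewrite expr_div_n (exprMn k y1) (exprMn k y3) (exprAC y2).
  exact: key.
have e2 : (2 * c * S) ^+ g = (2 * c) ^+ g * S ^+ g by rewrite exprMn.
have e3 : S ^+ (2 * n + 1 - g) = S ^+ g * (S ^+ (n - g)) ^+ 2 * S.
  rewrite -exprM -exprD -exprSr; congr (_ ^+ _).
  by rewrite mulnBl; move: (ltnW gn) => h; clear -h; lia.
rewrite e1 e2 e3 [(2 * n%:R) ^+ (n - g + 2)]exprD.
have nn : n%:R != 0 :> R by have := n1; lra.
have NN : N%:R != 0 :> R by have := N1; lra.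
have pi0 : pi != 0 :> R by rewrite gt_eqF ?pi_gt0.
have Nk : N%:R ^+ (n - g) != 0 :> R by rewrite expf_neq0.
have nk : (2 * n%:R) ^+ (n - g) != 0 :> R by rewrite expf_neq0// mulf_neq0.
rewrite /ex_D SE.
move: (S ^+ g) (n%:R : R) (N%:R : R) nn NN (pi : R) pi0 (N%:R ^+ (n - g)) Nk ((2 * n%:R) ^+ (n - g)) nk
  ((2 * c) ^+ g) ((c ^+ 2 / (2 * pi)) ^+ (n - g)) ((N%:R ^+ (n - g) * N%:R ^+ 2) ^+ (n - g)) => s u v u0 v0 w w0' vk vk0 uk uk0 x1 x2 x3.
by field; rewrite u0 v0 w0' vk0 uk0.
Qed.

End example_estimates.

(** * Comparison of exponents *)

Section power_comparison.
Variable R : realType.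

(** The comparison is asked for at arbitrarily large [S] only, because the example lives at
    [S = N^(k+1)]. *)
Lemma powR_le_exponent (c1 c2 e e' : R) : 0 < c1 ->
  (forall B, exists2 S, B <= S & c1 * S `^ e <= c2 * S `^ e') -> e <= e'.
Proof.
move=> c10 h; rewrite leNgt; apply/negP => ee.
pose d := e - e'; have d0 : 0 < d by rewrite subr_gt0.
pose y := `|c2| / c1 + 1; have y0 : 0 < y by rewrite ltr_wpDl// divr_ge0// ltW.
have [S] := h (maxr 1 (y `^ d^-1)); rewrite ge_max => /andP[S1 yS].
have S0 : 0 < S by apply: lt_le_trans S1.
rewrite (_ : e = d + e'); last by rewrite subrK.
rewrite powRD; last by rewrite (gt_eqF S0) implybT.
rewrite mulrA ler_pM2r ?powR_gt0//.
have : y <= S `^ d.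
  apply: le_trans (_ : (y `^ d^-1) `^ d <= _).
    by rewrite -powRrM mulVf ?gt_eqF// powRr1// ltW.
  by apply: ge0_ler_powR; rewrite ?nnegrE ?powR_ge0// ltW.
rewrite -(ler_pM2l c10 y) /y mulrDr mulr1 mulrCA divff ?gt_eqF// mulr1.
by have := ler_norm c2; lra.
Qed.

Lemma sqrt_powR (x e : R) : Num.sqrt (x `^ e) = x `^ (e / 2).
Proof. by rewrite -powR12_sqrt ?powR_ge0// powRrM. Qed.

End power_comparison.

(** * The assumed estimate applied to the example *)

Section example_inequality.
Variables (R : realType) (n g N : nat).
Hypothesis gn : (g < n)%N.
Hypothesis N8 : (8 * n <= N)%N.
Variables (C : nat -> R) (a b : R) (phi : R -> R).
Hypothesis hphi : bump_function C a b phi.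

Local Notation S := (ex_S R n g N).
Local Notation D := (ex_D R n N).
Local Notation lam := (@ex_lam R n g N).
Local Notation Z := (@ex_Z n g N).
Local Notation f := (ftest phi lam Z D).
Local Notation X := (@ex_set R n g N).

Let N0 : (0 < N)%N.
Proof. by apply: leq_trans N8; rewrite muln_gt0 (leq_ltn_trans _ gn). Qed.
Let N1 : 1 <= N%:R :> R. Proof. exact: ex_N1 N0. Qed.
Let S1 : 1 <= S. Proof. exact: ex_S1 N0. Qed.
Let S0 : 0 < S. Proof. exact: lt_le_trans ltr01 S1. Qed.

Lemma ex_wnorm_ge (q : \bar R) : (1 <= q)%E ->
  ((2^-1 * a ^+ n * (b ^+ n * fvol lam Z) *
    (ex_mass_cst R n g * S ^+ (2 * n + 1 - g)) `^ fine (q^-1)%E)%:E <=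
   wnorm (ex_weight R n g N) q (eball 0 (S ^+ 2)) (extension (fun z => (f z)%:C%C)))%E.
Proof.
move=> q1; have /andP[b0 _] := bump_b hphi; have a0 := bump_a hphi.
have v0 := ex_fvol_gt0 R gn N8.
have mass : ((ex_mass_cst R n g * S ^+ (2 * n + 1 - g))%:E <= wleb (ex_weight R n g N) X)%E.
  by rewrite [wleb _ _]wleb_ex_set; exact: ex_mass_ge.
rewrite /wnorm; apply: (Lnorm_ge (B := X)) => //.
- exact: measurable_ex_set.
- by rewrite !mulr_ge0 ?exprn_ge0// ltW.
- by apply: mulr_gt0; [exact: ex_mass_cst_gt0|exact: exprn_gt0].
- move=> x hx; rewrite patchE mem_set; last exact: ex_set_ball.
  rewrite /= lee_fin ger0_norm ?cabs_ge0//.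
  exact: (ex_extension_ge gn N8 hphi hx).
Qed.

(** Division by [sqrt (fvol lam Z)], the common factor of both sides. The absolute value is there
    because the constant in the assumed estimate has no prescribed sign. *)
Lemma ex_inequality (q : \bar R) (T : R) : (1 <= q)%E ->
  (wnorm (ex_weight R n g N) q (eball 0 (S ^+ 2)) (extension (fun z => (f z)%:C%C)) <=
    T%:E * L2norm (fun z => (f z)%:C%C))%E ->
  2^-1 * a ^+ n * b ^+ n * Num.sqrt (fvol lam Z) *
    (ex_mass_cst R n g * S ^+ (2 * n + 1 - g)) `^ fine (q^-1)%E <= `|T| * C 0%N ^+ n.
Proof.
move=> q1 h; have v0 := ex_fvol_gt0 R gn N8.
have s0 : 0 < Num.sqrt (fvol lam Z) by rewrite sqrtr_gt0.
have : ((2^-1 * a ^+ n * (b ^+ n * fvol lam Z) *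
    (ex_mass_cst R n g * S ^+ (2 * n + 1 - g)) `^ fine (q^-1)%E)%:E <=
  (`|T| * (C 0%N ^+ n * Num.sqrt (fvol lam Z)))%:E)%E.
  apply: le_trans (ex_wnorm_ge q1) _; apply: le_trans h _; rewrite EFinM.
  apply: le_trans (_ : (`|T|%:E * L2norm (fun z => (f z)%:C%C) <= _)%E).
    by apply: lee_wpmul2r; [exact: Lnorm_ge0|rewrite lee_fin ler_norm].
  by apply: lee_wpmul2l; [rewrite lee_fin|exact: (ex_L2norm_le gn N8 hphi)].
rewrite lee_fin -{1}(sqr_sqrtr (ltW v0)) expr2.
move: (Num.sqrt _) s0 (_ `^ _) => s s0 z h'; rewrite -(ler_pM2r s0).
by apply: le_trans (le_trans h' _); rewrite le_eqVlt; apply/orP; left; apply/eqP; ring.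
Qed.

Lemma ex_N_powR : N%:R = S `^ ((n - g + 2)%:R^-1).
Proof.
have N0' : 0 <= N%:R :> R by [].
by rewrite /ex_S -powR_mulrn// -powRrM divff ?powRr1// pnatr_eq0 addn2.
Qed.

(** Powers of 2 are dropped; the last fraction counts the [N = S^(1/(n-g+2))] teeth in each of
    [n - g] variables. *)
Lemma ex_fvol_ge :
  S `^ (- g%:R - 2 * (n - g)%:R + (n - g)%:R / (n - g + 2)%:R) <= fvol lam Z.
Proof.
rewrite ex_fvolE//.
have Sn : S != 0 by rewrite gt_eqF.
have e1 : S `^ (- g%:R) = (1 / S) ^+ g by rewrite powR_invn ?ltW// div1r exprVn.
have e2 : S `^ (- (2 * (n - g)%:R) + (n - g)%:R / (n - g + 2)%:R) = (N%:R / S ^+ 2) ^+ (n - g).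
  rewrite powRD ?Sn ?implybT// (mulrC _ (_ ^-1)) powRrM -ex_N_powR powR_mulrn//.
  by rewrite -natrM powR_invn ?ltW// expr_div_n exprM mulrC.
rewrite -addrA powRD ?Sn ?implybT// e1 e2.
have Si : 0 <= S^-1 by rewrite invr_ge0 ltW.
have Si2 : 0 <= (S ^+ 2)^-1 by rewrite invr_ge0 exprn_ge0 ?ltW.
apply: ler_pM; rewrite ?exprn_ge0 ?divr_ge0 ?exprn_ge0 ?(ltW S0)//.
  by apply: lerXn2r; rewrite ?nnegrE ?divr_ge0 ?(ltW S0)// ler_wpM2r//; lra.
by apply: lerXn2r; rewrite ?nnegrE ?divr_ge0 ?mulr_ge0 ?exprn_ge0 ?(ltW S0)// ler_wpM2r//; have := N1; lra.
Qed.

Definition ex_lower_cst (q : \bar R) : R :=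
  2^-1 * a ^+ n * b ^+ n * ex_mass_cst R n g `^ fine (q^-1)%E.

Lemma ex_lower_cst_gt0 q : 0 < ex_lower_cst q.
Proof.
have /andP[b0 _] := bump_b hphi; have a0 := bump_a hphi.
by rewrite /ex_lower_cst !mulr_gt0 ?exprn_gt0// powR_gt0// ex_mass_cst_gt0.
Qed.

Lemma ex_lower q :
  ex_lower_cst q * S `^ ((- g%:R - 2 * (n - g)%:R + (n - g)%:R / (n - g + 2)%:R) / 2 +
    (2 * n + 1 - g)%:R * fine (q^-1)%E) <=
  2^-1 * a ^+ n * b ^+ n * Num.sqrt (fvol lam Z) *
    (ex_mass_cst R n g * S ^+ (2 * n + 1 - g)) `^ fine (q^-1)%E.
Proof.
have /andP[b0 _] := bump_b hphi; have a0 := bump_a hphi.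
have Sn : S != 0 by rewrite gt_eqF.
have m0 := ex_mass_cst_gt0 R gn.
rewrite [X in _ <= _ * X]powRM ?(ltW m0) ?exprn_ge0 ?(ltW S0)// -[S ^+ (2 * n + 1 - g)]powR_mulrn ?(ltW S0)// -powRrM.
rewrite powRD ?Sn ?implybT// -sqrt_powR /ex_lower_cst.
have h := @ler_wsqrtr R _ _ ex_fvol_ge.
have k0 : 0 <= 2^-1 * a ^+ n * b ^+ n * ex_mass_cst R n g `^ fine (q^-1)%E * S `^ ((2 * n + 1 - g)%:R * fine (q^-1)%E).
  by rewrite !mulr_ge0 ?exprn_ge0 ?powR_ge0// ltW.
apply: le_trans (le_trans (ler_wpM2l k0 h) _); rewrite le_eqVlt; apply/orP; left; apply/eqP; ring.
Qed.

End example_inequality.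

(** * The bound on [beta] for a fixed [k] *)

Section necessary_condition.
Variables (R : realType) (n m k : nat) (q : \bar R).
Hypothesis k2 : (2 <= k)%N.
Hypothesis km : (k <= m)%N.
Hypothesis mn : (m <= n + 1)%N.
Hypothesis q1 : (1 <= q)%E.

Local Notation g := (n + 1 - k)%N.

Let gn : (g < n)%N.
Proof. by move: k2 km mn; lia. Qed.
Let n0 : (0 < n)%N. Proof. exact: leq_ltn_trans gn. Qed.
Let Jn : (n + 1 - m <= n)%N.
Proof. by move: k2 km; lia. Qed.

(** For [g = n + 1 - k] the left side equals [2 * beta_bound n q k], the factor 2 being that of
    [L = S ^+ 2]. *)
Lemma beta_bound_exponent (s : R) :
  (- g%:R - 2 * (n - g)%:R + (n - g)%:R / (n - g + 2)%:R) / 2 +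
    (2 * n + 1 - g)%:R * fine (q^-1)%E <= 2 * s -> beta_bound n q k <= s.
Proof.
have -> : (n - g = k - 1)%N by move: k2 km mn; lia.
have -> : (k - 1 + 2 = k.+1)%N by move: k2; lia.
have -> : (2 * n + 1 - g = n + k)%N by move: k2 km mn; lia.
have kn : (k <= n + 1)%N by exact: leq_trans mn.
rewrite (natrB _ kn) (natrB _ (ltnW k2)) /beta_bound -[k.+1%:R]natr1 !natrD.
have k0 : 0 <= k%:R :> R by [].
move: (fine _) (k%:R : R) k0 (n%:R : R) => x y y0 z h.
have y1 : y + 1 != 0 by rewrite gt_eqF// ltr_wpDl.
have e : (z + y) / 2 * (x - 2^-1) + y / (2 * (y + 1)) =
  ((- (z + 1 - y) - 2 * (y - 1) + (y - 1) / (y + 1)) / 2 + (z + y) * x) / 2.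
  by field; rewrite y1.
by rewrite e; lra.
Qed.

Variables (delta : R) (W : R -> wave_packets R n).
Variables (K : nat) (kappa cc : R) (A : nat -> R).
Hypothesis d01 : 0 < delta <= 1.
Hypothesis kappa1 : kappa <= 1.
Hypothesis hW : forall L, 1 <= L -> is_wave_packets L delta (W L) K kappa cc A.
Variables (C : nat -> R) (a b : R) (phi : R -> R).
Hypothesis hphi : bump_function C a b phi.

(** Here [N] is the order of rapid decay. A multiple of [17 * n + 2 * N] by more than [1 / delta]
    makes this power of [X = L^delta] exceed [S ^+ (5 * n + 2 * N + 12 * n)]. *)
Definition ex_decay_order (N : nat) : nat :=
  ((Num.truncn delta^-1).+1 * (17 * n + 2 * N))%N.

Definition ex_rapid_decay (N : nat) : R :=
  concentration_cst n K A C a b N (ex_decay_order N).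

Section large_parameter.
Variable N : nat.
Hypothesis N8 : (8 * n <= N)%N.

Local Notation S := (ex_S R n g N).
Local Notation D := (ex_D R n N).
Local Notation lam := (@ex_lam R n g N).
Local Notation Z := (@ex_Z n g N).
Local Notation f := (ftest phi lam Z D).
Local Notation X := ((S ^+ 2) `^ delta).

Hypothesis X8 : 8 * n%:R * (K%:R + 4) <= X.
Hypothesis SK : K%:R <= S.

Let N0 : (0 < N)%N. Proof. by apply: leq_trans N8; rewrite muln_gt0. Qed.
Let S1 : 1 <= S. Proof. exact: ex_S1 N0. Qed.
Let S0 : 0 < S. Proof. exact: lt_le_trans ltr01 S1. Qed.

Lemma ex_X_powR (s : R) : X `^ s = S `^ (2 * delta * s).
Proof. by rewrite -(@powR_mulrn _ S 2) ?(ltW S0)// -!powRrM mulrA. Qed.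

Lemma ex_concentrated :
  concentrated (S ^+ 2) delta (W (S ^+ 2)) (coord_poly R Jn) (X ^+ 2) ex_rapid_decay
    (fun z => (f z)%:C%C).
Proof.
move=> M; have hWS := hW (exprn_ege1 2 S1); have /andP[d0 d1] := d01.
apply: (concentrated_ftest_le n0 erefl erefl d01 X8 (@ex_S8 R n g N gn N8) SK hWS kappa1 hphi
  (D := D) (Zm := N)).
- by have := @ex_D2 R n g N gn N0; lra.
- exact: ex_Dlam.
- exact: ex_Slam.
- exact: ex_Z_le.
- exact: ex_N_le_S.
- by move=> i iJ; rewrite /ex_lam ifT//; apply: leq_trans iJ _; rewrite leq_sub2l.
- move=> x hx i; have [h1 h2] := ex_fsupp_small gn N8 hx i; split.
    by apply: le_trans h1 _; rewrite invf_le1 ?ler1n// ltr0n.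
  by move=> iJ; apply: h2; apply: leq_trans iJ _; rewrite leq_sub2l.
(* A cap covering 0 exists, and the bound on its cutoff shows [0 <= A 0]. *)
- have [|t _ _] := theta_cover hWS (t := 0); first by rewrite /eball /= subr0 enorm0.
  exact: le_trans (normr_ge0 _) (deriv_bounds0 0 (psi_bounds hWS t)).
- rewrite -[X in _ <= X]powR_mulrn ?powR_ge0// ex_X_powR -powR_mulrn ?(ltW S0)//.
  apply: ler_powR => //.
  rewrite (_ : 5 * n + 2 * M + 12 * n = 17 * n + 2 * M)%N; last by lia.
  rewrite /ex_decay_order natrM mulrA ler_peMl// -mulrA.
  have : delta^-1 <= (Num.truncn delta^-1).+1%:R by rewrite ltW// truncnS_gt.
  rewrite -(ler_pM2l d0 delta^-1) divff ?gt_eqF//; lra.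
Qed.

(** With [E = X^2 = L^(2 delta)] the factor [E^Cexp] is at most [L^(2 eps |Cexp|)], which explains
    [1 + 2 * |Cexp|]. *)
Lemma ex_upper (beta Cexp eps delta_deg Ceps : R) : 0 < delta_deg -> delta <= eps ->
  (forall (L E : R) (P : 'I_(n + 1 - m) -> mpoly.mpoly (n + 1) R)
            (f : 'rV[R]_n -> R[i]) (H : weight R (n + 1)),
       1 <= L -> L `^ delta <= E ->
       transverse_complete_intersection P ->
       (forall l, (total_degree (P l))%:R <= L `^ delta_deg) ->
       L2_ball f ->
       concentrated L delta (W L) P E ex_rapid_decay f ->
       dimensional H n%:R (Num.sqrt L) (4 ^+ n.+1) ->
       (wnorm H q (eball 0%R L) (extension f) <=
         (Ceps * E `^ Cexp * L `^ eps * L `^ beta)%:E * L2norm f)%E) ->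
  ex_lower_cst n g a b q * S `^ ((- g%:R - 2 * (n - g)%:R + (n - g)%:R / (n - g + 2)%:R) / 2 +
    (2 * n + 1 - g)%:R * fine (q^-1)%E) <=
  `|Ceps| * C 0%N ^+ n * S `^ (2 * (beta + eps * (1 + 2 * `|Cexp|))).
Proof.
move=> dd de h; have /andP[d0 d1] := d01.
have L1 : 1 <= S ^+ 2 by rewrite exprn_ege1.
have X1 : 1 <= X by rewrite -(powRr0 (S ^+ 2)) ler_powR// ltW.
apply: le_trans (ex_lower gn N8 hphi q) _.
apply: le_trans (ex_inequality gn N8 hphi q1 (h _ (X ^+ 2) (coord_poly R Jn) _ _ L1 _ _ _ _ _ _)) _.
- by rewrite -[leLHS]expr1 ler_weXn2l.
- exact: transverse_coord_poly.
- by move=> l; rewrite total_degree_coord_poly -(powRr0 (S ^+ 2)) ler_powR// ltW.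
- by have := ex_L2_ball gn N8 hphi.
- exact: ex_concentrated.
- by rewrite sqrtr_sqr ger0_norm ?(ltW S0)//; exact: ex_dimensional.
have C0 : 0 <= C 0%N by have := le_trans (bump_ge0 hphi 0) (le_trans (ler_norm _) (bump_le hphi 0)).
rewrite [leRHS]mulrAC; apply: ler_wpM2r; first exact: exprn_ge0.
rewrite -!mulrA normrM ler_wpM2l// ger0_norm ?mulr_ge0 ?powR_ge0//.
rewrite -(@powR_mulrn _ X 2) ?powR_ge0// -powRrM ex_X_powR -(@powR_mulrn _ S 2) ?(ltW S0)// -!powRrM.
have Sn : S != 0 by rewrite gt_eqF.
rewrite -!powRD ?Sn ?implybT//; apply: ler_powR => //.
have : delta * Cexp <= eps * `|Cexp|.
  apply: le_trans (_ : delta * `|Cexp| <= _); first by rewrite ler_wpM2l ?ler_norm// ltW.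
  by rewrite ler_wpM2r.
by lra.
Qed.

End large_parameter.

Lemma exists_large_parameter (B : R) : exists N : nat,
  [/\ (8 * n <= N)%N, B <= ex_S R n g N, K%:R <= ex_S R n g N &
    8 * n%:R * (K%:R + 4) <= ((ex_S R n g N) ^+ 2) `^ delta].
Proof.
have /andP[d0 d1] := d01.
pose y : R := 8 * n%:R * (K%:R + 4); have y0 : 0 <= y by rewrite mulr_ge0// addr_ge0.
pose N := (8 * n + K + (Num.truncn B).+1 + (Num.truncn (y `^ delta^-1)).+1)%N.
have N8 : (8 * n <= N)%N by rewrite /N; clear; lia.
have NS : N%:R <= ex_S R n g N by exact: ex_N_le_S.
have BN : B <= N%:R.
  apply: le_trans (_ : (Num.truncn B).+1%:R <= _); first by rewrite ltW// truncnS_gt.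
  by rewrite ler_nat /N; clear; lia.
have yN : y `^ delta^-1 <= N%:R.
  apply: le_trans (_ : (Num.truncn (y `^ delta^-1)).+1%:R <= _); first by rewrite ltW// truncnS_gt.
  by rewrite ler_nat /N; clear; lia.
exists N; split => //.
- exact: le_trans NS.
- by apply: le_trans NS; rewrite ler_nat /N; clear; lia.
apply: le_trans (_ : (y `^ delta^-1) `^ delta <= _).
  by rewrite -powRrM mulVf ?gt_eqF// powRr1.
apply: ge0_ler_powR; rewrite ?nnegrE ?powR_ge0 ?(ltW d0) ?sqr_ge0//.
by apply: le_trans yN (le_trans NS _); exact: ex_S_le_sqr.
Qed.

Lemma beta_bound_le_delta (beta Cexp eps delta_deg : R) : 0 < delta_deg -> delta <= eps ->
  (forall CN : nat -> R, exists Ceps : R,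
     forall (L E : R) (P : 'I_(n + 1 - m) -> mpoly.mpoly (n + 1) R)
            (f : 'rV[R]_n -> R[i]) (H : weight R (n + 1)),
       1 <= L -> L `^ delta <= E ->
       transverse_complete_intersection P ->
       (forall l, (total_degree (P l))%:R <= L `^ delta_deg) ->
       L2_ball f ->
       concentrated L delta (W L) P E CN f ->
       dimensional H n%:R (Num.sqrt L) (4 ^+ n.+1) ->
       (wnorm H q (eball 0%R L) (extension f) <=
         (Ceps * E `^ Cexp * L `^ eps * L `^ beta)%:E * L2norm f)%E) ->
  beta_bound n q k <= beta + eps * (1 + 2 * `|Cexp|).
Proof.
move=> dd de /(_ ex_rapid_decay)[Ceps h]; apply: beta_bound_exponent.
apply: (powR_le_exponent (ex_lower_cst_gt0 gn hphi q)) => B.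
have [N [N8 BN KN XN]] := exists_large_parameter B.
by exists (ex_S R n g N) => //; exact: (ex_upper N8 XN KN dd de h).
Qed.

End necessary_condition.

Theorem mainTheorem3 (R : realType) (n m : nat) (q : \bar R) (beta : R)
    (W : R -> R -> wave_packets R n) (thr : R -> R) :
  (2 <= m)%N -> (m <= n + 1)%N -> (1 <= q)%E ->
  (forall delta, 0 < delta -> uniform_wave_packets delta (W delta)) ->
  smallness_threshold thr ->
  (exists C : R, forall eps CH : R, 0 < eps -> 0 < CH ->
   exists delta delta_deg : R,
     [/\ 0 < delta_deg, delta_deg < thr delta, 0 < delta & delta < thr eps] /\
     forall CN : nat -> R, exists Ceps : R,
     forall (L E : R) (P : 'I_(n + 1 - m) -> mpoly.mpoly (n + 1) R)
            (f : 'rV[R]_n -> R[i]) (H : weight R (n + 1)),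
       1 <= L -> L `^ delta <= E ->
       transverse_complete_intersection P ->
       (forall l, (total_degree (P l))%:R <= L `^ delta_deg) ->
       L2_ball f ->
       concentrated L delta (W delta L) P E CN f ->
       dimensional H n%:R (Num.sqrt L) CH ->
       (wnorm H q (eball 0%R L) (extension f) <=
         (Ceps * E `^ C * L `^ eps * L `^ beta)%:E * L2norm f)%E) ->
  \big[Num.max/beta_bound n q 2]_(2 <= k < m.+1) beta_bound n q k <= beta.
Proof.
move=> m2 mn q1 hW hthr [C hC].
have main k : (2 <= k)%N -> (k <= m)%N -> beta_bound n q k <= beta.
  move=> k2 km; apply/ler_addgt0Pr => e e0.
  have n0 : (0 < n)%N by move: m2 mn; lia.
  have C1 : 0 < 1 + 2 * `|C| by rewrite ltr_pwDl// mulr_ge0.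
  (* The total loss is then at most [e], and [delta <= eps <= 1]. *)
  pose eps := minr 1 (e / (1 + 2 * `|C|)).
  have eps0 : 0 < eps by rewrite lt_min ltr01 divr_gt0.
  (* [4 ^+ n.+1] is the constant of [ex_dimensional]. *)
  have [delta [ddeg [[dd _ d0 dt]]]] := hC eps (4 ^+ n.+1) eps0 (exprn_gt0 _ (ltr0n _ 4)).
  have /andP[_ te] := hthr eps eps0; have de := le_trans (ltW dt) te.
  have d01 : 0 < delta <= 1 by rewrite d0 (le_trans de)// ge_min lexx.
  have [K [kappa [cc [A [/andP[_ kappa1] _ hWd]]]]] := hW delta d0.
  (* Only the scale [L = 1] of this family is used, to produce the bump; its parameter 1 is an
     arbitrary choice. *)
  have [K1 [kappa' [cc' [A' [kappa01 _ hW1]]]]] := hW 1 ltr01.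
  have [Cb [a [b [phi hphi]]]] := exists_bump n0 kappa01 (hW1 1 (lexx 1)).
  move=> h; apply: le_trans (beta_bound_le_delta k2 km mn q1 d01 (ltW kappa1) hWd hphi dd de h) _.
  rewrite lerD2l; apply: le_trans (_ : e / (1 + 2 * `|C|) * (1 + 2 * `|C|) <= _).
    by rewrite ler_wpM2r ?(ltW C1)// ge_min lexx orbT.
  by rewrite divfK// gt_eqF.
(* The initial value of the maximum is the term [k = 2], covered because [2 <= m]. *)
rewrite big_seq; elim/big_ind: _ => [|x y hx hy|k].
- exact: main.
- by rewrite ge_max hx hy.
- by rewrite mem_index_iota ltnS => /andP[k2 km]; exact: main.
Qed.
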